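(* There exists an absolute constant $C>0$ such that the following holds. Let $X=(X_1,\ldots,X_n)$ be a random vector whose coordinates $X_i$ are real-valued independent random variables. Let $t,p\ge 0$ be such that $$\mathcal{L}(X_i,t)\le p\quad\text{for all } i=1,\ldots,n.$$ Then for every non-zero $m\times n$ real matrix $A$ and for every $M\ge 1$ we have $$\mathcal{L}(AX,\,Mt\|A\|_{\mathrm{HS}})\le\left(\frac{CMp}{\sqrt{\delta(A)}}\right)^{r(A)}$$ provided $\delta(A)>0$. Moreover, if $\delta(A)<0.4$, then $$\mathcal{L}(AX,\,Mt\|A\|_{\mathrm{HS}})\le (CMp)^{r_0(A)},$$ where $r_0(A)=\lceil(1-2\delta(A))\,r(A)\rceil$.
   Context: For a random vector $Z$ taking values in $\mathbb{R}^k$, the concentration function is $\mathcal{L}(Z,t)=\max_{u\in\mathbb{R}^k}\mathbb{P}\{\|Z-u\|_2\le t\}$ for $t\ge 0$, where $\|\cdot\|_2$ is the Euclidean norm (for real-valued $X_i$, $k=1$). $\|A\|_{\mathrm{HS}}$ denotes the Hilbert-Schmidt (Frobenius) norm and $\|A\|$ the operator (spectral) norm of $A$. The singular values of $A$ in non-increasing order are $s_j(A)$, $j=1,\ldots,\min(m,n)$, and $s_j(A)=0$ for $j>\min(m,n)$. The stable rank of $A$ is $$r(A)=\left\lfloor\frac{\|A\|_{\mathrm{HS}}^2}{\|A\|^2}\right\rfloor=\left\lfloor\frac{\sum_{j=1}^\infty s_j(A)^2}{s_1(A)^2}\right\rfloor,$$ and $$\delta(A)=\frac{\sum_{j=r(A)+1}^\infty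 s_j(A)^2}{\sum_{j=1}^\infty s_j(A)^2},$$ so $0\le\delta(A)\le 1$. *)

(* Defs.v *)
From HB Require Import structures.
From mathcomp Require Import all_boot all_order all_algebra.
From mathcomp Require Import polyrcf.
From mathcomp Require Import all_classical all_reals all_analysis.
Set Implicit Arguments.
Unset Strict Implicit.
Unset Printing Implicit Defensive.
Import Order.TTheory GRing.Theory Num.Theory.

Local Open Scope classical_set_scope.
Local Open Scope ring_scope.

(* The library's norm on matrices is the maximum norm, so the Euclidean,
   Hilbert-Schmidt and operator norms are defined here. *)
Definition l2norm (R : realType) (k : nat) (x : 'cV[R]_k) : R :=
  Num.sqrt (\sum_(i < k) x i 0 ^+ 2).

Definition hsnorm (R : realType) (m n : nat) (A : 'M[R]_(m, n)) : R :=
  Num.sqrt (\sum_(i < m) \sum_(j < n) A i j ^+ 2).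

Definition opnorm (R : realType) (m n : nat) (A : 'M[R]_(m, n)) : R :=
  sup [set l2norm (A *m x) | x in [set x : 'cV[R]_n | l2norm x <= 1]].

(* Square roots of the eigenvalues of A^T A, repeated according to their
   multiplicities. The list has n entries; when m < n, its last n - m entries
   are 0. *)
Definition singular_values (R : realType) (m n : nat) (A : 'M[R]_(m, n)) :
    seq R :=
  let p := char_poly (A^T *m A) in
  sort >=%R (flatten [seq nseq (mup x p) (Num.sqrt x) | x <- rootsR p]).

(* Indices start at 0: [singval A j] is s_{j+1}(A). *)
Definition singval (R : realType) (m n : nat) (A : 'M[R]_(m, n)) (j : nat) : R :=
  (singular_values A)`_j.

Definition stable_rank (R : realType) (m n : nat) (A : 'M[R]_(m, n)) : nat :=
  Num.truncn (hsnorm A ^+ 2 / opnorm A ^+ 2).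

(* The series over j are finite sums, as s_j(A) = 0 for j > min(m, n). *)
Definition delta (R : realType) (m n : nat) (A : 'M[R]_(m, n)) : R :=
  (\sum_(stable_rank A <= j < minn m n) singval A j ^+ 2) /
  (\sum_(0 <= j < minn m n) singval A j ^+ 2).

Definition stable_rank0 (R : realType) (m n : nat) (A : 'M[R]_(m, n)) : int :=
  Num.ceil ((1 - 2 * delta A) * (stable_rank A)%:R).

(* The supremum over u is attained when Z is measurable and t >= 0. *)
Definition concentration (d : measure_display) (T : measurableType d)
    (R : realType) (P : probability T R) (k : nat) (Z : T -> 'cV[R]_k) (t : R) :
    \bar R :=
  ereal_sup (range (fun u : 'cV[R]_k => P [set w | l2norm (Z w - u) <= t])).

Definition mutually_independent (d : measure_display) (T : measurableType d)
    (R : realType) (P : probability T R) (n : nat) (X : 'I_n -> {RV P >-> R}) :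
    Prop :=
  forall (J : {set 'I_n}) (B : 'I_n -> set R),
    (forall i, measurable (B i)) ->
    P (\bigcap_(i in [set` J]) (X i @^-1` B i)) =
    (\prod_(i in J) P (X i @^-1` B i))%E.

(* Main.v *)
(** The density (in the smoothed, discretized form used here) of the projection
    of a product measure to a [k]-dimensional space is bounded by the geometric
    Brascamp-Lieb inequality applied on the orthogonal complement of that space.
    If [c_i] is the squared length of the projection of the [i]-th basis vector
    to the complement, the [c_i] sum to [n - k], and an [i]-th factor bounded by
    [K] with integral at most 1 has [L^(1/c_i)]-norm at most [K^(1 - c_i)]; the
    product of these bounds is [K^k], and the constants [c_i^(- c_i / 2)] cost
    only [e^(k / 2)]. The Brascamp-Lieb inequality itself is obtained from the
    heat flow, run in discrete time as a random walk with small steps built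
    from uniform signs, so that only finite sums occur.

    For a general matrix [A], normalized to have operator norm 1, replace the
    projection by [A^T A / kappa]. Its eigenvalues, cut off at 1, sum to at
    least [r(A)] when [kappa = delta(A)], and to at least [r_0(A)] when
    [kappa = 1/2]. The Gaussian expectation is convex in the eigenvalues, hence
    it suffices to bound it at the vertices of the hypersimplex, where the
    quadratic form is a projection. *)

Require Import Defs.
From HB Require Import structures.
From mathcomp Require Import all_boot all_order all_algebra.
From mathcomp Require Import polyrcf complex spectral.
From mathcomp Require Import ring lra.
From mathcomp Require Import all_classical all_reals all_analysis measurable_realfun.
Set Implicit Arguments.
Unset Strict Implicit.
Unset Printing Implicit Defensive.
Import Order.TTheory GRing.Theory Num.Theory.
Import numFieldNormedType.Exports.

Local Open Scope classical_set_scope.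
Local Open Scope ring_scope.

(** * Elementary inequalities *)

(** The [X i] have arbitrary laws, so they are rounded to a grid of step t / (n + 1), which moves AX
    by at most t |A|_HS; a product of finitely supported weights remains. The ball is compared with
    a Gaussian weight by an exponential Markov inequality: with a window of width M t / sqrt kappa,
    a point of the ball costs a factor e^c with c of the order of |A|_HS^2 / |A|^2 < r(A) + 1. To
    hide this factor in a k-th power, r(A) must be at most a constant times k. For k = r_0(A) this
    comes from delta(A) < 0.4: then 1 - 2 delta(A) > 1/5, so r(A) <= 5 k.

    A discrete heat flow is monotone only up to errors. A step of size d loses a factor exp (O(d^3))
    and there are l^2 / d^2 steps, so the total loss vanishes with d, provided that the implied
    constant is the same at every step. The limit of infinite time is avoided as well: because the
    weights are finitely supported, a large finite l that depends on them is enough. *)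

Section Elementary.
Variable R : realType.
Implicit Types x y z s w : R.

Lemma ge0_of_derive_ge0 (f df : R -> R) (b : R) :
  (forall x, 0 <= x <= b -> is_derive x 1 f (df x)) ->
  (forall x, 0 <= x <= b -> 0 <= df x) -> 0 <= f 0 ->
  forall x, 0 <= x <= b -> 0 <= f x.
Proof.
move=> fdf df0 f0 x /andP[x0 xb].
have [||c cx] := @MVT_segment R f df 0 x x0.
- by move=> y; rewrite in_itv/= => /andP[y0 yx]; apply: fdf; lra.
- apply: derivable_within_continuous => y; rewrite in_itv/= => /andP[y0 yx].
  by have := fdf y; rewrite y0 (le_trans yx xb) => /(_ isT) [].
move: cx; rewrite in_itv/= subr0 => /andP[c0 cx] fE.
have := df0 c; rewrite c0 (le_trans cx xb) => /(_ isT) dfc.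
have : 0 <= df c * x by apply: mulr_ge0.
lra.
Qed.

Lemma expR_sub1_le x : 0 <= x -> expR x - 1 <= x * expR x.
Proof.
move=> x0; have := expR_ge1Dx (- x); have := expRxMexpNx_1 x.
have := expR_gt0 x; nra.
Qed.

Lemma expR_sub1Dx_le x : 0 <= x -> expR x - 1 - x <= x ^+ 2 * expR x.
Proof.
move=> x0; rewrite -subr_ge0.
apply: (@ge0_of_derive_ge0 (fun x => x ^+ 2 * expR x - (expR x - 1 - x))
  (fun x => (2 * x + x ^+ 2) * expR x - (expR x - 1)) x); last by lra.
- move=> y _; apply: is_derive_eq; rewrite /GRing.scale/=; ring.
- move=> y /andP[y0 _]; have := expR_sub1_le y0.
  have := expR_gt0 y; have := sqr_ge0 y; nra.
- by rewrite expR0; lra.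
Qed.

Lemma expR_taylor2_pos x : 0 <= x ->
  0 <= expR x - 1 - x - x ^+ 2 / 2 <= x ^+ 3 * expR x.
Proof.
move=> x0; apply/andP; split.
  apply: (@ge0_of_derive_ge0 (fun x => expR x - 1 - x - x ^+ 2 / 2)
  (fun x => expR x - 1 - x) x); last by lra.
  - move=> y _; apply: is_derive_eq; rewrite /GRing.scale/=; by field.
  - by move=> y _; rewrite -addrA -opprD subr_ge0 expR_ge1Dx.
  - by rewrite expR0; lra.
rewrite -subr_ge0.
apply: (@ge0_of_derive_ge0 (fun x => x ^+ 3 * expR x - (expR x - 1 - x - x ^+ 2 / 2))
  (fun x => (3 * x ^+ 2 + x ^+ 3) * expR x - (expR x - 1 - x)) x); last by lra.
- move=> y _; apply: is_derive_eq; rewrite /GRing.scale/=; by field.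
- move=> y /andP[y0 _]; have := expR_sub1Dx_le y0.
  have : 0 <= y ^+ 2 * expR y by rewrite mulr_ge0 ?sqr_ge0 ?expR_ge0.
  have : 0 <= y ^+ 3 * expR y by rewrite mulr_ge0 ?exprn_ge0 ?expR_ge0.
  lra.
- by rewrite expR0; lra.
Qed.

Lemma expRN_le_taylor2 x : 0 <= x -> expR (- x) <= 1 - x + x ^+ 2 / 2.
Proof.
move=> x0; rewrite -subr_ge0.
apply: (@ge0_of_derive_ge0 (fun x => 1 - x + x ^+ 2 / 2 - expR (- x))
  (fun x => - 1 + x + expR (- x)) x); last by lra.
- move=> y _; apply: is_derive_eq; rewrite /GRing.scale/=; by field.
- by move=> y _; have := expR_ge1Dx (- y); lra.
- by rewrite oppr0 expR0; lra.
Qed.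

Lemma expRN_ge_taylor3 x : 0 <= x ->
  1 - x + x ^+ 2 / 2 - x ^+ 3 / 6 <= expR (- x).
Proof.
move=> x0; rewrite -subr_ge0.
apply: (@ge0_of_derive_ge0 (fun x => expR (- x) - (1 - x + x ^+ 2 / 2 - x ^+ 3 / 6))
  (fun x => 1 - x + x ^+ 2 / 2 - expR (- x)) x); last by lra.
- move=> y _; apply: is_derive_eq; rewrite /GRing.scale/=; by field.
- by move=> y /andP[y0 _]; have := expRN_le_taylor2 y0; lra.
- by rewrite oppr0 expR0; lra.
Qed.

Lemma expR_ge_taylor3 x : 0 <= x ->
  1 + x + x ^+ 2 / 2 + x ^+ 3 / 6 <= expR x.
Proof.
move=> x0; rewrite -subr_ge0.
apply: (@ge0_of_derive_ge0 (fun x => expR x - (1 + x + x ^+ 2 / 2 + x ^+ 3 / 6))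
  (fun x => expR x - 1 - x - x ^+ 2 / 2) x); last by lra.
- move=> y _; apply: is_derive_eq; rewrite /GRing.scale/=; by field.
- by move=> y /andP[y0 _]; have /andP[] := expR_taylor2_pos y0.
- by rewrite expR0; lra.
Qed.

Lemma expR_taylor2 w :
  `|expR w - 1 - w - w ^+ 2 / 2| <= `|w| ^+ 3 * expR `|w|.
Proof.
have [w0|w0] := leP 0 w.
  by have /andP[? ?] := expR_taylor2_pos w0; rewrite !ger0_norm.
have x0 : 0 <= - w by lra.
have := expRN_ge_taylor3 x0; have := expRN_le_taylor2 x0.
rewrite opprK (ltr0_norm w0) ler_norml => h1 h2.
have e1 : 1 <= expR (- w) by rewrite -expR0 ler_expR.
have x30 : 0 <= (- w) ^+ 3 by apply: exprn_ge0.
have := ler_wpM2l x30 e1; rewrite mulr1.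
have -> : w ^+ 2 = (- w) ^+ 2 by rewrite sqrrN.
by move=> ?; apply/andP; split; lra.
Qed.

Lemma ln1D_taylor2 z : `|z| <= 2^-1 ->
  `|ln (1 + z) - z + z ^+ 2 / 2| <= `|z| ^+ 3.
Proof.
have [z0|z0] := leP 0 z.
  rewrite ger0_norm// => z1; rewrite ger0_norm.
  - rewrite -subr_ge0.
    apply: (@ge0_of_derive_ge0 (fun z => z ^+ 3 - (ln (1 + z) - z + z ^+ 2 / 2))
      (fun z => 3 * z ^+ 2 - ((1 + z)^-1 - 1 + z)) z); last by lra.
    + move=> y /andP[y0 _]; have y1 : 0 < 1 + y by lra.
      have := is_derive1_ln y1 => ?.
      apply: is_derive_eq; rewrite /GRing.scale/=; field; do ?[apply/andP; split]; lra.
    + move=> y /andP[y0 _]; have y1 : 1 + y != 0 by lra.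
      have -> : 3 * y ^+ 2 - ((1 + y)^-1 - 1 + y) = y ^+ 2 * (2 + 3 * y) / (1 + y).
        by field.
      by rewrite divr_ge0 ?mulr_ge0 ?sqr_ge0//; lra.
    + by rewrite addr0 ln1; lra.
  - apply: (@ge0_of_derive_ge0 (fun z => (ln (1 + z) - z + z ^+ 2 / 2))
      (fun z => ((1 + z)^-1 - 1 + z)) z); last by lra.
    + move=> y /andP[y0 _]; have y1 : 0 < 1 + y by lra.
      have := is_derive1_ln y1 => ?.
      apply: is_derive_eq; rewrite /GRing.scale/=; field; do ?[apply/andP; split]; lra.
    + move=> y /andP[y0 _]; have y1 : 1 + y != 0 by lra.
      have -> : ((1 + y)^-1 - 1 + y) = y ^+ 2 / (1 + y) by field.
      by rewrite divr_ge0 ?mulr_ge0 ?sqr_ge0//; lra.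
    + by rewrite addr0 ln1; lra.
rewrite ltr0_norm// => z1; have [t tE] : exists t, z = - t by exists (- z); rewrite opprK.
rewrite {}tE opprK in z0 z1 *; have t0 : 0 <= t by lra.
rewrite sqrrN ler0_norm.
- rewrite -subr_ge0.
  apply: (@ge0_of_derive_ge0 (fun z => z ^+ 3 - - (ln (1 - z) + z + z ^+ 2 / 2))
      (fun z => 3 * z ^+ 2 - ((1 - z)^-1 - 1 - z)) t); last by lra.
  + move=> y /andP[y0 yt]; have y1 : 0 < 1 - y by lra.
    have := is_derive1_ln y1 => ?.
    apply: is_derive_eq; rewrite /GRing.scale/=; field; do ?[apply/andP; split]; lra.
  + move=> y /andP[y0 yt]; have y1 : 1 - y != 0 by lra.
    have -> : 3 * y ^+ 2 - ((1 - y)^-1 - 1 - y) = y ^+ 2 * (2 - 3 * y) / (1 - y).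
      by field.
    by rewrite divr_ge0 ?mulr_ge0 ?sqr_ge0//; lra.
  + by rewrite subr0 ln1; lra.
- rewrite -oppr_ge0.
  apply: (@ge0_of_derive_ge0 (fun z => - (ln (1 - z) + z + z ^+ 2 / 2))
      (fun z => ((1 - z)^-1 - 1 - z)) t); last by lra.
  + move=> y /andP[y0 yt]; have y1 : 0 < 1 - y by lra.
    have := is_derive1_ln y1 => ?.
    apply: is_derive_eq; rewrite /GRing.scale/=; field; do ?[apply/andP; split]; lra.
  + move=> y /andP[y0 yt]; have y1 : 1 - y != 0 by lra.
    have -> : ((1 - y)^-1 - 1 - y) = y ^+ 2 / (1 - y) by field.
    by rewrite divr_ge0 ?mulr_ge0 ?sqr_ge0//; lra.
  + by rewrite subr0 ln1; lra.
Qed.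

Definition cosh x : R := (expR x + expR (- x)) / 2.

Lemma coshN x : cosh (- x) = cosh x.
Proof. by rewrite /cosh opprK addrC. Qed.

Lemma cosh_ge x : 1 + x ^+ 2 / 2 <= cosh x.
Proof.
wlog x0 : x / 0 <= x.
  move=> h; have [/h//|x0] := leP 0 x.
  by rewrite -coshN -sqrrN; apply: h; lra.
by rewrite /cosh; have := expRN_ge_taylor3 x0; have := expR_ge_taylor3 x0; lra.
Qed.

(** The derivative of 1 - cosh x exp (- x^2 / 2) has the sign of x cosh x - sinh x, whose own
    derivative x sinh x is nonnegative. *)
Lemma cosh_le x : cosh x <= expR (x ^+ 2 / 2).
Proof.
wlog x0 : x / 0 <= x.
  move=> h; have [/h//|x0] := leP 0 x.
  by rewrite -coshN -sqrrN; apply: h; lra.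
suff : 0 <= 1 - cosh x * expR (- (x ^+ 2 / 2)).
  have := expRxMexpNx_1 (x ^+ 2 / 2); have := expR_gt0 (x ^+ 2 / 2).
  set a := expR _; set b := expR (- _) => a0 ab h.
  have : 0 <= a * (1 - cosh x * b) by apply: mulr_ge0 => //; lra.
  have -> : a * (1 - cosh x * b) = a - cosh x * (a * b) by ring.
  rewrite ab; lra.
apply: (@ge0_of_derive_ge0 (fun x => 1 - cosh x * expR (- (x ^+ 2 / 2)))
  (fun x => expR (- (x ^+ 2 / 2)) * (x * cosh x - (expR x - expR (- x)) / 2)) x) => //;
  last by lra.
- move=> y _; rewrite /cosh; apply: is_derive_eq; rewrite /GRing.scale/=; by field.
- move=> y /andP[y0 _]; apply: mulr_ge0; first exact: expR_ge0.
  apply: (@ge0_of_derive_ge0 (fun x => x * cosh x - (expR x - expR (- x)) / 2)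
    (fun x => x * ((expR x - expR (- x)) / 2)) y); last by lra.
  + move=> t _; rewrite /cosh; apply: is_derive_eq; rewrite /GRing.scale/=; by field.
  + move=> t /andP[t0 _]; apply: mulr_ge0 => //.
    have : expR (- t) <= expR t by rewrite ler_expR; lra.
    lra.
  + by rewrite oppr0 subrr mul0r mul0r subr0.
- by rewrite /cosh oppr0 expR0 expr0n/= mul0r oppr0 expR0; lra.
Qed.

End Elementary.

(** * Gaussian functions: discrete heat equation and Taylor expansions *)

Section Gauss.
Variable R : realType.
Implicit Types x y z s w t k : R.

(* The expectation of [expR (- ((s + Z) ^+ 2 / 2))] for a centred Gaussian [Z] of
   variance [t]. *)
Definition heat t s : R := expR (- (s ^+ 2 / (1 + t) / 2)) / Num.sqrt (1 + t).

(** In [heat_step], with X = s^2 / (1 + t) and E = k^2 / (1 + t), the mean of the two shifted values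
    is, up to the factor 1 / sqrt (1 + t), exp (- (X + E) / 2) cosh z with z^2 = X E. This lemma
    serves the upper estimate [cosh_le], and [gauss_step_ge] the lower one [cosh_ge]; both errors
    have to be of order E^2 uniformly in X. *)
Lemma gauss_step_le (X E : R) : 0 <= X -> 0 <= E <= 2^-1 ->
  expR (- (X / 2) - E / 2 + X * E / 2) <=
    expR (- (X / (1 + E) / 2)) / Num.sqrt (1 + E) + 2 * E ^+ 2.
Proof.
move=> X0 /andP[E0 E1].
have e1 : 0 < 1 + E by lra.
have s1 : 0 < Num.sqrt (1 + E) by rewrite sqrtr_gt0.
have h1 : expR (- (E / 2)) <= (Num.sqrt (1 + E))^-1.
  rewrite -[leRHS]invrK expRN lef_pV2 ?posrE ?invr_gt0 ?expR_gt0 ?invrK//.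
  rewrite -(@ler_pXn2r _ 2) ?nnegrE ?expR_ge0 ?sqrtr_ge0// sqr_sqrtr; last by lra.
  by rewrite -expRM_natr (_ : E / 2 * 2%:R = E) ?expR_ge1Dx//; field.
have h2 : expR (- (X * (1 - E) / 2)) <= expR (- (X / (1 + E) / 2)) + 2 * E ^+ 2.
  set p := - (X * (1 - E) / 2); set q := - (X / (1 + E) / 2).
  have pq : p - q = X * E ^+ 2 / (1 + E) / 2 by rewrite /p /q; field; lra.
  have h3 : expR p * (1 + (q - p)) <= expR q.
    by rewrite -[in leRHS](subrK p q) expRD [leRHS]mulrC ler_wpM2l ?expR_ge0// expR_ge1Dx.
  (* [p - q] contains the unbounded factor [X]; [expR p] absorbs it, as p <= - X / 4 for E <=
     1/2. *)
  have h4 : X * expR p <= 4.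
    have : 1 + X / 4 <= expR (X / 4) by exact: expR_ge1Dx.
    have : expR p <= expR (- (X / 4)) by rewrite ler_expR /p; nra.
    have := expRxMexpNx_1 (X / 4); have := expR_gt0 (- (X / 4)); have := expR_gt0 p.
    set a := expR (X / 4); set b := expR (- _); set c := expR p => *.
    have : X / 4 * c <= a * b by apply: ler_pM; lra.
    lra.
  have h5 : expR p * (p - q) <= 2 * E ^+ 2.
    have -> : expR p * (p - q) = X * expR p * (E ^+ 2 / (1 + E) / 2) by rewrite pq; ring.
    have : E ^+ 2 / (1 + E) <= E ^+ 2.
      by rewrite ler_pdivrMr// ler_peMr ?sqr_ge0//; lra.
    have : 0 <= E ^+ 2 / (1 + E) by rewrite divr_ge0 ?sqr_ge0//; lra.
    have := expR_gt0 p; set f := E ^+ 2 / _ => *.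
    have : X * expR p * (f / 2) <= 4 * (E ^+ 2 / 2).
      by apply: ler_pM; [rewrite mulr_ge0// ltW|lra|lra|lra].
    lra.
  lra.
have -> : - (X / 2) - E / 2 + X * E / 2 = - (E / 2) + - (X * (1 - E) / 2) by ring.
rewrite expRD.
have h3 : expR (- (E / 2)) <= 1 by rewrite -[leRHS]expR0 ler_expR; lra.
have := expR_gt0 (- (E / 2)); have := expR_gt0 (- (X * (1 - E) / 2)).
have := expR_gt0 (- (X / (1 + E) / 2)).
have := sqr_ge0 E.
set a := expR (- (E / 2)) in h1 h3 *; set b := expR _ in h2 *.
set c := expR _ in h2 *; set d := _^-1 in h1 * => k1 k2 k3 k4.
have : a * b <= a * (c + 2 * E ^+ 2) by rewrite ler_wpM2l//; lra.
have : a * c <= d * c by rewrite ler_wpM2r//; lra.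
have : a * E ^+ 2 <= E ^+ 2 by rewrite ler_piMl.
rewrite [c * d]mulrC; lra.
Qed.

Lemma gauss_step_ge (X E : R) : 0 <= X -> 0 <= E <= 2^-1 ->
  expR (- (X / (1 + E) / 2)) / Num.sqrt (1 + E) - 11 * E ^+ 2 <=
  expR (- (X / 2) - E / 2) * (1 + X * E / 2).
Proof.
move=> X0 /andP[E0 E1].
have e1 : 0 < 1 + E by lra.
have s1 : 0 < Num.sqrt (1 + E) by rewrite sqrtr_gt0.
have E4 : E ^+ 2 <= 4^-1 by nra.
have h1 : (Num.sqrt (1 + E))^-1 <= expR (- (E / 2)) + E ^+ 2.
  have k1 : (Num.sqrt (1 + E))^-1 <= expR (- (E / 2)) * (1 + E ^+ 2).
    rewrite -[leRHS]invrK lef_pV2 ?posrE// ?invr_gt0 ?mulr_gt0 ?expR_gt0//; last first.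
      have := sqr_ge0 E; lra.
    rewrite -(@ler_pXn2r _ 2) ?nnegrE ?sqrtr_ge0 ?invr_ge0 ?mulr_ge0 ?expR_ge0//;
      last by have := sqr_ge0 E; lra.
    rewrite sqr_sqrtr; last by lra.
    rewrite exprVn -div1r ler_pdivrMr; last first.
      by rewrite exprn_gt0// mulr_gt0 ?expR_gt0//; have := sqr_ge0 E; lra.
    rewrite exprMn -expRM_natr (_ : - (E / 2) * 2%:R = - E); last by field.
    have := expR_ge1Dx (- E) => k.
    have k2 : 1 - E ^+ 2 <= (1 + E) * expR (- E).
      have -> : 1 - E ^+ 2 = (1 + E) * (1 - E) by ring.
      by rewrite ler_wpM2l//; lra.
    have k3 : 0 <= (1 + E ^+ 2) ^+ 2 by apply: sqr_ge0.
    have := ler_wpM2r k3 k2; rewrite -mulrA.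
    have : 1 <= (1 - E ^+ 2) * (1 + E ^+ 2) ^+ 2.
      by move: (E ^+ 2) (sqr_ge0 E) E4 => y y0 y4; nra.
    lra.
  have : expR (- (E / 2)) <= 1 by rewrite -[leRHS]expR0 ler_expR; lra.
  have := sqr_ge0 E; nra.
have h2 : expR (- (X / (1 + E) / 2)) <= expR (- (X / 2)) * (1 + X * E / 2) + 8 * E ^+ 2.
  set w := X * E / (1 + E) / 2.
  have w0 : 0 <= w by rewrite /w divr_ge0// divr_ge0 ?mulr_ge0//; lra.
  have wv : w <= X * E / 2.
    rewrite /w ler_wpM2r// ler_pdivrMr// ler_peMr ?mulr_ge0//; lra.
  have -> : - (X / (1 + E) / 2) = - (X / 2) + w by rewrite /w; field; lra.
  rewrite expRD.
  have k1 := expR_sub1Dx_le w0.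
  (* Since w <= X / 4, half of the decay exp (- X / 2) pays for [expR w], and the other half for the
     factor X^2 in w^2. *)
  have k2 : expR (- (X / 2)) * (w ^+ 2 * expR w) <= 8 * E ^+ 2.
    have l1 : w ^+ 2 <= (X * E / 2) ^+ 2 by rewrite ler_pXn2r// nnegrE//; lra.
    have l2 : expR (- (X / 2)) * expR w <= expR (- (X / 4)).
      by rewrite -expRD ler_expR; nra.
    have X4 : 0 <= X / 4 by lra.
    have l3 : (X / 4) ^+ 2 / 2 * expR (- (X / 4)) <= 1.
      have /andP[+ _] := expR_taylor2_pos X4.
      have := expRxMexpNx_1 (X / 4); have := expR_gt0 (- (X / 4)).
      set a := expR (X / 4); set b := expR (- _) => b0 ab h.
      by rewrite -[leRHS]ab ler_wpM2r//; lra.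
    have -> : expR (- (X / 2)) * (w ^+ 2 * expR w) =
       w ^+ 2 * (expR (- (X / 2)) * expR w) by ring.
    apply: le_trans (_ : (X * E / 2) ^+ 2 * expR (- (X / 4)) <= _).
      by rewrite ler_pM ?sqr_ge0 ?mulr_ge0 ?expR_ge0.
    have -> : (X * E / 2) ^+ 2 * expR (- (X / 4)) =
      (X / 4) ^+ 2 / 2 * expR (- (X / 4)) * (8 * E ^+ 2) by field.
    by rewrite ler_piMl// mulr_ge0 ?sqr_ge0.
  have := expR_gt0 (- (X / 2)); set a := expR _ in k2 * => a0.
  have : a * (expR w - 1 - w) <= a * (w ^+ 2 * expR w) by rewrite ler_wpM2l// ltW.
  have : a * w <= a * (X * E / 2) by rewrite ler_wpM2l// ltW.
  lra.
have h3 : expR (- (X / 2)) * (1 + X * E / 2) <= 1.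
  have k1 : 1 + X * E / 2 <= expR (X / 2).
    have := expR_ge1Dx (X / 2); nra.
  rewrite expRN ler_pdivrMl ?expR_gt0//; lra.
rewrite expRD.
have h0 : 0 <= expR (- (X / 2)) * (1 + X * E / 2).
  by rewrite mulr_ge0 ?expR_ge0//; nra.
have h4 : expR (- (E / 2)) <= 1 by rewrite -[leRHS]expR0 ler_expR; lra.
have h6 := expR_gt0 (- (X / (1 + E) / 2)).
have h7 := expR_gt0 (- (E / 2)).
have h8 : 0 < (Num.sqrt (1 + E))^-1 by rewrite invr_gt0.
have -> : expR (- (X / 2)) * expR (- (E / 2)) * (1 + X * E / 2) =
  expR (- (X / 2)) * (1 + X * E / 2) * expR (- (E / 2)) by ring.
set a := expR (- (X / 2)) * _ in h2 h3 h0 *; set b := expR (- (E / 2)) in h1 h4 h7 *.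
set c := expR _ in h2 h6 *; set d := _^-1 in h1 h8 *.
have k1 : c * d <= (a + 8 * E ^+ 2) * (b + E ^+ 2) by rewrite ler_pM// ltW.
have E20 := sqr_ge0 E.
move: (E ^+ 2) k1 E20 E4 => y *.
have : a * y <= y by rewrite ler_piMl.
have : b * y <= y by rewrite ler_piMl.
have : y * y <= y / 4 by rewrite ler_wpM2l.
lra.
Qed.

Lemma sqrt1D_gt0 t : 0 <= t -> 0 < Num.sqrt (1 + t).
Proof. by move=> t0; rewrite sqrtr_gt0; lra. Qed.

Lemma heat_gt0 t s : 0 <= t -> 0 < heat t s.
Proof. by move=> t0; rewrite divr_gt0 ?expR_gt0 ?sqrt1D_gt0. Qed.

Lemma heat_le t s : 0 <= t -> heat t s <= (Num.sqrt (1 + t))^-1.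
Proof.
move=> t0; rewrite ler_pdivrMr ?sqrt1D_gt0// mulVf ?gt_eqF ?sqrt1D_gt0//.
rewrite -[leRHS]expR0 ler_expR oppr_le0 !divr_ge0 ?sqr_ge0//; lra.
Qed.

Lemma heat_le1 t s : 0 <= t -> heat t s <= 1.
Proof.
move=> t0; apply: le_trans (heat_le s t0) _.
rewrite invf_le1 ?sqrt1D_gt0// -[leLHS]sqrtr1 ler_wsqrtr; lra.
Qed.

Lemma heat0 s : heat 0 s = expR (- (s ^+ 2 / 2)).
Proof. by rewrite /heat !addr0 sqrtr1 !divr1. Qed.

(* The heat equation for [heat], discretized with steps [k] and [k ^+ 2]. *)
Lemma heat_step t s k : 0 <= t -> k ^+ 2 <= 2^-1 ->
  `|(heat t (s + k) + heat t (s - k)) / 2 - heat (t + k ^+ 2) s| <= 11 * k ^+ 4.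
Proof.
move=> t0 k1; have b0 : 0 < 1 + t by lra.
set X := s ^+ 2 / (1 + t); set E := k ^+ 2 / (1 + t).
have X0 : 0 <= X by rewrite divr_ge0 ?sqr_ge0// ltW.
have E0 : 0 <= E by rewrite divr_ge0 ?sqr_ge0// ltW.
have Ek : E <= k ^+ 2 by rewrite ler_pdivrMr// ler_peMr ?sqr_ge0//; lra.
have E12 : 0 <= E <= 2^-1 by apply/andP; split; lra.
have -> : heat (t + k ^+ 2) s =
    expR (- (X / (1 + E) / 2)) / Num.sqrt (1 + E) / Num.sqrt (1 + t).
  rewrite /heat -[RHS]mulrA -invfM -sqrtrM; last by lra.
  have k0 := sqr_ge0 k.
  congr (expR (- _) / Num.sqrt _); rewrite /X /E; last by field; lra.
  by field; apply/andP; split; lra.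
have -> : (heat t (s + k) + heat t (s - k)) / 2 =
    expR (- (X / 2) - E / 2) * cosh (s * k / (1 + t)) / Num.sqrt (1 + t).
  rewrite /heat /cosh.
  have -> : - ((s + k) ^+ 2 / (1 + t) / 2) = - (X / 2) - E / 2 + - (s * k / (1 + t)).
    by rewrite /X /E; field; lra.
  have -> : - ((s - k) ^+ 2 / (1 + t) / 2) = - (X / 2) - E / 2 + (s * k / (1 + t)).
    by rewrite /X /E; field; lra.
  rewrite ![expR (_ - _ + _)]expRD; field.
  by rewrite gt_eqF// sqrt1D_gt0.
have zE : (s * k / (1 + t)) ^+ 2 = X * E by rewrite /X /E; field; lra.
rewrite -mulrBl normrM.
have : `|(Num.sqrt (1 + t))^-1| <= 1.
  rewrite gtr0_norm ?invr_gt0 ?sqrt1D_gt0// invf_le1 ?sqrt1D_gt0//.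
  by rewrite -[leLHS]sqrtr1 ler_wsqrtr; lra.
set q := `| _^-1 | => q1.
apply: le_trans (_ : 11 * E ^+ 2 * 1 <= _); last first.
  have k4 : k ^+ 4 = (k ^+ 2) ^+ 2 by rewrite -exprM.
  by rewrite mulr1 ler_pM2l// k4 ler_pXn2r// nnegrE sqr_ge0.
apply: ler_pM => //; first exact: normr_ge0.
have := cosh_le (s * k / (1 + t)); have := cosh_ge (s * k / (1 + t)).
rewrite zE => c1 c2.
have g1 := gauss_step_le X0 E12; have g2 := gauss_step_ge X0 E12.
have e0 := expR_gt0 (- (X / 2) - E / 2).
rewrite expRD in g1.
have := ler_wpM2l (ltW e0) c1; have := ler_wpM2l (ltW e0) c2.
have := sqr_ge0 E.
rewrite ler_norml => *; apply/andP; split; lra.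
Qed.

Lemma gauss_mul_le s : expR (- (s ^+ 2 / 2)) * `|s| <= 1.
Proof.
rewrite expRN ler_pdivrMl ?expR_gt0// mulr1; apply: le_trans (expR_ge1Dx _).
by rewrite -real_normK ?num_real//; have := sqr_ge0 (`|s| - 1); lra.
Qed.

Lemma gauss_mul2_le s : expR (- (s ^+ 2 / 2)) * `|(s ^+ 2 - 1) / 2| <= 1.
Proof.
rewrite expRN ler_pdivrMl ?expR_gt0// mulr1; apply: le_trans (expR_ge1Dx _).
have := sqr_ge0 s; rewrite ler_norml => ?; apply/andP; split; lra.
Qed.

(** The error is uniform in [s]: the powers of [s] and the factors exp (|s| + 1) that come from
    expanding [expR w] are dominated by exp (- s^2 / 2). *)
Lemma gauss_taylor s y : `|y| <= 1 ->
  `|expR (- ((s + y) ^+ 2 / 2)) -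
    expR (- (s ^+ 2 / 2)) * (1 - s * y + (s ^+ 2 - 1) / 2 * y ^+ 2)|
  <= (6 * expR 4 + 1) * `|y| ^+ 3.
Proof.
move=> y1; set w := - (s * y + y ^+ 2 / 2).
have -> : - ((s + y) ^+ 2 / 2) = - (s ^+ 2 / 2) + w by rewrite /w; field.
rewrite expRD -mulrBr.
have -> : expR w - (1 - s * y + (s ^+ 2 - 1) / 2 * y ^+ 2) =
  (expR w - 1 - w - w ^+ 2 / 2) + (s * y ^+ 3 / 2 + y ^+ 3 * y / 8) by rewrite /w; field.
have p0 := expR_gt0 (- (s ^+ 2 / 2)).
have wy : `|w| <= (`|s| + 1) * `|y|.
  rewrite /w normrN; apply: le_trans (ler_normD _ _) _.
  rewrite normrM [`|_ / 2|]normrM normrX [`|2^-1|]gtr0_norm//.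
  have := normr_ge0 y; have := normr_ge0 s; nra.
have y0 := normr_ge0 y; have s0 := normr_ge0 s.
have w0 := normr_ge0 w.
have wm : `|w| <= `|s| + 1 by nra.
have y30 : 0 <= `|y| ^+ 3 by apply: exprn_ge0.
rewrite normrM gtr0_norm//.
apply: le_trans (_ : expR (- (s ^+ 2 / 2)) * (6 * expR (`|s| + 1) * `|y| ^+ 3 * expR (`|s| + 1)
   + (`|s| / 2 + 8^-1) * `|y| ^+ 3) <= _).
  rewrite ler_wpM2l ?(ltW p0)//; apply: le_trans (ler_normD (expR w - 1 - w - w ^+ 2 / 2) _) _.
  apply: lerD.
    apply: le_trans (expR_taylor2 _) _.
    apply: ler_pM; rewrite ?exprn_ge0 ?expR_ge0 ?ler_expR//.
    apply: le_trans (_ : ((`|s| + 1) * `|y|) ^+ 3 <= _).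
      by rewrite ler_pXn2r// nnegrE// mulr_ge0//; lra.
    rewrite exprMn ler_wpM2r//.
    have m0 : 0 <= `|s| + 1 by lra.
    have := expR_ge_taylor3 m0; have := sqr_ge0 (`|s| + 1); lra.
  apply: le_trans (ler_normD _ _) _.
  rewrite [`|s * _ / 2|]normrM [`|s * _|]normrM [`|_ * y / 8|]normrM [`|_ * y|]normrM !normrX ![`|_^-1|]gtr0_norm//.
  have : `|y| ^+ 3 * `|y| <= `|y| ^+ 3 by rewrite ler_piMr.
  lra.
have -> : expR (- (s ^+ 2 / 2)) * (6 * expR (`|s| + 1) * `|y| ^+ 3 * expR (`|s| + 1)
   + (`|s| / 2 + 8^-1) * `|y| ^+ 3) =
   (6 * (expR (- (s ^+ 2 / 2)) * expR (`|s| + 1) * expR (`|s| + 1)) +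
    (expR (- (s ^+ 2 / 2)) * `|s| / 2 + expR (- (s ^+ 2 / 2)) / 8)) * `|y| ^+ 3 by ring.
rewrite ler_wpM2r//.
have k1 := gauss_mul_le s.
have k2 : expR (- (s ^+ 2 / 2)) <= 1.
  by rewrite -[leRHS]expR0 ler_expR; have := sqr_ge0 s; lra.
(* The exponent on the left is 4 - (|s| - 2)^2 / 2. *)
have k3 : expR (- (s ^+ 2 / 2)) * expR (`|s| + 1) * expR (`|s| + 1) <= expR 4.
  rewrite -!expRD ler_expR -[s ^+ 2]real_normK ?num_real//.
  have := sqr_ge0 (`|s| - 2); lra.
lra.
Qed.

(** The radius [(8 * B)^-1], the same as in [tame], keeps the argument below 1/2, where
    [ln1D_taylor2] applies. The square of the first order term joins the second order one, hence
    [b - a ^+ 2 / 2]. *)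
Lemma ln1D_quadratic (B a b r y : R) : 1 <= B -> `|a| <= B -> `|b| <= B ->
  `|y| <= (8 * B)^-1 -> `|r| <= B * `|y| ^+ 3 ->
  `|a * y + b * y ^+ 2 + r| <= 2^-1 /\
  `|ln (1 + (a * y + b * y ^+ 2 + r)) - (a * y + (b - a ^+ 2 / 2) * y ^+ 2)|
    <= 12 * B ^+ 3 * `|y| ^+ 3.
Proof.
move=> B1 aB bB yB rB; set z := a * y + b * y ^+ 2 + r.
have B0 : 0 < B by lra.
have y0 := normr_ge0 y.
have yB8 : B * `|y| <= 8^-1.
  have := ler_wpM2l (ltW B0) yB.
  by rewrite invfM mulrCA divff ?mulr1// gt_eqF.
have y8 : `|y| <= 8^-1 by nra.
have y2E : `|y ^+ 2| = `|y| ^+ 2 by rewrite normrX.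
have ay : `|a * y| <= B * `|y| by rewrite normrM ler_wpM2r.
have by2 : `|b * y ^+ 2| <= B * `|y| ^+ 2 by rewrite normrM y2E ler_wpM2r// sqr_ge0.
have zay : `|z - a * y| <= 2 * B * `|y| ^+ 2.
  have -> : z - a * y = b * y ^+ 2 + r by rewrite /z; ring.
  apply: le_trans (ler_normD _ _) _.
  have : `|y| ^+ 3 <= `|y| ^+ 2 by rewrite [leLHS]exprS ler_piMl ?sqr_ge0//; lra.
  have := sqr_ge0 `|y|; nra.
have y2 : `|y| ^+ 2 <= `|y| / 8 by rewrite expr2 ler_wpM2l.
have zB : `|z| <= 2 * B * `|y|.
  have -> : z = (z - a * y) + a * y by rewrite subrK.
  apply: le_trans (ler_normD _ _) _.
  have : B * `|y| ^+ 2 <= B * (`|y| / 8) by rewrite ler_wpM2l// ltW.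
  have : 0 <= B * `|y| by rewrite mulr_ge0// ltW.
  nra.
have z2 : `|z| <= 2^-1 by lra.
split=> //.
have -> : ln (1 + z) - (a * y + (b - a ^+ 2 / 2) * y ^+ 2) =
  (ln (1 + z) - z + z ^+ 2 / 2) + (r - (z - a * y) * (z + a * y) / 2).
  by rewrite /z; field.
apply: le_trans (ler_normD _ _) _.
have h1 := ln1D_taylor2 z2.
have h2 : `|z| ^+ 3 <= 8 * B ^+ 3 * `|y| ^+ 3.
  have -> : 8 * B ^+ 3 * `|y| ^+ 3 = (2 * B * `|y|) ^+ 3 by ring.
  by rewrite ler_pXn2r// nnegrE// mulr_ge0// mulr_ge0// ltW.
have h3 : `|(z - a * y) * (z + a * y) / 2| <= 3 * B ^+ 3 * `|y| ^+ 3.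
  rewrite !normrM [`|2^-1|]gtr0_norm//.
  have : `|z + a * y| <= 3 * B * `|y|.
    by apply: le_trans (ler_normD _ _) _; lra.
  move=> k.
  have : `|z - a * y| * `|z + a * y| <= (2 * B * `|y| ^+ 2) * (3 * B * `|y|) by apply: ler_pM.
  have -> : (2 * B * `|y| ^+ 2) * (3 * B * `|y|) = 6 * B ^+ 2 * `|y| ^+ 3 by ring.
  have : B ^+ 2 * `|y| ^+ 3 <= B ^+ 3 * `|y| ^+ 3.
    by rewrite ler_wpM2r ?exprn_ge0// ler_weXn2l//.
  lra.
have h4 : B * `|y| ^+ 3 <= B ^+ 3 * `|y| ^+ 3.
  by rewrite ler_wpM2r ?exprn_ge0// -[leLHS]expr1 ler_weXn2l.
apply: le_trans (lerD h1 (ler_normB _ _)) _.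
lra.
Qed.

End Gauss.

(** * Averages over signs and the discrete heat flow *)

Section Signs.
Variables (R : realType) (n : nat).
Implicit Types (F G : {ffun 'I_n -> bool} -> R) (e : {ffun 'I_n -> bool}).

Definition avg F : R := #|{: {ffun 'I_n -> bool}}|%:R^-1 * \sum_e F e.

Let card_gt0 : (0 : R) < #|{: {ffun 'I_n -> bool}}|%:R.
Proof. by rewrite ltr0n; apply/card_gt0P; exists [ffun=> true]. Qed.

Lemma avg_cst (a : R) : avg (fun=> a) = a.
Proof.
by rewrite /avg sumr_const -[a *+ _]mulr_natl mulrA mulVf ?mul1r// gt_eqF.
Qed.

Lemma avgD F G : avg (fun e => F e + G e) = avg F + avg G.
Proof. by rewrite /avg big_split mulrDr. Qed.

Lemma avgZ (a : R) F : avg (fun e => a * F e) = a * avg F.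
Proof. by rewrite /avg -mulr_sumr mulrCA. Qed.

Lemma avg_sum (I : finType) (F : I -> {ffun 'I_n -> bool} -> R) :
  avg (fun e => \sum_i F i e) = \sum_i avg (F i).
Proof. by rewrite /avg exchange_big -mulr_sumr. Qed.

Lemma avg_le F G : (forall e, F e <= G e) -> avg F <= avg G.
Proof. by move=> FG; rewrite /avg ler_pM2l ?invr_gt0//; apply: ler_sum. Qed.

Lemma eq_avg F G : F =1 G -> avg F = avg G.
Proof. by move=> FG; rewrite /avg; congr (_ * _); apply: eq_bigr => e _; apply: FG. Qed.

Lemma avg_gt0 F : (forall e, 0 < F e) -> 0 < avg F.
Proof.
move=> F0; rewrite /avg mulr_gt0 ?invr_gt0// lt0r sumr_ge0 ?andbT; last first.
  by move=> e _; apply: ltW.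
rewrite psumr_neq0; last by move=> e _; apply: ltW.
by apply/hasP; exists [ffun=> true]; rewrite ?mem_index_enum//= F0.
Qed.

Lemma ler_norm_avg F : `|avg F| <= avg (fun e => `|F e|).
Proof.
rewrite /avg normrM gtr0_norm ?invr_gt0// ler_pM2l ?invr_gt0//.
exact: ler_norm_sum.
Qed.

(** Changing one sign preserves [avg], so whatever is odd in that sign averages to 0. *)
Definition flip (j : 'I_n) e : {ffun 'I_n -> bool} :=
  [ffun i => if i == j then ~~ e i else e i].

Lemma flipK j : involutive (flip j).
Proof. by move=> e; apply/ffunP => i; rewrite !ffunE; case: eqP => // _; rewrite negbK. Qed.

Lemma avg_flip j F : avg F = avg (fun e => F (flip j e)).
Proof.
by rewrite /avg; congr (_ * _); rewrite (reindex_inj (can_inj (flipK j))).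
Qed.

Definition sgn (b : bool) : R := (-1) ^+ b.

Lemma sgn_flip j e i : sgn (flip j e i) = if i == j then - sgn (e i) else sgn (e i).
Proof. by rewrite ffunE /sgn; case: eqP => // _; case: (e i); rewrite ?expr0 ?expr1 ?opprK. Qed.

Lemma avg_sgn j : avg (fun e => sgn (e j)) = 0.
Proof.
have : avg (fun e => sgn (e j)) = - avg (fun e => sgn (e j)).
  rewrite [LHS](avg_flip j) -mulN1r -avgZ; apply: eq_avg => e.
  by rewrite sgn_flip eqxx mulN1r.
lra.
Qed.

Lemma avg_sgnM i j : avg (fun e => sgn (e i) * sgn (e j)) = (i == j)%:R.
Proof.
have [->|ij] := eqVneq i j.
  by rewrite -[RHS](avg_cst 1); apply: eq_avg => e; rewrite /sgn -expr2 sqrr_sign.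
have : avg (fun e => sgn (e i) * sgn (e j)) = - avg (fun e => sgn (e i) * sgn (e j)).
  rewrite [LHS](avg_flip j) -mulN1r -avgZ; apply: eq_avg => e.
  by rewrite !sgn_flip eqxx (negbTE ij) mulN1r mulrN.
rewrite /=; lra.
Qed.

Definition dot (w : 'I_n -> R) e : R := \sum_j w j * sgn (e j).

Lemma avg_dot w : avg (dot w) = 0.
Proof.
rewrite avg_sum big1// => j _; by rewrite avgZ avg_sgn mulr0.
Qed.

Lemma avg_dot2 w : avg (fun e => dot w e ^+ 2) = \sum_j w j ^+ 2.
Proof.
under eq_avg do rewrite expr2 /dot mulr_suml.
rewrite avg_sum; apply: eq_bigr => i _.
under eq_avg do rewrite mulr_sumr.
rewrite avg_sum (bigD1 i)//= big1 ?addr0.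
  under eq_avg do rewrite mulrACA.
  by rewrite avgZ avg_sgnM eqxx mulr1 expr2.
move=> j ji; under eq_avg do rewrite mulrACA.
by rewrite avgZ avg_sgnM eq_sym (negbTE ji) mulr0.
Qed.

Lemma norm_dot_le w e : `|dot w e| <= \sum_j `|w j|.
Proof.
apply: le_trans (ler_norm_sum _ _ _) _; apply: ler_sum => j _.
by rewrite normrM /sgn normr_sign mulr1.
Qed.

End Signs.
Arguments sgn {R}.

Ltac nonneg := repeat first [by [] | exact: ltW | apply: exprn_ge0 | apply: mulr_ge0].

(** * Functions with a uniform relative second order expansion *)

Section Tame.
Variable R : realType.

(** The terms [m], [q], [r] have orders 1, 2, 3 in [d], so [m ^+ 2 / 2] is the only further term of
    order 2. Since |m + q + r| <= 3 G d <= 1, the Taylor error contributes 27 e; the 5 collects the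
    rest. *)
Lemma expR_sum3 (G d m q r : R) : 0 <= d <= 1 -> 1 <= G -> G * d <= 3^-1 ->
  `|m| <= G * d -> `|q| <= G * d ^+ 2 -> `|r| <= G * d ^+ 3 ->
  `|expR (m + q + r) - (1 + m + q + m ^+ 2 / 2)| <=
    (5 + 27 * expR 1) * G ^+ 3 * d ^+ 3.
Proof.
move=> /andP[d0 d1] G1 Gd mG qG rG.
have G0 : 0 <= G by lra.
have d2 : d ^+ 2 <= d by rewrite expr2 ler_piMl.
have d3 : d ^+ 3 <= d ^+ 2 by rewrite exprS ler_piMl ?sqr_ge0.
have Gd2 : G * d ^+ 2 <= G * d by rewrite ler_wpM2l.
have Gd3 : G * d ^+ 3 <= G * d ^+ 2 by rewrite ler_wpM2l.
set t := m + q + r.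
have tm : `|t - m| <= 2 * G * d ^+ 2.
  have -> : t - m = q + r by rewrite /t; ring.
  by apply: le_trans (ler_normD _ _) _; lra.
have tp : `|t + m| <= 4 * G * d.
  have -> : t + m = m + m + (q + r) by rewrite /t; ring.
  have := ler_normD (m + m) (q + r).
  have := ler_normD m m; have := ler_normD q r; lra.
have tG : `|t| <= 3 * G * d.
  have := ler_normD m (q + r); have := ler_normD q r; rewrite addrA -/t; lra.
have h1 : `|expR t - 1 - t - t ^+ 2 / 2| <= 27 * expR 1 * G ^+ 3 * d ^+ 3.
  apply: le_trans (expR_taylor2 _) _.
  have -> : 27 * expR 1 * G ^+ 3 * d ^+ 3 = (3 * G * d) ^+ 3 * expR 1 by ring.
  apply: ler_pM; rewrite ?exprn_ge0 ?expR_ge0 ?ler_expR//; last by lra.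
  by rewrite ler_pXn2r// nnegrE// mulr_ge0// mulr_ge0.
have h2 : `|(t - m) * (t + m) / 2| <= 4 * G ^+ 2 * d ^+ 3.
  rewrite [`|_ / 2|]normrM [`|(t - m) * _|]normrM [`|2^-1|]gtr0_norm//.
  have : `|t - m| * `|t + m| <= 2 * G * d ^+ 2 * (4 * G * d) by apply: ler_pM.
  have -> : 2 * G * d ^+ 2 * (4 * G * d) = 8 * G ^+ 2 * d ^+ 3 by ring.
  lra.
have d30 : 0 <= d ^+ 3 by apply: exprn_ge0.
have h3 : G ^+ 2 * d ^+ 3 <= G ^+ 3 * d ^+ 3.
  by rewrite ler_wpM2r// ler_weXn2l.
have h4 : G * d ^+ 3 <= G ^+ 3 * d ^+ 3.
  by rewrite ler_wpM2r// -[leLHS]expr1 ler_weXn2l.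
have -> : expR t - (1 + m + q + m ^+ 2 / 2) =
  (expR t - 1 - t - t ^+ 2 / 2) + ((t - m) * (t + m) / 2 + r) by rewrite /t; field.
apply: le_trans (ler_normD _ _) _.
have := ler_normD ((t - m) * (t + m) / 2) r; lra.
Qed.

Implicit Types (B : R) (h : R -> R).

(* A second order expansion whose error is relative to [h s] and uniform in [s]:
   this passes to averages of translates with the same [B], so that the error of
   each step of the flow is bounded independently of the number of steps. *)
Definition tame B h := forall s, 0 < h s /\ exists a b, [/\ `|a| <= B, `|b| <= B &
  forall y, `|y| <= (8 * B)^-1 ->
    `|h (s + y) - h s * (1 + a * y + b * y ^+ 2)| <= B * h s * `|y| ^+ 3].

Lemma tame_coef B h : tame B h -> exists ab : R -> R * R,
  forall s, [/\ 0 < h s, `|(ab s).1| <= B, `|(ab s).2| <= B &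
  forall y, `|y| <= (8 * B)^-1 ->
    `|h (s + y) - h s * (1 + (ab s).1 * y + (ab s).2 * y ^+ 2)| <= B * h s * `|y| ^+ 3].
Proof.
move=> th.
have : forall s, exists ab : R * R, [/\ 0 < h s, `|ab.1| <= B, `|ab.2| <= B &
  forall y, `|y| <= (8 * B)^-1 ->
    `|h (s + y) - h s * (1 + ab.1 * y + ab.2 * y ^+ 2)| <= B * h s * `|y| ^+ 3].
  by move=> s; have [h0 [a [b [? ? ?]]]] := th s; exists (a, b); split.
by case/choice => ab abP; exists ab.
Qed.

(** The coefficients of the average are the means of the coefficients at the points [s + f e],
    weighted by the values [h (s + f e)]; a weighted mean respects the bound [B]. *)
Lemma tame_avg n (f : {ffun 'I_n -> bool} -> R) B h :
  tame B h -> tame B (fun s => avg (fun e => h (s + f e))).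
Proof.
move=> /tame_coef[ab abP] s.
have A0 : 0 < avg (fun e => h (s + f e)) by apply: avg_gt0 => e; case: (abP (s + f e)).
split => //; set A := avg _ in A0 *.
have bnd (g : R -> R) : (forall t, `|g t| <= B) ->
    `|avg (fun e => h (s + f e) * g (s + f e)) / A| <= B.
  move=> gB; rewrite normrM [`|A^-1|]gtr0_norm ?invr_gt0// ler_pdivrMr//.
  apply: le_trans (ler_norm_avg _) _; rewrite /A -avgZ; apply: avg_le => e.
  have [h0 _ _ _] := abP (s + f e).
  by rewrite normrM gtr0_norm// mulrC ler_wpM2r// ltW.
exists (avg (fun e => h (s + f e) * (ab (s + f e)).1) / A).
exists (avg (fun e => h (s + f e) * (ab (s + f e)).2) / A).
split; [by apply: (bnd (fun t => (ab t).1)) => t; case: (abP t) | by apply: (bnd (fun t => (ab t).2)) => t; case: (abP t) |].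
move=> y yB.
have AK t : A * (t / A) = t by rewrite mulrC divfK// gt_eqF.
rewrite mulrDr mulrDr mulr1 ![A * (_ / A * _)]mulrA !AK.
rewrite [avg _ * y]mulrC [avg _ * y ^+ 2]mulrC /A -!avgZ -!avgD.
rewrite -mulN1r -avgZ -avgD [leRHS]mulrC -avgZ.
apply: le_trans (ler_norm_avg _) _; apply: avg_le => e.
have [h0 _ _ /(_ _ yB)] := abP (s + f e).
set H := h (s + f e).
have -> : s + y + f e = s + f e + y by ring.
have -> : `|y| ^+ 3 * (B * H) = B * H * `|y| ^+ 3 by ring.
congr (`|_| <= _); by ring.
Qed.

Lemma tame_iter_avg n (f : {ffun 'I_n -> bool} -> R) B h N : tame B h ->
  tame B (iter N (fun g s => avg (fun e => g (s + f e))) h).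
Proof. by move=> th; elim: N => //= N; apply: tame_avg. Qed.

Lemma tame_ln B h : 1 <= B -> tame B h -> exists ab : R -> R * R, forall s,
  [/\ 0 < h s, `|(ab s).1| <= B, `|(ab s).2| <= B,
  forall y, `|y| <= (8 * B)^-1 ->
    `|h (s + y) - h s * (1 + (ab s).1 * y + (ab s).2 * y ^+ 2)| <= B * h s * `|y| ^+ 3 &
  forall y, `|y| <= (8 * B)^-1 ->
    `|ln (h (s + y)) -
      (ln (h s) + ((ab s).1 * y + ((ab s).2 - (ab s).1 ^+ 2 / 2) * y ^+ 2))|
    <= 12 * B ^+ 3 * `|y| ^+ 3].
Proof.
move=> B1 /tame_coef[ab abP]; exists ab => s; have [h0 aB bB hB] := abP s.
split=> // y yB; set a := (ab s).1 in aB hB *; set b := (ab s).2 in bB hB *.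
pose r := h (s + y) / h s - (1 + a * y + b * y ^+ 2).
have hE : h (s + y) = h s * (1 + (a * y + b * y ^+ 2 + r)).
  by rewrite /r; field; rewrite gt_eqF.
have rB : `|r| <= B * `|y| ^+ 3.
  have := hB y yB; rewrite hE -mulrBr.
  have -> : 1 + (a * y + b * y ^+ 2 + r) - (1 + a * y + b * y ^+ 2) = r by ring.
  by rewrite normrM gtr0_norm// [B * _]mulrC -mulrA ler_pM2l.
have [z2 lz] := ln1D_quadratic B1 aB bB yB rB.
rewrite hE lnM ?posrE//; last first.
  by move: z2; rewrite ler_norml => /andP[+ _]; clear; lra.
by rewrite opprD addrACA subrr add0r.
Qed.

(** The logarithm stands outside the average of a centred increment, so the first order term is gone
    before the logarithm is expanded and the coefficient of [v] is [b]. With the logarithm inside it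
    would be [b - a ^+ 2 / 2]; [flow_step] lives on this difference. *)
Lemma ln_avg_ge n (y : {ffun 'I_n -> bool} -> R) h (s a b B s0 d v : R) :
  1 <= B -> 1 <= s0 -> 0 < d -> d * s0 <= (8 * B)^-1 -> 4 * B * s0 ^+ 3 * d <= 1 ->
  0 < h s -> `|b| <= B ->
  (forall y, `|y| <= (8 * B)^-1 ->
    `|h (s + y) - h s * (1 + a * y + b * y ^+ 2)| <= B * h s * `|y| ^+ 3) ->
  (forall e, `|y e| <= d * s0) -> avg y = 0 -> avg (fun e => y e ^+ 2) = v ->
  0 <= v <= d ^+ 2 ->
  ln (h s) + b * v - 5 * B ^+ 2 * s0 ^+ 6 * d ^+ 3 <= ln (avg (fun e => h (s + y e))).
Proof.
move=> B1 s1 d0 dsB Bsd h0 bB hB ys y1 y2 /andP[v0 vd].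
have B0 : 0 < B by exact: lt_le_trans B1.
have s00 : 0 < s0 by exact: lt_le_trans s1.
have d1 : d <= 1.
  apply: (@le_trans _ _ (d * s0)); first by rewrite ler_peMr// ltW.
  by apply: le_trans dsB _; rewrite invf_le1; lra.
have d20 := sqr_ge0 d.
have d30 : 0 <= d ^+ 3 by nonneg.
pose r e := h (s + y e) / h s - (1 + a * y e + b * y e ^+ 2).
have hE e : h (s + y e) = h s * (1 + (a * y e + (b * y e ^+ 2 + r e))).
  by rewrite /r; field; rewrite gt_eqF.
have rB e : `|r e| <= B * (s0 ^+ 3 * d ^+ 3).
  apply: le_trans (_ : B * `|y e| ^+ 3 <= _); last first.
    rewrite ler_wpM2l ?(ltW B0)// -exprMn [s0 * _]mulrC ler_pXn2r ?nnegrE//.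
    by apply: mulr_ge0; exact: ltW.
  have := hB (y e) (le_trans (ys e) dsB); rewrite hE -mulrBr.
  have -> : 1 + (a * y e + (b * y e ^+ 2 + r e)) - (1 + a * y e + b * y e ^+ 2) = r e by ring.
  by rewrite normrM gtr0_norm// [B * _]mulrC -mulrA ler_pM2l.
set w := b * v + avg r.
have -> : avg (fun e => h (s + y e)) = h s * (1 + w).
  under eq_avg do rewrite hE.
  by rewrite avgZ avgD avg_cst avgD avgZ y1 mulr0 add0r avgD avgZ y2.
have ar : `|avg r| <= B * (s0 ^+ 3 * d ^+ 3).
  apply: le_trans (ler_norm_avg _) _.
  by rewrite -[leRHS](avg_cst n); apply: avg_le => e; exact: rB.
have wB : `|w| <= 2 * (B * (s0 ^+ 3 * d ^+ 2)).
  apply: le_trans (ler_normD _ _) _.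
  have k1 : `|b * v| <= B * (s0 ^+ 3 * d ^+ 2).
    rewrite normrM [`|v|]ger0_norm//; apply: ler_pM => //.
    by apply: (le_trans vd); rewrite ler_peMl// exprn_ege1.
  have k2 : B * (s0 ^+ 3 * d ^+ 3) <= B * (s0 ^+ 3 * d ^+ 2).
    rewrite ler_wpM2l ?(ltW B0)// ler_wpM2l//; first by nonneg.
    by rewrite exprS ler_piMl.
  move: k1 k2 ar; clear; lra.
have w2 : `|w| <= 2^-1.
  apply: le_trans wB _.
  have : B * (s0 ^+ 3 * d ^+ 2) <= B * (s0 ^+ 3 * d).
    rewrite ler_wpM2l ?(ltW B0)// ler_wpM2l//; first by nonneg.
    by rewrite expr2 ler_piMl// ltW.
  move: Bsd; clear; lra.
rewrite lnM ?posrE//; last by move: w2; rewrite ler_norml => /andP[+ _]; clear; lra.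
rewrite -addrA lerD2l.
have wsq : w ^+ 2 <= 4 * B ^+ 2 * s0 ^+ 6 * d ^+ 3.
  rewrite -real_normK ?num_real//.
  apply: le_trans (_ : (2 * (B * (s0 ^+ 3 * d ^+ 2))) ^+ 2 <= _).
    by rewrite ler_pXn2r ?nnegrE//; nonneg.
  have -> : (2 * (B * (s0 ^+ 3 * d ^+ 2))) ^+ 2 = 4 * B ^+ 2 * s0 ^+ 6 * d ^+ 3 * d by ring.
  by rewrite ler_piMr//; nonneg.
have lw : w - w ^+ 2 <= ln (1 + w).
  have := ln1D_taylor2 w2.
  have : `|w| ^+ 3 <= w ^+ 2 / 2.
    by rewrite exprS real_normK ?num_real// mulrC ler_wpM2l ?sqr_ge0.
  rewrite ler_norml => k /andP[]; move: k; clear; lra.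
apply: le_trans lw; rewrite /w in wsq *.
have : B * (s0 ^+ 3 * d ^+ 3) <= B ^+ 2 * s0 ^+ 6 * d ^+ 3.
  rewrite mulrA ler_wpM2r//; apply: ler_pM; [nonneg|nonneg| |].
    by rewrite -[leLHS]expr1 ler_weXn2l.
  by rewrite ler_weXn2l.
by move: ar wsq; rewrite ler_norml => /andP[]; clear; lra.
Qed.

Lemma flow_const (n : nat) (B s0 : R) : 1 <= B -> 1 <= s0 -> exists2 G, 12 <= G &
  [/\ 8 * B * s0 <= G, 4 * B * s0 ^+ 3 <= G, n%:R * (B * s0) <= G,
   n%:R * (2 * (B ^+ 2 * s0 ^+ 2)) <= G & n%:R * (12 * B ^+ 3 * s0 ^+ 3) <= G].
Proof.
move=> B1 s1; pose y := B ^+ 3 * s0 ^+ 3.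
have B0 : 0 <= B by lra.
have s00 : 0 <= s0 by lra.
have y1 : 1 <= y by rewrite -[leLHS]mulr1 ler_pM// exprn_ege1.
have Bk (k : nat) : (k <= 3)%N -> B ^+ k <= B ^+ 3 by move=> k3; rewrite ler_weXn2l.
have sk (k : nat) : (k <= 3)%N -> s0 ^+ k <= s0 ^+ 3 by move=> k3; rewrite ler_weXn2l.
have h1 : B * s0 <= y by rewrite -[B]expr1 -[s0]expr1 ler_pM ?exprn_ge0 ?Bk ?sk.
have h2 : B ^+ 2 * s0 ^+ 2 <= y by rewrite ler_pM ?exprn_ge0 ?Bk ?sk.
have h3 : B * s0 ^+ 3 <= y by rewrite -[B]expr1 ler_pM ?exprn_ge0 ?Bk.
have yE : 12 * B ^+ 3 * s0 ^+ 3 = 12 * y by rewrite /y; ring.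
have n1 : 0 <= n%:R :> R by [].
have ny := mulr_ge0 n1 (le_trans ler01 y1).
exists (12 * (n%:R * y + y)); first by move: (n%:R * y) ny => ? ?; lra.
have := ler_wpM2l n1 h1; have := ler_wpM2l n1 h2; rewrite yE.
clearbody y; clear yE; split; lra.
Qed.

End Tame.

(** * Monotonicity along the discrete heat flow *)

Section Flow.
Variables (R : realType) (n : nat) (S : 'M[R]_n) (c : 'I_n -> R).
Implicit Types (B d : R) (h : 'I_n -> R -> R) (x : 'I_n -> R).
Hypothesis c_gt0 : forall i, 0 < c i.
Hypothesis c_le1 : forall i, c i <= 1.
Hypothesis c_def : forall i, \sum_j S i j ^+ 2 = c i.
Hypothesis S_contr : forall b : 'I_n -> R,
  \sum_j (\sum_i b i * S i j) ^+ 2 <= \sum_i b i ^+ 2.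

Definition incr d (e : {ffun 'I_n -> bool}) i : R := d * dot (S i) e.

Lemma avg_incr d i : avg (fun e => incr d e i) = 0.
Proof. by rewrite avgZ avg_dot mulr0. Qed.

Lemma avg_incr2 d i : avg (fun e => incr d e i ^+ 2) = d ^+ 2 * c i.
Proof.
under eq_avg do rewrite exprMn.
by rewrite avgZ avg_dot2 c_def.
Qed.

Lemma avg_incr_lin2 d (b : 'I_n -> R) :
  avg (fun e => (\sum_i b i * incr d e i) ^+ 2) <= d ^+ 2 * \sum_i b i ^+ 2.
Proof.
have E e : (\sum_i b i * incr d e i) ^+ 2 =
    d ^+ 2 * dot (fun j => \sum_i b i * S i j) e ^+ 2.
  rewrite -exprMn; congr (_ ^+ 2); rewrite /dot mulr_sumr.
  under eq_bigr do rewrite /incr /dot mulrCA mulr_sumr mulr_sumr.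
  rewrite exchange_big; apply: eq_bigr => j _ /=.
  by rewrite mulr_suml mulr_sumr; apply: eq_bigr => i _; ring.
under eq_avg do rewrite E.
by rewrite avgZ avg_dot2 ler_wpM2l ?sqr_ge0.
Qed.

Let s0 := 1 + \sum_i \sum_j `|S i j|.

Lemma s0_ge1 : 1 <= s0.
Proof. by rewrite lerDl; apply: sumr_ge0 => i _; apply: sumr_ge0. Qed.

Lemma norm_incr_le d e i : 0 <= d -> `|incr d e i| <= d * s0.
Proof.
move=> d0; rewrite normrM ger0_norm// ler_wpM2l//.
apply: le_trans (norm_dot_le _ _) _.
rewrite /s0 [in leRHS](bigD1 i)//= addrCA lerDl addr_ge0// sumr_ge0// => k _.
exact: sumr_ge0.
Qed.

(* With [a_i] the logarithmic derivative of [h i] at [x i], the second order terms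
   on the two sides differ by half of
   [avg (fun e => (\sum_i c i * a_i * incr d e i) ^+ 2) - d ^+ 2 * \sum_i (c i * a_i) ^+ 2],
   which is nonpositive by [S_contr]. *)
Lemma flow_step B : 1 <= B -> exists D d0, [/\ 0 <= D, 0 < d0 &
  forall d h x, 0 < d <= d0 -> (forall i, tame B (h i)) ->
  avg (fun e => expR (\sum_i c i * ln (h i (x i + incr d e i)))) <=
  expR (D * d ^+ 3) * expR (\sum_i c i * ln (avg (fun e => h i (x i + incr d e i))))].
Proof.
move=> B1; have B0 : 0 < B by lra.
have s1 := s0_ge1; have s00 : 0 < s0 by lra.
have [G G1 [Gs0 Gs3 Gm Gq Gr]] := flow_const n B1 s1.
have G0 : 0 < G by lra.
pose D' := (5 + 27 * expR 1) * G ^+ 3.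
pose D'' := n%:R * (5 * B ^+ 2 * s0 ^+ 6).
have D'0 : 0 <= D'.
  by rewrite /D' mulr_ge0 ?exprn_ge0 ?(ltW G0)//; have := expR_gt0 (1 : R); lra.
have D''0 : 0 <= D''.
  by rewrite /D''; nonneg.
exists (D' + D''), (3 * G)^-1; split; first by apply: addr_ge0.
  by rewrite invr_gt0; lra.
move=> d h x /andP[d0 dG] th.
have Gd : G * d <= 3^-1.
  have := ler_wpM2l (ltW G0) dG.
  by rewrite invfM mulrCA divff ?mulr1// gt_eqF.
have d1 : d <= 1 by nra.
have d01 : 0 <= d <= 1 by rewrite ltW.
have dsB : d * s0 <= (8 * B)^-1.
  have B8 : 0 < 8 * B by lra.
  rewrite -(ler_pM2l B8) divff ?gt_eqF// mulrCA.
  by have := ler_wpM2l (ltW d0) Gs0; lra.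
have [a aP] := choice (fun i => tame_ln B1 (th i)).
pose al i := (a i (x i)).1; pose be i := (a i (x i)).2.
have alB i : `|al i| <= B by case: (aP i (x i)).
have beB i : `|be i| <= B by case: (aP i (x i)).
have y_le e i : `|incr d e i| <= d * s0 by apply: norm_incr_le; exact: ltW.
have y3 e i : `|incr d e i| ^+ 3 <= s0 ^+ 3 * d ^+ 3.
  by rewrite -exprMn mulrC ler_pXn2r ?nnegrE// mulr_ge0 ?ltW.
have y2 e i : incr d e i ^+ 2 <= s0 ^+ 2 * d ^+ 2.
  by rewrite -real_normK ?num_real// -exprMn mulrC ler_pXn2r ?nnegrE// mulr_ge0 ?ltW.
pose L0 := \sum_i c i * ln (h i (x i)).
pose m e := \sum_i c i * al i * incr d e i.
pose q e := \sum_i c i * (be i - al i ^+ 2 / 2) * incr d e i ^+ 2.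
pose rr := \sum_(i < n) 12 * B ^+ 3 * (s0 ^+ 3 * d ^+ 3).
have d30 : 0 <= d ^+ 3 by apply: exprn_ge0; exact: ltW.
have d20 : 0 <= d ^+ 2 by apply: sqr_ge0.
have upper e : \sum_i c i * ln (h i (x i + incr d e i)) <= L0 + (m e + q e + rr).
  rewrite /L0 /m /q /rr -!big_split/=; apply: ler_sum => i _.
  have [_ _ _ _ /(_ _ (le_trans (y_le e i) dsB))] := aP i (x i).
  rewrite -/(al i) -/(be i) ler_norml => /andP[_ lz].
  have k1 : 0 <= 12 * B ^+ 3 by nonneg.
  have k2 := ler_wpM2l k1 (y3 e i).
  have := ler_wpM2l (ltW (c_gt0 i)) (le_trans lz k2).
  have : c i * (12 * B ^+ 3 * (s0 ^+ 3 * d ^+ 3)) <= 12 * B ^+ 3 * (s0 ^+ 3 * d ^+ 3).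
    by rewrite ler_piMl//; nonneg.
  by lra.
have sum_le (f : 'I_n -> R) K : (forall i, `|f i| <= K) -> `|\sum_i f i| <= n%:R * K.
  move=> fK; apply: le_trans (ler_norm_sum _ _ _) _.
  apply: le_trans (ler_sum _ (fun i _ => fK i)) _.
  by rewrite sumr_const card_ord mulr_natl.
have mG e : `|m e| <= G * d.
  apply: le_trans (sum_le _ (B * (d * s0)) _) _.
    move=> i; rewrite [`|c i * _ * _|]normrM [`|c i * _|]normrM [`|c i|]gtr0_norm// -mulrA.
    apply: le_trans (_ : `|al i| * `|incr d e i| <= _); first by rewrite ler_piMl//; nonneg.
    exact: ler_pM.
  have -> : n%:R * (B * (d * s0)) = (n%:R * (B * s0)) * d by ring.
  by rewrite ler_wpM2r ?(ltW d0).
have qG e : `|q e| <= G * d ^+ 2.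
  apply: le_trans (sum_le _ (2 * B ^+ 2 * (s0 ^+ 2 * d ^+ 2)) _) _.
    move=> i; rewrite [`|c i * _ * _|]normrM [`|c i * _|]normrM [`|c i|]gtr0_norm// -mulrA.
    apply: le_trans (_ : `|be i - al i ^+ 2 / 2| * `|incr d e i ^+ 2| <= _); first by rewrite ler_piMl//; nonneg.
    apply: ler_pM => //; last by rewrite [leLHS]ger0_norm ?sqr_ge0.
    apply: le_trans (ler_normB _ _) _.
    have : B <= B ^+ 2 by rewrite -[leLHS]expr1 ler_weXn2l.
    have : `|al i| ^+ 2 <= B ^+ 2 by rewrite ler_pXn2r ?nnegrE// ltW.
    rewrite normrM normrX [`|2^-1|]gtr0_norm//; have := beB i; lra.
  have -> : n%:R * (2 * B ^+ 2 * (s0 ^+ 2 * d ^+ 2)) = (n%:R * (2 * (B ^+ 2 * s0 ^+ 2))) * d ^+ 2 by ring.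
  by rewrite ler_wpM2r.
have rG : `|rr| <= G * d ^+ 3.
  rewrite /rr sumr_const card_ord -[_ *+ n]mulr_natl ger0_norm; last first.
    by nonneg.
  have -> : n%:R * (12 * B ^+ 3 * (s0 ^+ 3 * d ^+ 3)) = n%:R * (12 * B ^+ 3 * s0 ^+ 3) * d ^+ 3 by ring.
  by rewrite ler_wpM2r.
have G1' : 1 <= G by lra.
pose A := d ^+ 2 * \sum_i c i ^+ 2 * be i.
have lhs : avg (fun e => expR (\sum_i c i * ln (h i (x i + incr d e i)))) <=
    expR L0 * expR (A + D' * d ^+ 3).
  apply: le_trans (_ : avg (fun e => expR L0 * (1 + m e + q e + m e ^+ 2 / 2 + D' * d ^+ 3)) <= _).
    apply: avg_le => e.
    apply: le_trans (_ : expR (L0 + (m e + q e + rr)) <= _); first by rewrite ler_expR.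
    rewrite expRD ler_wpM2l ?expR_ge0//.
    have := expR_sum3 d01 G1' Gd (mG e) (qG e) rG.
    by rewrite -/D' ler_norml => /andP[]; lra.
  rewrite avgZ ler_wpM2l ?expR_ge0//.
  apply: le_trans (expR_ge1Dx _).
  under eq_avg do rewrite -!addrA.
  rewrite avgD avg_cst lerD2l !avgD avg_cst addrA addrA lerD2r.
  have -> : avg m = 0.
    by rewrite /m avg_sum big1// => i _; rewrite avgZ avg_incr mulr0.
  have -> : avg q = d ^+ 2 * \sum_i c i ^+ 2 * (be i - al i ^+ 2 / 2).
    rewrite /q avg_sum mulr_sumr; apply: eq_bigr => i _.
    by rewrite avgZ avg_incr2; ring.
  (* [S_contr] bounds the correlated sum by the diagonal one, which exactly cancels the terms
     [- al i ^+ 2 / 2] of [avg q]. *)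
  have : avg (fun e => m e ^+ 2 / 2) <= d ^+ 2 * \sum_i (c i ^+ 2 * (al i ^+ 2 / 2)).
    under eq_avg do rewrite mulrC.
    rewrite avgZ; have := avg_incr_lin2 d (fun i => c i * al i).
    rewrite -/(m _) => k; rewrite ler_pdivrMl//; apply: le_trans k _.
    rewrite mulrCA ler_wpM2l// mulr_sumr; apply: ler_sum => i _.
    by rewrite exprMn; lra.
  rewrite add0r => k; apply: le_trans (lerD (lexx _) k) _.
  rewrite -mulrDr /A -big_split/= ler_wpM2l//; apply: ler_sum => i _.
  by rewrite -mulrDr subrK.
have Bsd : 4 * B * s0 ^+ 3 * d <= 1.
  by have := ler_wpM2r (ltW d0) Gs3; lra.
have rhs : L0 + (A - D'' * d ^+ 3) <= \sum_i c i * ln (avg (fun e => h i (x i + incr d e i))).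
  rewrite /L0 /A /D'' mulr_sumr.
  have -> : n%:R * (5 * B ^+ 2 * s0 ^+ 6) * d ^+ 3 = \sum_(i < n) 5 * B ^+ 2 * s0 ^+ 6 * d ^+ 3.
    by rewrite sumr_const card_ord -[RHS]mulr_natl; ring.
  rewrite -sumrB -big_split/=; apply: ler_sum => i _.
  have [h0 _ _ hB _] := aP i (x i).
  have ci : 0 <= d ^+ 2 * c i <= d ^+ 2.
    by rewrite mulr_ge0 ?(ltW (c_gt0 i))//= ler_piMr.
  have := ln_avg_ge B1 s1 d0 dsB Bsd h0 (beB i) hB (fun e => y_le e i)
    (avg_incr d i) (avg_incr2 d i) ci.
  move=> /(ler_wpM2l (ltW (c_gt0 i))).
  have : c i * (5 * B ^+ 2 * s0 ^+ 6 * d ^+ 3) <= 5 * B ^+ 2 * s0 ^+ 6 * d ^+ 3.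
    by rewrite ler_piMl//; nonneg.
  by lra.
apply: le_trans lhs _.
by rewrite -!expRD ler_expR; move: rhs; lra.
Qed.

Fixpoint walk d N (F : ('I_n -> R) -> R) x : R :=
  if N is N'.+1 then avg (fun e => walk d N' F (fun i => x i + incr d e i)) else F x.

(** One step of coordinate [i] alone. In [walk] all coordinates move with the same signs, and it is
    this shared randomness that [flow] decouples. *)
Definition evol d i (g : R -> R) s := avg (fun e => g (s + incr d e i)).

Lemma walk_le d N F G x : (forall y, F y <= G y) -> walk d N F x <= walk d N G x.
Proof. by move=> FG; elim: N x => //= N IH x; apply: avg_le => e. Qed.

(** Each use of [flow_step] moves one average inside the logarithms. It applies at every stage with
    the same [D], because [tame_iter_avg] preserves [B]. *)
Lemma flow B : 1 <= B -> exists D d0, [/\ 0 <= D, 0 < d0 &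
  forall d h x N, 0 < d <= d0 -> (forall i, tame B (h i)) ->
  walk d N (fun y => expR (\sum_i c i * ln (h i (y i)))) x <=
  expR (N%:R * (D * d ^+ 3)) * expR (\sum_i c i * ln (iter N (evol d i) (h i) (x i)))].
Proof.
move=> B1; have [D [d0 [D0 d00 DP]]] := flow_step B1.
exists D, d0; split => // d h x N dd th.
elim: N x => [|N IH] x /=; first by rewrite mul0r expR0 mul1r.
apply: le_trans (avg_le (fun e => IH _)) _.
rewrite avgZ -[in leRHS]natr1 mulrDl mul1r expRD -mulrA ler_wpM2l ?expR_ge0//.
apply: (DP d (fun i => iter N (evol d i) (h i)) x dd) => i.
exact: tame_iter_avg.
Qed.

End Flow.

Section TameExamples.
Variable R : realType.
Implicit Types (B : R) (h g : R -> R).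

Lemma le_tame B B' h : 0 < B -> B <= B' -> tame B h -> tame B' h.
Proof.
move=> B0 BB th s; have [h0 [a [b [aB bB hB]]]] := th s.
split => //; exists a, b; split; [exact: le_trans BB|exact: le_trans BB|].
move=> y yB; apply: le_trans (hB y _) _.
  apply: le_trans yB _; rewrite lef_pV2 ?posrE ?ler_pM2l//; lra.
by rewrite ler_wpM2r ?exprn_ge0// ler_wpM2r// ltW.
Qed.

Lemma tame_family n (h : 'I_n -> R -> R) :
  (forall i, exists2 B, 1 <= B & tame B (h i)) ->
  exists2 B, 1 <= B & forall i, tame B (h i).
Proof.
move=> hB; have /choice[B BP] : forall i, exists B, 1 <= B /\ tame B (h i).
  by move=> i; have [B ? ?] := hB i; exists B.
have B0 i : 0 <= B i by case: (BP i) => [k _]; lra.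
exists (1 + \sum_i B i) => [|i]; first by rewrite lerDl sumr_ge0.
have [B1 tB] := BP i; apply: le_tame tB; first by lra.
by rewrite (bigD1 i)//= addrCA lerDl addr_ge0// sumr_ge0.
Qed.

(** Used for the power k = 1 / c_i of the i-th factor. The expansion of ln g is multiplied by [k]
    and exponentiated, which returns half the square of the first order term to the second order. *)
Lemma tame_expR_ln (k : R) B g : 0 < k -> 1 <= B -> tame B g ->
  exists2 B', 1 <= B' & tame B' (fun s => expR (k * ln (g s))).
Proof.
move=> k0 B1 tg; pose G := 12 * (1 + k) * B ^+ 3.
have B0 : 0 < B by lra.
have B31 : 1 <= B ^+ 3 by rewrite exprn_ege1.
have kB : 0 <= k * B ^+ 3 by nonneg.
have G12 : 12 <= G by rewrite /G; lra.
have e0 := expR_gt0 (1 : R).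
have e1 : 1 <= expR (1 : R) by rewrite -[leLHS]expR0 ler_expR.
pose B' := (5 + 27 * expR 1) * G ^+ 3.
have G1 : G <= G ^+ 3 by rewrite -[leLHS]expr1 ler_weXn2l//; lra.
have G2 : G ^+ 2 <= G ^+ 3 by rewrite ler_weXn2l//; lra.
have B'G : 32 * G ^+ 3 <= B' by rewrite /B' ler_wpM2r//; lra.
have BB3 : B <= B ^+ 3 by rewrite -[leLHS]expr1 ler_weXn2l.
have BG : B <= G by rewrite /G; lra.
have B2 : B ^+ 2 <= B ^+ 3 by rewrite ler_weXn2l.
have kBB : k * B <= G.
  have : k * B <= k * B ^+ 3 by rewrite ler_wpM2l ?(ltW k0).
  by rewrite /G; lra.
have kG2 : k * (2 * B ^+ 3) <= G by rewrite /G; lra.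
have kG : k * (12 * B ^+ 3) <= G by rewrite /G; lra.
have B'E : (5 + 27 * expR 1) * G ^+ 3 = B' by [].
clearbody B' G.
exists B'; first by lra.
have [ab abP] := tame_ln B1 tg.
move=> s; split; first exact: expR_gt0.
have [g0 aB bB _ lz] := abP s.
set a := (ab s).1 in aB lz; set b := (ab s).2 in bB lz.
exists (k * a), (k * (b - a ^+ 2 / 2) + (k * a) ^+ 2 / 2).
have ka : `|k * a| <= G.
  by rewrite normrM gtr0_norm//; apply: le_trans kBB; rewrite ler_wpM2l// ltW.
have kb : `|k * (b - a ^+ 2 / 2)| <= G.
  rewrite normrM gtr0_norm//; apply: le_trans (_ : k * (2 * B ^+ 3) <= _) => //.
  rewrite ler_wpM2l ?(ltW k0)//; apply: le_trans (ler_normB _ _) _.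
  have : `|a| ^+ 2 <= B ^+ 2 by rewrite ler_pXn2r ?nnegrE// ltW.
  rewrite normrM normrX [`|2^-1|]gtr0_norm//; lra.
split.
- by apply: (le_trans ka); lra.
- apply: le_trans (ler_normD _ _) _.
  have : `|k * a| ^+ 2 <= G ^+ 2 by rewrite ler_pXn2r ?nnegrE//; lra.
  rewrite [`|_ / 2|]normrM normrX [`|2^-1|]gtr0_norm//; lra.
move=> y yB'.
have B'0 : 0 < B' by lra.
have y8 : `|y| <= (8 * B)^-1.
  by apply: le_trans yB' _; rewrite lef_pV2 ?posrE ?ler_pM2l//; lra.
have yG : G * `|y| <= 3^-1.
  have : 8 * B' * `|y| <= 1 by rewrite mulrC -ler_pdivlMr ?mul1r//; lra.
  have : G * `|y| <= B' * `|y| by rewrite ler_wpM2r//; lra.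
  lra.
have y1 : 0 <= `|y| <= 1.
  by rewrite normr_ge0/=; have := normr_ge0 y; nra.
pose r := k * (ln (g (s + y)) - (ln (g s) + (a * y + (b - a ^+ 2 / 2) * y ^+ 2))).
have rB : `|r| <= G * `|y| ^+ 3.
  rewrite /r normrM gtr0_norm//; apply: le_trans (ler_wpM2l (ltW k0) (lz y y8)) _.
  by rewrite mulrA ler_wpM2r ?exprn_ge0.
have -> : k * ln (g (s + y)) = k * ln (g s) +
    (k * a * y + k * (b - a ^+ 2 / 2) * y ^+ 2 + r) by rewrite /r; ring.
rewrite expRD.
have m1 : `|k * a * y| <= G * `|y| by rewrite normrM ler_wpM2r.
have q1 : `|k * (b - a ^+ 2 / 2) * y ^+ 2| <= G * `|y| ^+ 2.
  by rewrite normrM [`|y ^+ 2|]normrX ler_wpM2r ?sqr_ge0.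
have G1' : 1 <= G by lra.
rewrite -mulrBr normrM [`|expR _|]gtr0_norm ?expR_gt0//.
rewrite -[leRHS]mulrA [leRHS]mulrCA ler_wpM2l ?expR_ge0//.
have := expR_sum3 y1 G1' yG m1 q1 rB; rewrite B'E.
congr (`|_| <= _); by ring.
Qed.

(** The Gaussian estimates are absolute, while [tame] asks for errors relative to the value. The
    lower bound [t] of the value converts one into the other at the cost of a factor 1 / t in
    [B]. *)
Lemma tame_mix (I : finType) (p xs : I -> R) (t : R) : 0 < t -> (forall z, 0 <= p z) ->
  exists2 B, 1 <= B &
  tame B (fun s => t + \sum_z p z * expR (- ((s - xs z) ^+ 2 / 2))).
Proof.
move=> t0 p0; pose P := \sum_z p z; pose C : R := 6 * expR 4 + 1.
have P0 : 0 <= P by apply: sumr_ge0.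
have C1 : 1 <= C by rewrite /C lerDr mulr_ge0 ?expR_ge0.
have PC : 0 <= C * P / t by rewrite divr_ge0 ?mulr_ge0// ?ltW//; lra.
exists (1 + C * P / t) => [|s]; first by lra.
pose w z := expR (- ((s - xs z) ^+ 2 / 2)).
have w0 z : 0 < w z by apply: expR_gt0.
set g := t + _.
have g0 : 0 < g.
  by rewrite ltr_wpDr// sumr_ge0// => z _; rewrite mulr_ge0// expR_ge0.
have tg : t <= g by rewrite lerDl sumr_ge0// => z _; rewrite mulr_ge0// expR_ge0.
split => //.
have bnd (f : I -> R) : (forall z, w z * `|f z| <= 1) ->
    `|(\sum_z p z * (w z * f z)) / g| <= 1 + C * P / t.
  move=> fw; rewrite normrM [`|g^-1|]gtr0_norm ?invr_gt0// ler_pdivrMr//.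
  apply: le_trans (ler_norm_sum _ _ _) _.
  apply: le_trans (_ : P <= _).
    apply: ler_sum => z _; rewrite normrM ger0_norm// ler_piMr//.
    by rewrite normrM gtr0_norm.
  have : P <= C * P / t * g.
    have : C * P / t * t <= C * P / t * g by rewrite ler_wpM2l.
    rewrite divfK ?gt_eqF//; have : P <= C * P by rewrite ler_peMl.
    lra.
  lra.
exists ((\sum_z p z * (w z * - (s - xs z))) / g).
exists ((\sum_z p z * (w z * (((s - xs z) ^+ 2 - 1) / 2))) / g).
split.
- by apply: bnd => z; rewrite normrN gauss_mul_le.
- by apply: bnd => z; rewrite gauss_mul2_le.
move=> y yB.
have y1 : `|y| <= 1.
  by apply: le_trans yB _; rewrite invf_le1; lra.
rewrite mulrDr mulrDr mulr1 ![g * (_ / g * _)]mulrA ![g * (_ / g)]mulrC !divfK ?gt_eqF//.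
rewrite /g !mulr_suml opprD opprD.
have -> : t + \sum_z p z * expR (- ((s + y - xs z) ^+ 2 / 2)) +
   (- (t + \sum_z p z * w z) - \sum_z p z * (w z * - (s - xs z)) * y -
    \sum_z p z * (w z * (((s - xs z) ^+ 2 - 1) / 2)) * y ^+ 2) =
   \sum_z p z * (expR (- ((s + y - xs z) ^+ 2 / 2)) - w z * (1 - (s - xs z) * y + ((s - xs z) ^+ 2 - 1) / 2 * y ^+ 2)).
  rewrite [RHS](eq_bigr (fun z => p z * expR (- ((s + y - xs z) ^+ 2 / 2)) + (- (p z * w z) +
    (- (p z * (w z * - (s - xs z)) * y) -
     p z * (w z * (((s - xs z) ^+ 2 - 1) / 2)) * y ^+ 2)))); last by move=> z _; ring.
  rewrite !big_split/= !sumrN; ring.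
apply: le_trans (ler_norm_sum _ _ _) _.
apply: le_trans (_ : \sum_z p z * (C * `|y| ^+ 3) <= _).
  apply: ler_sum => z _; rewrite normrM ger0_norm// ler_wpM2l//.
  by rewrite addrAC; apply: gauss_taylor.
rewrite -mulr_suml -/P mulrA ler_wpM2r ?exprn_ge0// -/g.
have : C * P / t * t <= C * P / t * g by rewrite ler_wpM2l.
rewrite divfK ?gt_eqF//; lra.
Qed.

End TameExamples.

Section Lindeberg.
Variables (R : realType) (n : nat).
Implicit Types (w : 'I_n -> R) (s t d : R).

(** Lindeberg replacement, one sign at a time: pairing [e] with [flip j e] turns the average over
    sign [j] into the mean in [heat_step], which adds [w j ^+ 2] to the variance and at most
    [11 * d ^+ 4] to the error. *)
Lemma avg_heat_le w s t d : 0 <= t -> d ^+ 2 <= 2^-1 -> (forall j, `|w j| <= d) ->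
  avg (fun e => heat t (s + dot w e)) <= heat (t + \sum_j w j ^+ 2) s + n%:R * (11 * d ^+ 4).
Proof.
move=> t0 d2 wd.
have w2 j : w j ^+ 2 <= d ^+ 2.
  by rewrite -real_normK ?num_real// ler_pXn2r ?nnegrE//; exact: le_trans (wd j).
suff H (r : seq 'I_n) : uniq r -> forall t, 0 <= t ->
    avg (fun e => heat t (s + \sum_(j <- r) w j * sgn (e j))) <=
    heat (t + \sum_(j <- r) w j ^+ 2) s + (size r)%:R * (11 * d ^+ 4).
  have := H _ (index_enum_uniq 'I_n) t t0.
  by rewrite -[index_enum _]enumT size_enum_ord enumT.
elim: r => [_ {}t {}t0|j r IH /= /andP[jr ur] {}t {}t0].
  rewrite !big_nil addr0 mul0r addr0; under eq_avg do rewrite big_nil addr0.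
  by rewrite avg_cst.
have fl : avg (fun e => heat t (s + \sum_(i <- j :: r) w i * sgn (e i))) <=
    avg (fun e => heat (t + w j ^+ 2) (s + \sum_(i <- r) w i * sgn (e i)) + 11 * d ^+ 4).
  have -> : avg (fun e => heat t (s + \sum_(i <- j :: r) w i * sgn (e i))) =
     avg (fun e => (heat t ((s + \sum_(i <- r) w i * sgn (e i)) + w j) +
       heat t ((s + \sum_(i <- r) w i * sgn (e i)) - w j)) / 2).
    set F := fun e : {ffun 'I_n -> bool} => _.
    have E1 : avg F = 2^-1 * (avg F + avg (fun e => F (flip j e))).
      by rewrite -avg_flip; field.
    rewrite [LHS]E1 -avgD -avgZ; apply: eq_avg => e; rewrite mulrC; congr (_ / 2).
    rewrite /F !big_cons sgn_flip eqxx.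
    have -> : \sum_(i <- r) w i * sgn (flip j e i) = \sum_(i <- r) w i * sgn (e i).
      rewrite [LHS]big_seq [RHS]big_seq; apply: eq_bigr => i ir.
      by rewrite sgn_flip; case: eqP ir jr => // -> ->.
    rewrite [w j * _ + _]addrC [w j * - _ + _]addrC !addrA.
    by case: (e j); rewrite /sgn ?expr0 ?expr1 ?opprK ?mulr1 ?mulrN1 ?opprK//; exact: addrC.
  apply: avg_le => e.
  have wj : w j ^+ 2 <= 2^-1 by apply: le_trans (w2 j) _.
  have := heat_step (s + \sum_(i <- r) w i * sgn (e i)) t0 wj.
  have : w j ^+ 4 <= d ^+ 4.
    by rewrite ![_ ^+ 4](exprM _ 2 2) ler_pXn2r ?nnegrE ?sqr_ge0.
  by rewrite ler_norml => ? /andP[]; lra.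
apply: le_trans fl _; rewrite avgD avg_cst big_cons addrA -[in leRHS]natr1 [(_ + 1) * _]mulrDl [1 * (11 * _)]mul1r [leRHS]addrA lerD2r.
by apply: IH => //; rewrite addr_ge0// sqr_ge0.
Qed.

End Lindeberg.

(** * Random walks and the Brascamp-Lieb bound *)

Section Walk.
Variables (R : realType) (n : nat).

Lemma avg_prod (psi : 'I_n -> bool -> R) :
  avg (fun e => \prod_j psi j (e j)) = \prod_j ((psi j true + psi j false) / 2).
Proof.
rewrite big_split/= prodr_const card_ord /avg card_ffun card_ord card_bool.
under [in RHS]eq_bigr do rewrite -(big_bool (GRing.add : Monoid.law 0) (psi _)).
by rewrite bigA_distr_bigA/= mulrC natrX exprVn.
Qed.

Lemma prodr_sub_le (I : finType) (a b : I -> R) :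
  (forall i, 0 <= a i <= 1) -> (forall i, 0 <= b i <= 1) ->
  `|\prod_i a i - \prod_i b i| <= \sum_i `|a i - b i|.
Proof.
move=> a01 b01; elim: (index_enum I) => [|i r IH]; first by rewrite !big_nil subrr normr0.
rewrite !big_cons.
have pb : 0 <= \prod_(j <- r) b j <= 1.
  by apply/andP; split; [apply: prodr_ge0|apply: prodr_ile1] => j _ //; case/andP: (b01 j).
have -> : a i * \prod_(j <- r) a j - b i * \prod_(j <- r) b j =
  (a i - b i) * \prod_(j <- r) b j + a i * (\prod_(j <- r) a j - \prod_(j <- r) b j) by ring.
apply: le_trans (ler_normD _ _) _; rewrite !normrM; case/andP: pb => pb0 pb1.
case/andP: (a01 i) => a0 a1.
apply: lerD; first by rewrite [`|\prod_(_ <- _) _|]ger0_norm// ler_piMr.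
by rewrite [`|a i|]ger0_norm//; apply: le_trans IH; rewrite ler_piMl.
Qed.

Variable S : 'M[R]_n.
Implicit Types (d : R) (x y a : 'I_n -> R) (F G : ('I_n -> R) -> R).

Lemma walk_shift d N F a x :
  walk S d N (fun y => F (fun i => y i - a i)) x = walk S d N F (fun i => x i - a i).
Proof.
elim: N x => //= N IH x; apply: eq_avg => e; rewrite IH; congr (walk _ _ _ _ _).
by apply/funext => i; rewrite addrAC.
Qed.

Lemma walk_sum (I : finType) d N (q : I -> R) (F : I -> ('I_n -> R) -> R) x :
  walk S d N (fun y => \sum_z q z * F z y) x = \sum_z q z * walk S d N (F z) x.
Proof.
elim: N x => //= N IH x; under eq_avg do rewrite IH.
by rewrite avg_sum; apply: eq_bigr => z _; rewrite avgZ.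
Qed.

Lemma iter_evol_le d i N (f g : R -> R) s : (forall v, f v <= g v) ->
  iter N (evol S d i) f s <= iter N (evol S d i) g s.
Proof. by move=> fg; elim: N s => //= N IH s; apply: avg_le => e. Qed.

Lemma eq_iter_evol d i N (f g : R -> R) s : f =1 g ->
  iter N (evol S d i) f s = iter N (evol S d i) g s.
Proof. by move=> fg; elim: N s => //= N IH s; apply: eq_avg => e. Qed.

Lemma iter_evol_affine (I : finType) d i N (t : R) (q xs : I -> R) (f : R -> R) s :
  iter N (evol S d i) (fun v => t + \sum_z q z * f (v - xs z)) s =
  t + \sum_z q z * iter N (evol S d i) f (s - xs z).
Proof.
elim: N s => //= N IH s; rewrite /evol; under eq_avg do rewrite IH.
rewrite avgD avg_cst avg_sum; congr (_ + _); apply: eq_bigr => z _; rewrite avgZ.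
by congr (_ * _); apply: eq_avg => e; rewrite addrAC.
Qed.

Lemma iter_evolZ d i N (t : R) (f : R -> R) s :
  iter N (evol S d i) (fun v => t * f v) s = t * iter N (evol S d i) f s.
Proof. by elim: N s => //= N IH s; rewrite /evol; under eq_avg do rewrite IH; rewrite avgZ. Qed.

Lemma iter_evol_heat_le d i N (t s : R) : 0 <= d -> d ^+ 2 <= 2^-1 -> 0 <= t ->
  (forall j, `|S i j| <= 1) ->
  iter N (evol S d i) (heat t) s <=
  heat (t + N%:R * (d ^+ 2 * \sum_j S i j ^+ 2)) s + N%:R * (n%:R * (11 * d ^+ 4)).
Proof.
move=> d0 d2 t0 S1; elim: N s => [|N IH] s /=; first by rewrite !mul0r !addr0.
have c0 : 0 <= d ^+ 2 * \sum_j S i j ^+ 2.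
  by rewrite mulr_ge0 ?sqr_ge0// sumr_ge0// => j _; rewrite sqr_ge0.
apply: le_trans (avg_le (fun e => IH _)) _.
rewrite avgD avg_cst.
set t' := t + _ in IH *.
have t'0 : 0 <= t' by rewrite addr_ge0// mulr_ge0.
have wd j : `|d * S i j| <= d by rewrite normrM ger0_norm// ler_piMr.
have := avg_heat_le s t'0 d2 wd.
have -> : (fun e => heat t' (s + dot (fun j => d * S i j) e)) =
    (fun e => heat t' (s + incr S d e i)).
  apply/funext => e; congr (heat _ (_ + _)); rewrite /incr /dot mulr_sumr.
  by apply: eq_bigr => j _; rewrite mulrA.
have -> : \sum_j (d * S i j) ^+ 2 = d ^+ 2 * \sum_j S i j ^+ 2.
  by rewrite mulr_sumr; apply: eq_bigr => j _; rewrite exprMn.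
have -> : t + N.+1%:R * (d ^+ 2 * \sum_j S i j ^+ 2) = t' + d ^+ 2 * \sum_j S i j ^+ 2.
  by rewrite /t' -natr1; ring.
by rewrite -natr1 => h; lra.
Qed.

End Walk.

(** * The anisotropic walk on a discrete product measure *)

Section Core.
Variables (R : realType) (n : nat) (O : 'M[R]_n) (om : 'I_n -> R).
Implicit Types (d t l : R) (y w b : 'I_n -> R).
Hypothesis OOt : O *m O^T = 1%:M.
Hypothesis om01 : forall j, 0 <= om j <= 1.

Definition coor (y : 'I_n -> R) j : R := \sum_i O j i * y i.

Lemma O_rows j k : \sum_i O j i * O k i = (j == k)%:R.
Proof.
have /matrixP/(_ j k) := OOt; rewrite !mxE => <-.
by apply: eq_bigr => i _; rewrite mxE.
Qed.

Lemma O_cols i k : \sum_j O j i * O j k = (i == k)%:R.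
Proof.
have /matrixP/(_ i k) := mulmx1C OOt; rewrite !mxE => <-.
by apply: eq_bigr => j _; rewrite mxE.
Qed.

Lemma O_col1 i : \sum_j O j i ^+ 2 = 1.
Proof. by have := O_cols i i; rewrite eqxx. Qed.

Lemma coor_norm y : \sum_j coor y j ^+ 2 = \sum_i y i ^+ 2.
Proof.
under eq_bigr do rewrite /coor expr2 mulr_suml.
rewrite exchange_big; apply: eq_bigr => i _ /=.
under eq_bigr do rewrite mulr_sumr.
rewrite exchange_big (bigD1 i)//= [X in _ + X]big1 ?addr0.
  under eq_bigr do rewrite mulrACA.
  by rewrite -mulr_suml O_cols eqxx mul1r expr2.
move=> k ki; under eq_bigr do rewrite mulrACA.
by rewrite -mulr_suml O_cols eq_sym (negbTE ki) mul0r.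
Qed.

(* In the coordinates [coor], the increments with this matrix are independent
   signs, with standard deviation [om j] in direction [j]. *)
Definition stepmx : 'M[R]_n := \matrix_(i, j) (om j * O j i).

Lemma coor_incr d (e : {ffun 'I_n -> bool}) y j :
  coor (fun i => y i + incr stepmx d e i) j = coor y j + d * om j * sgn (e j).
Proof.
rewrite /coor; under eq_bigr do rewrite mulrDr.
rewrite big_split/=; congr (_ + _).
under eq_bigr => i _ do rewrite /incr /dot mulrCA mulr_sumr.
rewrite -mulr_sumr exchange_big/= -mulrA; congr (_ * _).
rewrite (bigD1 j)//= [X in _ + X]big1 ?addr0.
  under eq_bigr do rewrite mxE mulrA mulrCA.
  by rewrite -mulr_suml -mulr_sumr O_rows eqxx mulr1.
move=> k kj; under eq_bigr do rewrite mxE mulrA mulrCA.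
by rewrite -mulr_suml -mulr_sumr O_rows eq_sym (negbTE kj) mulr0 mul0r.
Qed.

(** The expectation of exp (- |y + Z|^2 / 2) for a centred Gaussian Z whose components along the
    rows of [O] are independent, with variance [t * om j ^+ 2] along row [j]. *)
Definition heatn (t : R) (y : 'I_n -> R) : R := \prod_j heat (t * om j ^+ 2) (coor y j).

Lemma om2 j : 0 <= om j ^+ 2 <= 1.
Proof. by case/andP: (om01 j) => o0 o1; rewrite exprn_ge0//= exprn_ile1. Qed.

(** In the coordinates [coor] a step moves direction [j] by the single sign [e j], so the average
    factors and [heat_step] applies to each factor. The errors merely add up, because all factors
    lie in [0, 1]. *)
Lemma walk_heatn_ge d N t y : 0 <= d -> d ^+ 2 <= 2^-1 -> 0 <= t ->
  heatn (t + N%:R * d ^+ 2) y - N%:R * (n%:R * (11 * d ^+ 4)) <=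
  walk stepmx d N (heatn t) y.
Proof.
move=> d0 d2 t0; elim: N y => [|N IH] y /=; first by rewrite !mul0r subr0 addr0.
apply: le_trans (avg_le (fun e => IH _)).
rewrite avgD avg_cst.
set t' := t + _ in IH *.
have t'0 : 0 <= t' by rewrite addr_ge0// mulr_ge0 ?sqr_ge0.
pose psi j (b : bool) := heat (t' * om j ^+ 2) (coor y j + d * om j * sgn b).
have tj j : 0 <= t' * om j ^+ 2 by rewrite mulr_ge0//; case/andP: (om2 j).
have h01 (r s : R) : 0 <= r -> 0 <= heat r s <= 1.
  by move=> r0; rewrite ltW ?heat_gt0//= heat_le1.
have -> : avg (fun e => heatn t' (fun i => y i + incr stepmx d e i)) =
    \prod_j ((psi j true + psi j false) / 2).
  rewrite -avg_prod; apply: eq_avg => e; apply: eq_bigr => j _.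
  by rewrite coor_incr.
have E : heatn (t + N.+1%:R * d ^+ 2) y =
    \prod_j heat (t' * om j ^+ 2 + (d * om j) ^+ 2) (coor y j).
  have -> : t + N.+1%:R * d ^+ 2 = t' + d ^+ 2 by rewrite /t' -natr1 mulrDl mul1r addrA.
  by apply: eq_bigr => j _; rewrite mulrDl exprMn.
have a01 j : 0 <= heat (t' * om j ^+ 2 + (d * om j) ^+ 2) (coor y j) <= 1.
  by apply: h01; rewrite addr_ge0// sqr_ge0.
have b01 j : 0 <= (psi j true + psi j false) / 2 <= 1.
  have /andP[] := h01 _ (coor y j + d * om j * sgn true) (tj j).
  have /andP[] := h01 _ (coor y j + d * om j * sgn false) (tj j).
  rewrite /psi => *; apply/andP; split; lra.
have := prodr_sub_le a01 b01; rewrite -E.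
have : \sum_j `|heat (t' * om j ^+ 2 + (d * om j) ^+ 2) (coor y j) - (psi j true + psi j false) / 2|
    <= \sum_(j < n) 11 * d ^+ 4.
  apply: ler_sum => j _.
  have dj : (d * om j) ^+ 2 <= d ^+ 2.
    by rewrite exprMn ler_piMr ?sqr_ge0//; case/andP: (om2 j).
  have dj4 : (d * om j) ^+ 4 <= d ^+ 4.
    by rewrite ![_ ^+ 4](exprM _ 2 2) ler_pXn2r ?nnegrE ?sqr_ge0.
  have := heat_step (coor y j) (tj j) (le_trans dj d2).
  rewrite distrC /psi /sgn expr0 expr1 mulr1 mulrN1 [X in X / 2]addrC; lra.
rewrite sumr_const card_ord -[_ *+ n]mulr_natl.
rewrite ler_norml -natr1 => h1 /andP[_ h2]; lra.
Qed.

Variables (I : finType) (p xs : 'I_n -> I -> R) (u : 'I_n -> R) (K : R).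
Hypothesis p_ge0 : forall i z, 0 <= p i z.
Hypothesis p_le1 : forall i, \sum_z p i z <= 1.
Hypothesis K_gt0 : 0 < K.
Hypothesis K_ub : forall i v, \sum_z p i z * expR (- ((v - xs i z) ^+ 2 / 2)) <= K.
Hypothesis om_gt0 : forall j, 0 < om j.

Definition wt (z : {ffun 'I_n -> I}) : R := \prod_i p i (z i).

Lemma wt_ge0 z : 0 <= wt z. Proof. exact: prodr_ge0. Qed.

Lemma sum_wt : \sum_z wt z <= 1.
Proof.
rewrite /wt -(bigA_distr_bigA p); apply: prodr_ile1 => i _.
by rewrite p_le1 andbT sumr_ge0.
Qed.

(** The variance of coordinate [i] in one step of the walk with d = 1, which is the Brascamp-Lieb
    exponent of that coordinate. *)
Definition cc i : R := \sum_j om j ^+ 2 * O j i ^+ 2.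

Lemma cc_le1 i : cc i <= 1.
Proof.
rewrite -[leRHS](O_col1 i); apply: ler_sum => j _.
by rewrite ler_piMl ?sqr_ge0//; case/andP: (om2 j).
Qed.

Lemma cc_gt0 i : 0 < cc i.
Proof.
rewrite lt_neqAle sumr_ge0 ?andbT; last by move=> j _; rewrite mulr_ge0 ?sqr_ge0.
apply/eqP => /esym/psumr_eq0P h.
have : (1 : R) = 0.
  rewrite -(O_col1 i); apply: big1 => j _.
  have /eqP := h (fun j _ => mulr_ge0 (sqr_ge0 _) (sqr_ge0 _)) j isT.
  by rewrite mulf_eq0 sqrf_eq0 gt_eqF//= => /eqP.
by move/eqP; rewrite oner_eq0.
Qed.

Lemma sum_cc : \sum_i cc i = \sum_j om j ^+ 2.
Proof.
rewrite exchange_big/=; apply: eq_bigr => j _.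
rewrite -mulr_sumr -[RHS]mulr1; congr (_ * _).
by have := O_rows j j; rewrite eqxx => h; apply: etrans h; apply: eq_bigr => i _; rewrite expr2.
Qed.

(** The flow runs for the total time N d^2 = l^2. With d = l / k and N = k^2 the accumulated errors
    are of order 1 / k and 1 / k^2, so a large k suffices. *)
Lemma step_params (A B D d0 l : R) : 0 < d0 -> 0 < D -> 0 < l ->
  exists N d, [/\ 0 < d <= d0, N%:R * d ^+ 2 = l ^+ 2, N%:R * (A * d ^+ 3) <= D &
   N%:R * (B * d ^+ 4) <= D].
Proof.
move=> d00 D0 l0.
pose X := l / d0 + `|A| * l ^+ 3 / D + `|B| * l ^+ 4 / D + 1.
have a1 : 0 <= l / d0 by apply: divr_ge0; nonneg.
have a2 : 0 <= `|A| * l ^+ 3 / D by apply: divr_ge0; nonneg.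
have a3 : 0 <= `|B| * l ^+ 4 / D by apply: divr_ge0; nonneg.
have X1 : 1 <= X by rewrite /X; lra.
pose k := (Num.truncn X).+1.
have kX : X < k%:R by apply: truncnS_gt.
have k0 : (0 : R) < k%:R by lra.
exists (k ^ 2)%N, (l / k%:R); rewrite natrX; split.
- rewrite divr_gt0//= ler_pdivrMr// mulrC -ler_pdivrMr//; rewrite /X in kX; lra.
- by field; rewrite gt_eqF.
- have -> : k%:R ^+ 2 * (A * (l / k%:R) ^+ 3) = A * l ^+ 3 / k%:R by field; rewrite gt_eqF.
  rewrite ler_pdivrMr// [D * _]mulrC -ler_pdivrMr//.
  apply: le_trans (_ : `|A| * l ^+ 3 / D <= _); last by rewrite /X in kX; lra.
  by rewrite ler_pM2r ?invr_gt0// ler_pM2r ?exprn_gt0// ler_norm.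
- have -> : k%:R ^+ 2 * (B * (l / k%:R) ^+ 4) = B * l ^+ 4 / k%:R / k%:R by field; rewrite gt_eqF.
  apply: le_trans (_ : `|B| * l ^+ 4 / k%:R <= _).
    rewrite ler_pdivrMr//.
    apply: le_trans (_ : `|B| * l ^+ 4 / k%:R <= _).
      by rewrite ler_pM2r ?invr_gt0// ler_pM2r ?exprn_gt0// ler_norm.
    by apply: ler_peMr; [apply: divr_ge0; nonneg|lra].
  rewrite ler_pdivrMr// [D * _]mulrC -ler_pdivrMr//; rewrite /X in kX; lra.
Qed.

Lemma heatn0 w : heatn 0 w = \prod_i expR (- (w i ^+ 2 / 2)).
Proof.
have E (f : 'I_n -> R) : \prod_i expR (- (f i ^+ 2 / 2)) = expR (- ((\sum_i f i ^+ 2) / 2)).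
  by rewrite mulr_suml -sumrN expR_sum.
rewrite E -coor_norm -E; apply: eq_bigr => j _.
by rewrite mul0r heat0.
Qed.

Lemma stepmx_row i : \sum_j stepmx i j ^+ 2 = cc i.
Proof. by apply: eq_bigr => j _; rewrite mxE exprMn. Qed.

Lemma stepmx_contr b :
  \sum_j (\sum_i b i * stepmx i j) ^+ 2 <= \sum_i b i ^+ 2.
Proof.
rewrite -(coor_norm b); apply: ler_sum => j _.
have -> : \sum_i b i * stepmx i j = om j * coor b j.
  by rewrite /coor mulr_sumr; apply: eq_bigr => i _; rewrite mxE mulrC mulrA.
by rewrite exprMn ler_piMl ?sqr_ge0//; case/andP: (om2 j).
Qed.

Lemma stepmx_le1 i j : `|stepmx i j| <= 1.
Proof.
have : stepmx i j ^+ 2 <= 1.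
  apply: le_trans (cc_le1 i); rewrite -stepmx_row (bigD1 j)//= lerDl sumr_ge0// => k _.
  exact: sqr_ge0.
by rewrite -real_normK ?num_real// -[X in _ <= X](expr1n _ 2) ler_pXn2r ?nnegrE.
Qed.

Let g (t : R) i (v : R) := t + \sum_z p i z * expR (- ((v - xs i z) ^+ 2 / 2)).

(* Brascamp-Lieb with exponents [cc i], for the powers [1 / cc i] of [g t i].
   The summand [t] in [g t i] keeps the functions positive, and hence tame. *)
Lemma core_flow l : 0 < l ->
  \sum_z wt z * heatn (l ^+ 2) (fun i => u i - xs i (z i)) <=
  (1 + expR 2) *
  expR (\sum_i ((1 - cc i) * ln (2 * K) - cc i * (ln (1 + l ^+ 2 * cc i) / 2))).
Proof.
move=> l0; set Q := expR (\sum_i _).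
have Q0 : 0 < Q by apply: expR_gt0.
pose sl := Num.sqrt (1 + l ^+ 2).
have sl0 : 0 < sl by rewrite sqrt1D_gt0// sqr_ge0.
(* [t] is also the tolerance for the accumulated errors. The bound by 1 limits the loss of the flow
   to a factor e; [K] gives [g t i v <= 2 * K]; [Q] absorbs the additive error in [lower]; the last
   bound makes the two summands [t] in [upper] cost a factor of at most exp (1 / (n + 1)) per
   coordinate, hence at most e in all. *)
pose t := Num.min (Num.min 1 K) (Num.min Q (2 * n.+1%:R * sl)^-1).
have t0 : 0 < t.
  by rewrite !lt_min ltr01 K_gt0 Q0 invr_gt0 !mulr_gt0// ltr0n.
have t1 : t <= 1 by rewrite !ge_min lexx.
have tK : t <= K by rewrite !ge_min lexx ?orbT.
have tQ : t <= Q by rewrite !ge_min lexx ?orbT.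
have tl : t <= (2 * n.+1%:R * sl)^-1 by rewrite !ge_min lexx ?orbT.
have g0 i v : 0 < g t i v.
  by rewrite ltr_wpDr// sumr_ge0// => z _; rewrite mulr_ge0// expR_ge0.
have gK i v : g t i v <= 2 * K by have := K_ub i v; rewrite /g; lra.
pose h i v := expR ((cc i)^-1 * ln (g t i v)).
have [B B1 hB] : exists2 B, 1 <= B & forall i, tame B (h i).
  apply: tame_family => i.
  have [B B1 gB] := tame_mix (xs i) t0 (p_ge0 i).
  by apply: tame_expR_ln gB => //; rewrite invr_gt0 cc_gt0.
have [D [d0 [D0 d00 fl]]] := flow cc_gt0 cc_le1 stepmx_row stepmx_contr B1.
have [|N [d [/andP[dp dd] Nd ND Nn]]] := @step_params D (n%:R * 11) t (Num.min d0 2^-1) l _ t0 l0.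
  by rewrite lt_min d00 invr_gt0 ltr0n.
have dd0 : d <= d0 by apply: le_trans dd _; rewrite ge_min lexx.
have d2 : d <= 2^-1 by apply: le_trans dd _; rewrite ge_min lexx orbT.
have dsq : d ^+ 2 <= 2^-1 by have := dp; nra.
have ddd : 0 < d <= d0 by rewrite dp.
have := fl d h u N ddd hB.
(* By rotation invariance ([heatn0]) the Gaussian at time 0 factors over the original coordinates,
   so its sum against [wt] is a product of sums, each below [g t i]. The walk then carries time 0 to
   time l^2. *)
have lower : \sum_z wt z * heatn (l ^+ 2) (fun i => u i - xs i (z i)) - t <=
   walk stepmx d N (fun y => expR (\sum_i cc i * ln (h i (y i)))) u.
  apply: le_trans (_ : walk stepmx d N (fun y => \sum_z wt z * heatn 0 (fun i => y i - xs i (z i))) u <= _); last first.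
    apply: walk_le => y.
    under eq_bigr do rewrite heatn0 /wt -big_split/=.
    rewrite -(bigA_distr_bigA (fun i z => p i z * expR (- ((y i - xs i z) ^+ 2 / 2)))) expR_sum.
    apply: ler_prod => i _; apply/andP; split.
      by apply: sumr_ge0 => z _; rewrite mulr_ge0// expR_ge0.
    rewrite expRK mulrA divff ?mul1r ?gt_eqF ?cc_gt0// lnK ?posrE//.
    by rewrite /g lerDr ltW.
  rewrite (walk_sum stepmx d N wt (fun z y => heatn 0 (fun i => y i - xs i (z i)))).
  apply: le_trans (_ : \sum_z wt z * (heatn (l ^+ 2) (fun i => u i - xs i (z i)) - t) <= _).
    under [leRHS]eq_bigr do rewrite mulrBr.
    rewrite sumrB lerD2l lerN2 -mulr_suml ler_piMl ?sum_wt//; exact: ltW.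
  apply: ler_sum => z _; rewrite ler_wpM2l ?wt_ge0//.
  rewrite (walk_shift stepmx d N (heatn 0) (fun i => xs i (z i))).
  apply: le_trans (walk_heatn_ge N _ (ltW dp) dsq (lexx 0)).
  by rewrite add0r Nd lerD2l lerN2; move: Nn; rewrite -!mulrA.
have upper i : ln (iter N (evol stepmx d i) (h i) (u i)) <=
   ((cc i)^-1 - 1) * ln (2 * K) - ln (1 + l ^+ 2 * cc i) / 2 + n.+1%:R^-1.
  have K2 : 0 < 2 * K by rewrite mulr_gt0.
  have E0 : 0 < iter N (evol stepmx d i) (h i) (u i).
    by have [] := tame_iter_avg (fun e => incr stepmx d e i) N (hB i) (u i).
  have li : 0 <= l ^+ 2 * cc i by rewrite mulr_ge0 ?sqr_ge0// ltW// cc_gt0.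
  have s1 : 0 < Num.sqrt (1 + l ^+ 2 * cc i) by rewrite sqrt1D_gt0.
  have ssl : Num.sqrt (1 + l ^+ 2 * cc i) <= sl.
    by rewrite ler_wsqrtr// lerD2l ler_piMr ?sqr_ge0// cc_le1.
  have h1 : iter N (evol stepmx d i) (h i) (u i) <=
      expR (((cc i)^-1 - 1) * ln (2 * K)) * (t + ((Num.sqrt (1 + l ^+ 2 * cc i))^-1 + t)).
    (* Interpolation between the supremum and the integral: g^(1/c) <= (2 K)^(1/c - 1) g, and the
       flow of [g] itself is known up to a small error. *)
    apply: le_trans (_ : iter N (evol stepmx d i) (fun v => expR (((cc i)^-1 - 1) * ln (2 * K)) * g t i v) (u i) <= _).
      apply: iter_evol_le => v; rewrite /h -[in leRHS](@lnK _ (g t i v)) ?posrE//.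
      rewrite -expRD ler_expR.
      have lgK : ln (g t i v) <= ln (2 * K) by rewrite ler_ln ?posrE.
      have ci1 : 0 <= (cc i)^-1 - 1 by rewrite subr_ge0 invf_ge1 ?cc_gt0 ?cc_le1.
      by have := ler_wpM2l ci1 lgK; lra.
    rewrite iter_evolZ ler_wpM2l ?expR_ge0// /g.
    rewrite (iter_evol_affine stepmx d i N t (p i) (xs i) (fun v => expR (- (v ^+ 2 / 2)))) lerD2l.
    apply: le_trans (_ : \sum_z p i z * ((Num.sqrt (1 + l ^+ 2 * cc i))^-1 + t) <= _); last first.
      by rewrite -mulr_suml ler_piMl// ?p_le1// addr_ge0 ?invr_ge0 ?sqrtr_ge0// ltW.
    apply: ler_sum => z _; rewrite ler_wpM2l//.
    rewrite (@eq_iter_evol _ _ stepmx d i N _ (heat 0)); last by move=> v; rewrite heat0.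
    apply: le_trans (iter_evol_heat_le N _ (ltW dp) dsq (lexx 0) (stepmx_le1 i)) _.
    apply: lerD; last by move: Nn; rewrite -!mulrA.
    rewrite stepmx_row add0r mulrA Nd; exact: heat_le.
  have s2 : t + ((Num.sqrt (1 + l ^+ 2 * cc i))^-1 + t) <=
     (Num.sqrt (1 + l ^+ 2 * cc i))^-1 * expR (n.+1%:R^-1).
    apply: le_trans (_ : (Num.sqrt (1 + l ^+ 2 * cc i))^-1 * (1 + n.+1%:R^-1) <= _); last first.
      by rewrite ler_wpM2l ?invr_ge0 ?sqrtr_ge0// expR_ge1Dx.
    rewrite mulrDr mulr1.
    have : t + t <= (Num.sqrt (1 + l ^+ 2 * cc i))^-1 / n.+1%:R.
      have k1 : 2 * t <= sl^-1 / n.+1%:R.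
        have E (a b : R) : 0 < a -> 0 < b -> b^-1 / a = 2 * (2 * a * b)^-1.
          by move=> a0 b0; field; rewrite !gt_eqF.
        by rewrite E ?ltr0n// ler_pM2l.
      have : sl^-1 / n.+1%:R <= (Num.sqrt (1 + l ^+ 2 * cc i))^-1 / n.+1%:R.
        by rewrite ler_pM2r ?invr_gt0 ?ltr0n// lef_pV2 ?posrE.
      by rewrite -mulr2n -[t *+ 2]mulr_natl; exact: le_trans.
    by rewrite addrCA lerD2l.
  have e0 := expR_gt0 (((cc i)^-1 - 1) * ln (2 * K)).
  have h2 := le_trans h1 (ler_wpM2l (ltW e0) s2).
  move: h2; rewrite -ler_ln ?posrE//; last by rewrite !mulr_gt0 ?expR_gt0 ?invr_gt0.
  rewrite !lnM ?posrE ?mulr_gt0 ?expR_gt0 ?invr_gt0// !expRK lnV ?posrE//.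
  have -> : ln (Num.sqrt (1 + l ^+ 2 * cc i)) = ln (1 + l ^+ 2 * cc i) / 2.
    have E : 1 + l ^+ 2 * cc i = Num.sqrt (1 + l ^+ 2 * cc i) ^+ 2 by rewrite sqr_sqrtr//; lra.
    by rewrite [in RHS]E lnXn// mulr2n; field.
  by rewrite addrA.
have ub : \sum_i cc i * ln (iter N (evol stepmx d i) (h i) (u i)) <= 1 +
    \sum_i ((1 - cc i) * ln (2 * K) - cc i * (ln (1 + l ^+ 2 * cc i) / 2)).
  apply: le_trans (_ : \sum_i (n.+1%:R^-1 + ((1 - cc i) * ln (2 * K) - cc i * (ln (1 + l ^+ 2 * cc i) / 2))) <= _).
    apply: ler_sum => i _; apply: le_trans (ler_wpM2l (ltW (cc_gt0 i)) (upper i)) _.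
    have ci := cc_gt0 i.
    have : cc i * n.+1%:R^-1 <= n.+1%:R^-1 by rewrite ler_piMl ?invr_ge0// cc_le1.
    have : cc i * (((cc i)^-1 - 1) * ln (2 * K)) = (1 - cc i) * ln (2 * K).
      by rewrite mulrA mulrBr mulr1 divff// gt_eqF.
    by move=> E k; rewrite mulrDr mulrBr E [leRHS]addrC lerD2l.
  rewrite big_split/= lerD2r sumr_const card_ord -[_ *+ n]mulr_natl.
  by rewrite ler_pdivrMr ?ltr0n// mul1r ler_nat.
move=> main.
have := le_trans lower main.
have : expR (N%:R * (D * d ^+ 3)) * expR (\sum_i cc i * ln (iter N (evol stepmx d i) (h i) (u i))) <= expR 2 * Q.
  rewrite /Q -!expRD ler_expR; lra.
lra.
Qed.

End Core.

(* The factor [expR 4] covers, per dimension, [expR W], a power of 2 and the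
   constants [cc i] of the Brascamp-Lieb inequality. *)
Definition smallball_const (R : realType) : R := (1 + expR 2) * expR 4.

Lemma smallball_const_ge1 (R : realType) : 1 <= smallball_const R.
Proof.
have := expR_gt0 (2 : R) => e2.
have e4 : 1 <= expR (4 : R) by rewrite -[leLHS]expR0 ler_expR.
by rewrite /smallball_const -[leLHS]mulr1 ler_pM//; lra.
Qed.

(** * Small ball estimate for projections *)

Section Projection.
Variables (R : realType) (n : nat) (O : 'M[R]_n).
Hypothesis OOt : O *m O^T = 1%:M.
Variables (I : finType) (p xs : 'I_n -> I -> R) (u : 'I_n -> R) (K : R).
Hypothesis p_ge0 : forall i z, 0 <= p i z.
Hypothesis p_le1 : forall i, \sum_z p i z <= 1.
Hypothesis K_gt0 : 0 < K.
Hypothesis K_ub : forall i v, \sum_z p i z * expR (- ((v - xs i z) ^+ 2 / 2)) <= K.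

Lemma heat_expR (t s : R) : 0 <= t -> heat t s = expR (- (s ^+ 2 / (1 + t) / 2) - ln (1 + t) / 2).
Proof.
move=> t0; have t1 : 0 < 1 + t by lra.
have s1 : 0 < Num.sqrt (1 + t) by rewrite sqrtr_gt0.
rewrite expRD /heat [expR (- (ln _ / 2))]expRN; congr (_ * _^-1).
apply: ln_inj; rewrite ?posrE ?expR_gt0// expRK.
have {2}-> : 1 + t = Num.sqrt (1 + t) ^+ 2 by rewrite sqr_sqrtr// ltW.
by rewrite lnXn// -[_ *+ 2]mulr_natl; field.
Qed.

(** Summed over the exponents, it bounds the cost of the factors c_i^(- c_i / 2) in terms of n minus
    the sum of the c_i, rather than n. *)
Lemma xlnx_ge (c : R) : 0 < c -> c - 1 <= c * ln c.
Proof.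
move=> c0; have := expR_ge1Dx (- ln c); rewrite expRN lnK ?posrE// => h.
have := ler_wpM2l (ltW c0) h; rewrite divff ?gt_eqF//; lra.
Qed.

Lemma ln2_le1 : ln (2 : R) <= 1.
Proof.
rewrite -ler_expR lnK ?posrE//; have := expR_ge1Dx (1 : R); lra.
Qed.

Lemma small_ball_proj (th : {set 'I_n}) :
  \sum_z wt p z * expR (- (\sum_(j in th) coor O (fun i => u i - xs i (z i)) j ^+ 2 / 4)) <=
  (smallball_const R * K) ^+ #|th|.
Proof.
(* The factor [1 + expR 2] of [core_flow] is later absorbed into a power with exponent [#|th|],
   which must then be positive. *)
have [->|/finset.set0Pn th0] := eqVneq th finset.set0.
  rewrite cards0 expr0; apply: le_trans (sum_wt p_ge0 p_le1).
  apply: ler_sum => z _; rewrite ler_piMr ?wt_ge0//.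
  by rewrite big_set0 oppr0 expR0.
have k1 : (1 : R) <= #|th|%:R by rewrite ler1n card_gt0; apply/finset.set0Pn.
set k : R := #|th|%:R in k1.
pose y (z : {ffun 'I_n -> I}) i := u i - xs i (z i).
(* Only finitely many [y z] occur, so one [l] serves all of them. That |y z|^2 <= l^2 makes the
   exponent of the heat kernel off [th] at most 1/2; that |ln (2 K)| <= l controls the excess k /
   l^2 of the sum of the exponents [cc] over n - k. *)
pose l : R := 1 + `|ln (2 * K)| + \sum_z \sum_i y z i ^+ 2.
have s0 : 0 <= \sum_z \sum_i y z i ^+ 2.
  by apply: sumr_ge0 => z _; apply: sumr_ge0 => i _; apply: sqr_ge0.
have ln0 := normr_ge0 (ln (2 * K)).
have l1 : 1 <= l by rewrite /l; lra.
have l0 : 0 < l by lra.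
have ll : l <= l ^+ 2 by rewrite expr2 ler_peMr// ltW.
(* As [l] grows the walk tends to one on the orthogonal complement of the
   coordinates in [th]; [om] has to stay positive to have [0 < cc i]. *)
pose om j : R := if j \in th then l^-1 else 1.
have om01 j : 0 <= om j <= 1.
  by rewrite /om; case: ifP => _; rewrite ?ler01 ?lexx// invr_ge0 ltW//= invf_le1.
have om0 j : 0 < om j by rewrite /om; case: ifP => _ //; rewrite invr_gt0.
have omE j : l ^+ 2 * om j ^+ 2 = if j \in th then 1 else l ^+ 2.
  by rewrite /om; case: ifP => _; rewrite -exprMn ?divff ?expr1n ?mulr1// gt_eqF.
pose L := ln (1 + l ^+ 2).
have L0 : 0 <= L by apply: ln_ge0; have := sqr_ge0 l; lra.
have := core_flow OOt om01 u p_ge0 p_le1 K_gt0 K_ub om0 l0.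
set Q := expR _ => core.
(* [W] undoes the normalization of the heat kernel, and its 1/2 pays for the directions off [th].
   Along [th] the variance is 1, which turns the exponent into the quarter of a square in the
   statement. *)
pose W := 2^-1 + \sum_j ln (1 + l ^+ 2 * om j ^+ 2) / 2.
have pt z : expR (- (\sum_(j in th) coor O (y z) j ^+ 2 / 4)) <=
    expR W * heatn O om (l ^+ 2) (y z).
  have E : heatn O om (l ^+ 2) (y z) = expR (\sum_j
     (- (coor O (y z) j ^+ 2 / (1 + l ^+ 2 * om j ^+ 2) / 2) - ln (1 + l ^+ 2 * om j ^+ 2) / 2)).
    rewrite expR_sum; apply: eq_bigr => j _.
    by rewrite heat_expR// mulr_ge0// sqr_ge0.
  rewrite E -expRD ler_expR sumrB sumrN /W.
  suff : \sum_j coor O (y z) j ^+ 2 / (1 + l ^+ 2 * om j ^+ 2) / 2 <=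
     \sum_(j in th) coor O (y z) j ^+ 2 / 4 + 2^-1 by lra.
  have yl : \sum_j coor O (y z) j ^+ 2 <= l ^+ 2.
    rewrite coor_norm//; apply: le_trans ll.
    rewrite /l (bigD1 z)//=; set A := \sum_i _; set B := \sum_(i | i != z) _.
    have B0 : 0 <= B by apply: sumr_ge0 => ? _; apply: sumr_ge0 => ? _; apply: sqr_ge0.
    by have : 0 <= `|ln (2 * K)| by []; lra.
  apply: le_trans (_ : \sum_j ((if j \in th then coor O (y z) j ^+ 2 / 4 else 0) + coor O (y z) j ^+ 2 / l ^+ 2 / 2) <= _).
    apply: ler_sum => j _; rewrite omE; have s20 := sqr_ge0 (coor O (y z) j).
    have l20 : 0 < l ^+ 2 by rewrite exprn_gt0.
    have h0 : 0 <= coor O (y z) j ^+ 2 / l ^+ 2 by rewrite divr_ge0// ltW.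
    case: ifP => _; first by have -> : (1 + 1 : R) = 2 by []; lra.
    rewrite add0r ler_pM2r// ler_wpM2l// lef_pV2 ?posrE//; lra.
  rewrite big_split/= -big_mkcond/= lerD2l -!mulr_suml ler_pdivrMr// mulVf//.
  by rewrite ler_pdivrMr ?mul1r ?exprn_gt0.
apply: le_trans (_ : \sum_z wt p z * (expR W * heatn O om (l ^+ 2) (y z)) <= _).
  by apply: ler_sum => z _; rewrite ler_wpM2l ?wt_ge0//; apply: pt.
under eq_bigr do rewrite mulrCA.
rewrite -mulr_sumr; apply: le_trans (ler_wpM2l (expR_ge0 W) core) _.
rewrite mulrCA -expRD /smallball_const.
have nE : (n%:R : R) = k + #|[predC th]|%:R by rewrite /k -natrD cardC card_ord.
have nk : \sum_j ln (1 + l ^+ 2 * om j ^+ 2) / 2 = k * (ln 2 / 2) + (n%:R - k) * (L / 2).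
  under eq_bigr do rewrite omE.
  rewrite (bigID (mem th))/= (eq_bigr (fun=> ln 2 / 2)); last by move=> j ->.
  rewrite [X in _ + X](eq_bigr (fun=> L / 2)); last by move=> j /negbTE ->.
  rewrite !sumr_const -[_ *+ #|th|]mulr_natl -[X in _ + X]mulr_natl; congr (_ + _ * _).
  by rewrite nE addrAC subrr add0r; congr (_ %:R); apply: eq_card => j; rewrite !inE.
have sc : \sum_i cc O om i = k * l ^- 2 + (n%:R - k).
  rewrite sum_cc// (bigID (mem th))/= (eq_bigr (fun=> l ^- 2)); last first.
    by move=> j jt; rewrite /om jt exprVn.
  rewrite [X in _ + X](eq_bigr (fun=> 1)); last by move=> j /negbTE jt; rewrite /om jt expr1n.
  rewrite !sumr_const -[_ *+ #|th|]mulr_natl; congr (_ + _).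
  by rewrite nE addrAC subrr add0r; congr (_ %:R); apply: eq_card => j; rewrite !inE.
have l20 : 0 < l ^+ 2 by rewrite exprn_gt0.
have ub : \sum_i ((1 - cc O om i) * ln (2 * K) - cc O om i * (ln (1 + l ^+ 2 * cc O om i) / 2)) <=
   (n%:R - \sum_i cc O om i) * (ln (2 * K) + 2^-1) - (\sum_i cc O om i) * (L / 2).
  have -> : (n%:R : R) = \sum_(i < n) 1 by rewrite sumr_const card_ord.
  rewrite -sumrB !mulr_suml -sumrB.
  apply: ler_sum => i _.
  have c0 := cc_gt0 OOt om0 i; have c1 := cc_le1 OOt om01 i.
  set c := cc O om i in c0 c1 *.
  have h1 : ln c + L <= ln (1 + l ^+ 2 * c).
    rewrite /L -lnM ?posrE//; last by lra.
    rewrite ler_ln ?posrE; [|rewrite mulr_gt0//; lra|]; last by have := mulr_gt0 l20 c0; lra.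
    by rewrite mulrDr mulr1 [c * _]mulrC; lra.
  have h2 := xlnx_ge c0.
  have h3 := ler_wpM2l (ltW c0) h1; rewrite mulrDr in h3.
  move: (ln (2 * K)) (ln c) (ln (1 + l ^+ 2 * c)) h2 h3 => *; lra.
have lK : - (l ^- 2 * ln (2 * K)) <= 1.
  rewrite -mulrN ler_pdivrMl// mulr1.
  apply: le_trans ll; rewrite /l; have := ler_norm (- ln (2 * K)); rewrite normrN; lra.
(* The terms (n - k) L / 2 of [W] and of the Brascamp-Lieb bound cancel, and what remains of [L] has
   a favourable sign, so no power of [l] survives. *)
have ex : W + \sum_i ((1 - cc O om i) * ln (2 * K) - cc O om i * (ln (1 + l ^+ 2 * cc O om i) / 2)) <=
   k * (4 + ln K).
  apply: le_trans (lerD (lexx W) ub) _; rewrite /W nk sc.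
  have l2i : 0 <= l ^- 2 by rewrite invr_ge0 ltW.
  have : 0 <= k * l ^- 2 * (L / 2) by rewrite !mulr_ge0//; lra.
  have : k * (- (l ^- 2 * ln (2 * K))) <= k * 1 by rewrite ler_wpM2l//; lra.
  have : 0 <= k * l ^- 2 by rewrite mulr_ge0//; lra.
  have -> : ln (2 * K) = ln 2 + ln K by rewrite lnM ?posrE.
  have := ler_wpM2l (le_trans ler01 k1) ln2_le1.
  move: (l ^- 2) (ln 2) (ln K) (n%:R) => a b c d; lra.
have e2 : 1 + expR 2 <= (1 + expR 2) ^+ #|th| :> R.
  by rewrite -[leLHS]expr1 ler_weXn2l ?lerDl ?expR_ge0// -(ler_nat R).
rewrite exprMn exprMn -mulrA; apply: ler_pM => //; rewrite ?addr_ge0 ?expR_ge0//.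
rewrite -exprMn -{2}[K](@lnK R) ?posrE// -expRD -expRM_natl ler_expR.
by rewrite -/k.
Qed.

End Projection.

(** * Convexity over the hypersimplex *)

Section Hypersimplex.
Variables (R : realType) (n : nat) (Z : finType) (w : Z -> R) (a : 'I_n -> Z -> R) (B : R).
Hypothesis w_ge0 : forall z, 0 <= w z.
Hypothesis a_ge0 : forall j z, 0 <= a j z.
Hypothesis B01 : 0 <= B <= 1.
Implicit Types mu : 'I_n -> R.

Lemma expR_convex2 (s t x y : R) : 0 <= s -> 0 <= t -> 0 < s + t ->
  (s + t) * expR ((s * x + t * y) / (s + t)) <= s * expR x + t * expR y.
Proof.
move=> s0 t0 st; set m := _ / _.
have mE : (s + t) * m = s * x + t * y by rewrite /m mulrC divfK// gt_eqF.
have tang v : expR m * (1 + (v - m)) <= expR v.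
  by rewrite -[in leRHS](subrK m v) expRD [leRHS]mulrC ler_wpM2l ?expR_ge0// expR_ge1Dx.
have := ler_wpM2l s0 (tang x); have := ler_wpM2l t0 (tang y).
have -> : (s + t) * expR m = s * (expR m * (1 + (x - m))) + t * (expR m * (1 + (y - m))).
  have -> : s * (expR m * (1 + (x - m))) + t * (expR m * (1 + (y - m))) =
    expR m * ((s + t) + (s * x + t * y - (s + t) * m)) by ring.
  by rewrite mE subrr addr0 mulrC.
lra.
Qed.

Let Phi mu := \sum_z w z * expR (- (\sum_j mu j * a j z)).
Let frac mu := [set j | (0 < mu j) && (mu j < 1)]%SET.

Lemma Phi_le mu nu : (forall j, nu j <= mu j) -> Phi mu <= Phi nu.
Proof.
move=> h; apply: ler_sum => z _; rewrite ler_wpM2l// ler_expR lerN2.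
by apply: ler_sum => j _; rewrite ler_wpM2r.
Qed.

Lemma Phi_conv mu nu1 nu2 (s t : R) : 0 <= s -> 0 <= t -> 0 < s + t ->
  (forall j, (s + t) * mu j = s * nu1 j + t * nu2 j) ->
  (s + t) * Phi mu <= s * Phi nu1 + t * Phi nu2.
Proof.
move=> s0 t0 st h; rewrite /Phi !mulr_sumr -big_split/=; apply: ler_sum => z _.
rewrite ![_ * (w z * _)]mulrCA -mulrDr ler_wpM2l//.
apply: le_trans (expR_convex2 _ _ s0 t0 st).
rewrite ler_wpM2l ?(ltW st)// ler_expR le_eqVlt; apply/orP; left; apply/eqP.
apply: (mulfI (lt0r_neq0 st)); rewrite [in RHS]mulrC divfK ?gt_eqF//.
rewrite !mulrN -opprD; congr (- _); rewrite !mulr_sumr -big_split/=.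
by apply: eq_bigr => j _; rewrite mulrA h; ring.
Qed.

(* Moving weight between two fractional coordinates until one of them is 0 or 1
   reduces to 0/1 vectors, by convexity along the segment. *)
Lemma hypersimplex_le :
  (forall th : {set 'I_n}, \sum_z w z * expR (- (\sum_(j in th) a j z)) <= B ^+ #|th|) ->
  forall mu (k : nat), (forall j, 0 <= mu j <= 1) -> k%:R <= \sum_j mu j ->
  \sum_z w z * expR (- (\sum_j mu j * a j z)) <= B ^+ k.
Proof.
move=> vert mu k mu01 kmu; rewrite -/(Phi mu); case/andP: B01 => B0 B1.
have [m] := ubnP #|frac mu|; elim: m => // m IH in mu mu01 kmu *.
rewrite ltnS => fm.
have int_case nu : (forall j, 0 <= nu j <= 1) -> frac nu = finset.set0 -> k%:R <= \sum_j nu j ->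
    Phi nu <= B ^+ k.
  move=> nu01 f0 knu; pose th := [set j | nu j == 1]%SET.
  have nuE j : nu j = if j \in th then 1 else 0.
    rewrite inE; case: eqP => // /eqP nj1.
    have := finset.in_set0 j; rewrite -f0 inE lt_neqAle [nu j < 1]lt_neqAle nj1.
    by case/andP: (nu01 j) => -> ->; rewrite !andbT => /negbFE/eqP.
  have -> : Phi nu = \sum_z w z * expR (- (\sum_(j in th) a j z)).
    apply: eq_bigr => z _; congr (_ * expR (- _)).
    rewrite [RHS]big_mkcond/=; apply: eq_bigr => j _.
    by rewrite nuE; case: ifP; rewrite ?mul1r ?mul0r.
  apply: le_trans (vert th) _; apply: ler_wiXn2l => //.
  move: knu; under eq_bigr do rewrite nuE.
  by rewrite -big_mkcond/= sumr_const ler_nat.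
have [f0|/finset.set0Pn[i fi]] := eqVneq (frac mu) finset.set0; first exact: int_case.
have /andP[i0 i1] : (0 < mu i) && (mu i < 1) by move: fi; rewrite inE.
pose upd (f : 'I_n -> R) i v j := if j == i then v else f j.
have [f1|/finset.set0Pn[j]] := eqVneq (frac mu :\ i)%SET finset.set0.
  (* A single fractional coordinate has no partner to trade with, so it is set to 0. This lowers the
     sum by less than 1 and makes it an integer, so it is still at least [k]. *)
  apply: le_trans (Phi_le (nu := upd mu i 0) _) _.
    by move=> j; rewrite /upd; case: eqP => [->|_] //; exact: ltW.
  have n01 j : 0 <= upd mu i 0 j <= 1 by rewrite /upd; case: eqP => //; rewrite lexx ler01.
  have fn : frac (upd mu i 0) = finset.set0.
    apply/setP => j; have := finset.in_set0 j; rewrite -f1 !inE /upd.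
    by case: eqP => [->|_]; rewrite ?ltxx.
  apply: int_case => //.
  pose th := [set j | upd mu i 0 j == 1]%SET.
  have nuE j : upd mu i 0 j = if j \in th then 1 else 0.
    rewrite inE; case: eqP => // /eqP nj1.
    have := finset.in_set0 j; rewrite -fn inE lt_neqAle [_ j < 1]lt_neqAle nj1.
    by case/andP: (n01 j) => -> ->; rewrite !andbT => /negbFE/eqP.
  have sE : \sum_j upd mu i 0 j = #|th|%:R.
    under eq_bigr do rewrite nuE.
    by rewrite -big_mkcond/= sumr_const.
  rewrite sE ler_nat -ltnS -(ltr_nat R); apply: (le_lt_trans kmu).
  rewrite -natr1 -sE (bigD1 i)//= [in ltRHS](bigD1 i)//= {1}/upd eqxx add0r addrC.
  rewrite (eq_bigr (upd mu i 0)) ?ltrD2l// => j ji.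
  by rewrite /upd (negbTE ji).
rewrite !inE => /andP[ji /andP[j0 j1]].
(* The largest transfers from [j] to [i] and from [i] to [j] that stay in the cube. Each endpoint
   has fewer fractional coordinates, and [mu] is the mean of the endpoints with weights proportional
   to [t] and [s]. *)
pose s := Num.min (1 - mu i) (mu j); pose t := Num.min (mu i) (1 - mu j).
have s0 : 0 < s by rewrite lt_min subr_gt0 i1.
have t0 : 0 < t by rewrite lt_min subr_gt0 i0.
have si : s <= 1 - mu i by rewrite ge_min lexx.
have sj : s <= mu j by rewrite ge_min lexx orbT.
have ti : t <= mu i by rewrite ge_min lexx.
have tj : t <= 1 - mu j by rewrite ge_min lexx orbT.
pose nu r := upd (upd mu i (mu i + r)) j (mu j - r).
have nui r : nu r i = mu i + r by rewrite /nu /upd eq_sym (negbTE ji) eqxx.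
have nuj r : nu r j = mu j - r by rewrite /nu /upd eqxx.
have nuo r l : l != i -> l != j -> nu r l = mu l by move=> /negbTE li /negbTE lj; rewrite /nu /upd lj li.
have nu01 r : - t <= r <= s -> forall l, 0 <= nu r l <= 1.
  move=> /andP[r1 r2] l; have [->|li] := eqVneq l i; first by rewrite nui; apply/andP; split; lra.
  have [->|lj] := eqVneq l j; first by rewrite nuj; apply/andP; split; lra.
  by rewrite nuo.
have snu r : \sum_l nu r l = \sum_l mu l.
  rewrite (bigD1 i)//= (bigD1 j)//= [in RHS](bigD1 i)//= [in RHS](bigD1 j)//=.
  rewrite nui nuj !addrA; congr (_ + _); first by ring.
  by apply: eq_bigr => l /andP[li lj]; rewrite nuo.
have step r : - t <= r <= s -> (nu r i == 0) || (nu r i == 1) || (nu r j == 0) || (nu r j == 1) ->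
    Phi (nu r) <= B ^+ k.
  move=> rts h; apply: IH; [exact: nu01|by rewrite snu|].
  apply: (leq_trans _ fm); apply: proper_card; apply/properP; split.
    apply/fintype.subsetP => l; rewrite !inE.
    have [->|li] := eqVneq l i; first by rewrite i0 i1.
    have [->|lj] := eqVneq l j; first by rewrite j0 j1.
    by rewrite nuo.
  case/orP: h => [/orP[/orP[]|]|] /eqP h; [exists i|exists i|exists j|exists j];
    by rewrite !inE ?i0 ?j0// h ?ltxx ?andbF.
have hs : Phi (nu s) <= B ^+ k.
  apply: step; first by rewrite lexx andbT; lra.
  rewrite nui nuj /s; have [h|h] := leP (1 - mu i) (mu j).
    by rewrite [_ + (1 - _)]addrC subrK eqxx orbT.
  by rewrite subrr eqxx !orbT.
have ht : Phi (nu (- t)) <= B ^+ k.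
  apply: step; first by rewrite lexx; lra.
  rewrite nui nuj /t; have [h|h] := leP (mu i) (1 - mu j).
    by rewrite subrr eqxx.
  by rewrite opprK [_ + (1 - _)]addrC subrK eqxx !orbT.
have st : 0 < t + s by lra.
have := @Phi_conv mu (nu s) (nu (- t)) t s (ltW t0) (ltW s0) st.
have cE l : (t + s) * mu l = t * nu s l + s * nu (- t) l.
  have [->|li] := eqVneq l i; first by rewrite !nui; ring.
  have [->|lj] := eqVneq l j; first by rewrite !nuj; ring.
  by rewrite !nuo//; ring.
move=> /(_ cE) h.
rewrite -(ler_pM2l st); apply: (le_trans h); rewrite mulrDl.
by apply: lerD; rewrite ler_pM2l.
Qed.

End Hypersimplex.

(** * Singular values *)

Section Spectral.
Variable R : realType.

(** Over the complex numbers the matrix is Hermitian, hence has a real spectral diagonal; a real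
    eigenvalue of the complexified matrix is already one of [M]. *)
Lemma sym_eigenvalue n (M : 'M[R]_n.+1) : M^T = M -> exists a, eigenvalue M a.
Proof.
move=> Msym; pose f := real_complex R; pose A := map_mx f M.
have Aherm : A \is hermsymmx.
  apply: realsym_hermsym.
    by apply/is_hermitianmxP; rewrite expr0 scale1r map_mx_id// /A map_trmx Msym.
  by apply/mxOverP => i j; rewrite mxE; apply/complex_realP; exists (M i j).
have /hermitian_normalmx /orthomx_spectralP A_eq := Aherm.
have /mxOverP/(_ 0 0)/complex_realP[r rE] := hermitian_spectral_diag_real Aherm.
exists r; rewrite -(eigenvalue_map f) -/A; apply/eigenvalueP.
exists (row 0 (spectralmx A)).
  rewrite -row_mul {2}A_eq !mulmxA mulmxV ?spectral_unit// mul1mx.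
  by rewrite row_mul row_diag_mx rE -scalemxAl -rowE.
have : row_free (spectralmx A) by rewrite row_free_unit spectral_unit.
by apply: contraTneq => r0; apply/negP => /row_freeP[B /(congr1 (row 0))];
  rewrite row_mul r0 mul0mx => /rowP/(_ 0); rewrite !mxE => /eqP; rewrite eq_sym oner_eq0.
Qed.

Lemma sqr_sum_gt0 n (v : 'rV[R]_n) : v != 0 -> 0 < (v *m v^T) 0 0.
Proof.
move=> v0; rewrite lt0r; apply/andP; split; last first.
  by rewrite mxE sumr_ge0// => i _; rewrite mxE -expr2 sqr_ge0.
apply: contraNneq v0; rewrite mxE => /psumr_eq0P h; apply/eqP/rowP => i.
have nn j : true -> 0 <= v 0 j * v^T j 0 by rewrite mxE -expr2 sqr_ge0.
by have /eqP := h nn i isT; rewrite !mxE -expr2 sqrf_eq0 => /eqP.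
Qed.

(** The reflection in the hyperplane orthogonal to [v - e] exchanges the unit vectors [v] and
    [e]. *)
Lemma householder n (v : 'rV[R]_n.+1) : v *m v^T = 1%:M ->
  exists2 H : 'M[R]_n.+1, H *m H^T = 1%:M & row 0 H = v.
Proof.
move=> vv; pose e : 'rV[R]_n.+1 := delta_mx 0 0; pose w := v - e.
have [w0|w0] := eqVneq w 0.
  exists 1%:M; first by rewrite trmx1 mulmx1.
  by rewrite row1; move/eqP: w0; rewrite subr_eq0 => /eqP ->.
pose s := (w *m w^T) 0 0; have s0 : 0 < s by apply: sqr_sum_gt0.
have ww : w *m w^T = s%:M by rewrite [LHS]mx11_scalar.
pose H := 1%:M - (2 / s) *: (w^T *m w).
have HT : H^T = H by rewrite /H linearB/= linearZ/= trmx_mul trmxK trmx1.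
exists H.
  rewrite HT /H mulmxBr mulmx1 mulmxBl mul1mx -scalemxAr -scalemxAl scalerA.
  have -> : w^T *m w *m (w^T *m w) = s *: (w^T *m w).
    by rewrite -mulmxA [w *m _]mulmxA ww mul_scalar_mx -scalemxAr.
  rewrite scalerA.
  have -> : 2 / s * (2 / s) * s = 2 / s + 2 / s by field; rewrite gt_eqF.
  rewrite scalerDl; set X := _ *: _.
  by rewrite opprB addrK subrK.
have rowE : row 0 H = e *m H by rewrite rowE.
rewrite rowE /H mulmxBr mulmx1 -scalemxAr mulmxA.
have ee : e *m e^T = 1%:M by rewrite trmx_delta mul_delta_mx; apply/matrixP => i j; rewrite !mxE !ord1.
have sE : e *m w^T = (- (s / 2))%:M.
  pose b := (e *m v^T) 0 0.
  have ev : e *m v^T = b%:M by rewrite [LHS]mx11_scalar.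
  have ve : v *m e^T = b%:M by rewrite -[LHS]trmxK trmx_mul trmxK ev tr_scalar_mx.
  have : s%:M = (2 - 2 * b)%:M :> 'M[R]_1.
    rewrite -ww /w linearB/= mulmxBl !mulmxBr vv ev ve ee -!raddfB/=.
    by congr (_ %:M); ring.
  move=> /matrixP/(_ 0 0); rewrite !mxE !eqxx !mulr1n => sb.
  rewrite /w linearB/= mulmxBr ev ee -raddfB/=; congr (_ %:M); rewrite sb; by field.
rewrite sE mul_scalar_mx scalerA.
have -> : 2 / s * - (s / 2) = -1 by field; rewrite gt_eqF.
by rewrite scaleN1r opprK /w addrC subrK.
Qed.

(** Deflation: a Householder matrix whose first row is a unit eigenvector conjugates [M] to a block
    diagonal matrix, and the induction hypothesis applies to the lower block. *)
Theorem sym_spectral n (M : 'M[R]_n) : M^T = M ->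
  exists (O : 'M[R]_n) (d : 'rV[R]_n), O *m O^T = 1%:M /\ M = O^T *m diag_mx d *m O.
Proof.
elim: n M => [|n IH] M Msym.
  by exists 1%:M, 0; split; apply/matrixP; case.
have [a /eigenvalueP[v vM v0]] := sym_eigenvalue Msym.
have s0 := sqr_sum_gt0 v0; set s := (_ *m _) 0 0 in s0.
pose v1 := (Num.sqrt s)^-1 *: v.
have vv1 : v1 *m v1^T = 1%:M.
  rewrite /v1 linearZ/= -scalemxAl -scalemxAr scalerA [v *m _]mx11_scalar -/s scale_scalar_mx.
  congr (_ %:M); rewrite -invfM -expr2 sqr_sqrtr ?mulVf ?gt_eqF//; exact: ltW.
have v1M : v1 *m M = a *: v1 by rewrite /v1 -scalemxAl vM !scalerA mulrC.
have [H HH rH] := householder vv1.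
pose N := H *m M *m H^T.
have Nsym : N^T = N by rewrite /N !trmx_mul trmxK Msym mulmxA.
have row0N : row 0 N = a *: delta_mx 0 0.
  rewrite /N -mulmxA row_mul rH mulmxA v1M -scalemxAl; congr (_ *: _).
  by rewrite -rH -row_mul HH row1.
have Ncol i : N i 0 = a * (i == 0)%:R.
  by rewrite -{1}Nsym mxE; have /rowP/(_ i) := row0N; rewrite !mxE.
have Nrow j : N 0 j = a * (j == 0)%:R.
  by have /rowP/(_ j) := row0N; rewrite !mxE.
have ME : M = H^T *m N *m H.
  by rewrite /N !mulmxA (mulmx1C HH) mul1mx -mulmxA (mulmx1C HH) mulmx1.
clearbody N.
pose D : 'M[R]_n := drsubmx (N : 'M[R]_(1 + n)).
have l0 : lshift n (0 : 'I_1) = 0 :> 'I_(1 + n) by apply: ord_inj.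
have NE : N = block_mx (a%:M : 'M[R]_1) 0 0 D :> 'M[R]_(1 + n).
  rewrite -[LHS](@submxK _ 1 n 1 n); congr block_mx; apply/matrixP => i j; rewrite !mxE ?ord1.
  - by rewrite l0 Ncol eqxx mulr1.
  - by rewrite l0 Nrow mulr0.
  - by rewrite l0 Ncol mulr0.
have Dsym : D^T = D by rewrite /D -[in RHS]Nsym; apply/matrixP => i j; rewrite !mxE.
have [Q [d [QQ DE]]] := IH _ Dsym.
pose B : 'M[R]_(1 + n) := block_mx (1%:M : 'M[R]_1) 0 0 Q.
have BB : B *m B^T = 1%:M.
  rewrite /B tr_block_mx !trmx0 trmx1 mulmx_block !mulmx0 !mul0mx !addr0 !add0r mulmx1 QQ.
  by rewrite -scalar_mx_block.
exists (B *m H), (row_mx (a%:M : 'M[R]_1) d : 'rV[R]_(1 + n)); split.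
  by rewrite trmx_mul mulmxA -(mulmxA B) HH mulmx1.
have key : N = B^T *m diag_mx (row_mx (a%:M : 'M[R]_1) d) *m B :> 'M[R]_(1 + n).
  rewrite diag_mx_row /B tr_block_mx !trmx0 trmx1 !mulmx_block.
  rewrite !mulmx0 !mul0mx !addr0 !add0r !mul1mx !mulmx1 !mul0mx NE DE.
  by congr block_mx; apply/matrixP => i j; rewrite !mxE !ord1.
rewrite ME trmx_mul -!mulmxA; congr (_ *m _); rewrite !mulmxA; congr (_ *m _).
exact: key.
Qed.

Lemma char_poly_spectral n (O : 'M[R]_n) (d : 'rV[R]_n) : O *m O^T = 1%:M ->
  char_poly (O^T *m diag_mx d *m O) = \prod_i ('X - (d 0 i)%:P).
Proof.
move=> OO; have OO' := mulmx1C OO.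
have E : char_poly_mx (O^T *m diag_mx d *m O) =
    map_mx polyC O^T *m char_poly_mx (diag_mx d) *m map_mx polyC O.
  rewrite /char_poly_mx mulmxBr mulmxBl !map_mxM; congr (_ - _).
  by rewrite mul_mx_scalar -scalemxAl -map_mxM OO' map_mx1 scalemx1.
rewrite /char_poly E !det_mulmx mulrAC -det_mulmx -map_mxM OO' map_mx1 det1 mul1r.
rewrite -/(char_poly _) char_poly_trig ?diag_mx_is_trig//.
by apply: eq_bigr => i _; rewrite mxE eqxx mulr1n.
Qed.

Lemma count_mup (s : seq R) x : mup x (\prod_(a <- s) ('X - a%:P)) = count_mem x s.
Proof.
elim: s => [|a s IH]; first by rewrite big_nil /= mupNroot// root1.
rewrite big_cons mupM ?polyXsubC_eq0 ?monic_neq0 ?monic_prod_XsubC//= IH.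
by have := mup_XsubCX 1 x a; rewrite expr1 => ->; rewrite eq_sym; case: eqP.
Qed.

Lemma perm_singular_values m n (A : 'M[R]_(m, n)) (O : 'M[R]_n) (d : 'rV[R]_n) :
  O *m O^T = 1%:M -> A^T *m A = O^T *m diag_mx d *m O ->
  perm_eq (singular_values A) [seq Num.sqrt (d 0 i) | i : 'I_n].
Proof.
move=> OO AE; rewrite /singular_values perm_sort AE.
set p := char_poly _; pose s := [seq d 0 i | i : 'I_n].
have pE : p = \prod_(a <- s) ('X - a%:P).
  by rewrite /p char_poly_spectral// big_map big_enum.
have p0 : p != 0 by rewrite pE monic_neq0// monic_prod_XsubC.
have pr : perm_eq (rootsR p) (undup s).
  apply: uniq_perm; rewrite ?undup_uniq//; first exact: uniq_roots.
  move=> x; rewrite mem_undup -(root_prod_XsubC s) -pE.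
  have := roots_on_rootsR p0 => /(_ x) <-.
  by rewrite in_itv.
have -> : [seq Num.sqrt (d 0 i) | i : 'I_n] = map Num.sqrt s by rewrite /s -map_comp.
apply: (@perm_trans _ (flatten [seq nseq (count_mem x s) (Num.sqrt x) | x <- undup s])).
  apply/permP => q; rewrite !count_flatten -!map_comp !sumnE !big_map.
  rewrite (perm_big _ pr)/=; apply: eq_bigr => x _.
  by rewrite !count_nseq pE count_mup.
have -> : flatten [seq nseq (count_mem x s) (Num.sqrt x) | x <- undup s] =
   map Num.sqrt (flatten [seq nseq (count_mem x s) x | x <- undup s]).
  by rewrite map_flatten -map_comp; congr flatten; apply: eq_map => x /=; rewrite map_nseq.
exact: perm_map (perm_count_undup s).
Qed.

End Spectral.

(** * Norms, stable rank and sums of truncated eigenvalues *)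

Section Norms.
Variables (R : realType) (m n : nat) (A : 'M[R]_(m, n)) (O : 'M[R]_n) (d : 'rV[R]_n).
Hypothesis OOt : O *m O^T = 1%:M.
Hypothesis AE : A^T *m A = O^T *m diag_mx d *m O.

Lemma l2norm_sqr k (x : 'cV[R]_k) : l2norm x ^+ 2 = \sum_i x i 0 ^+ 2.
Proof. by rewrite sqr_sqrtr// sumr_ge0// => i _; rewrite sqr_ge0. Qed.

Lemma l2norm_ge0 k (x : 'cV[R]_k) : 0 <= l2norm x.
Proof. exact: sqrtr_ge0. Qed.

Lemma l2norm_sqr_mx k (x : 'cV[R]_k) : l2norm x ^+ 2 = (x^T *m x) 0 0.
Proof.
by rewrite l2norm_sqr mxE; apply: eq_bigr => i _; rewrite mxE expr2.
Qed.

Lemma l2norm_orth (x : 'cV[R]_n) : l2norm (O *m x) ^+ 2 = l2norm x ^+ 2.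
Proof.
by rewrite !l2norm_sqr_mx trmx_mul mulmxA -[_ *m O]mulmxA (mulmx1C OOt) mulmx1.
Qed.

Lemma l2norm_mul_sqr (x : 'cV[R]_n) :
  l2norm (A *m x) ^+ 2 = \sum_j d 0 j * (O *m x) j 0 ^+ 2.
Proof.
rewrite l2norm_sqr_mx trmx_mul mulmxA -[_ *m A]mulmxA AE !mulmxA -[x^T *m O^T]trmx_mul -mulmxA mxE.
apply: eq_bigr => j _; rewrite mul_mx_diag !mxE; ring.
Qed.

Lemma l2norm_mul_eigen j : l2norm (A *m (row j O)^T) ^+ 2 = d 0 j.
Proof.
have OE : O *m (row j O)^T = delta_mx j 0.
  by rewrite tr_row colE mulmxA OOt mul1mx.
rewrite l2norm_mul_sqr OE (bigD1 j)//= big1 ?addr0.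
  by rewrite mxE !eqxx expr1n mulr1.
by move=> i ij; rewrite mxE (negbTE ij) expr0n mulr0.
Qed.

Lemma eigen_ge0 j : 0 <= d 0 j.
Proof. by rewrite -l2norm_mul_eigen sqr_ge0. Qed.

Lemma hsnorm_sqr : hsnorm A ^+ 2 = \sum_j d 0 j.
Proof.
rewrite sqr_sqrtr; last by apply: sumr_ge0 => i _; apply: sumr_ge0 => j _; apply: sqr_ge0.
have -> : \sum_j d 0 j = \tr (A^T *m A).
  by rewrite AE -mulmxA mxtrace_mulC -mulmxA OOt mulmx1 mxtrace_diag.
rewrite exchange_big; apply: eq_bigr => j _.
by rewrite mxE; apply: eq_bigr => i _; rewrite mxE expr2.
Qed.

Lemma l2norm_mul_le (x : 'cV[R]_n) : l2norm x <= 1 -> l2norm (A *m x) <= hsnorm A.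
Proof.
move=> x1; rewrite -(@ler_pXn2r _ 2) ?nnegrE ?sqrtr_ge0// hsnorm_sqr l2norm_mul_sqr.
apply: ler_sum => j _; rewrite ler_piMr ?eigen_ge0//.
apply: le_trans (_ : l2norm (O *m x) ^+ 2 <= _).
  rewrite l2norm_sqr (bigD1 j)//= lerDl sumr_ge0// => i _; exact: sqr_ge0.
by rewrite l2norm_orth exprn_ile1// l2norm_ge0.
Qed.

Lemma opnorm_has_sup :
  has_sup [set l2norm (A *m x) | x in [set x : 'cV[R]_n | l2norm x <= 1]].
Proof.
split; last by exists (hsnorm A) => _ [x x1 <-]; apply: l2norm_mul_le.
exists (l2norm (A *m 0)), 0 => //=; rewrite /l2norm big1 ?sqrtr0// => i _.
by rewrite mxE expr0n.
Qed.

Lemma opnorm_ge x : l2norm x <= 1 -> l2norm (A *m x) <= opnorm A.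
Proof. by move=> x1; apply: ub_le_sup; [case: opnorm_has_sup|exists x]. Qed.

Lemma opnorm_ge0 : 0 <= opnorm A.
Proof.
apply: le_trans (opnorm_ge (x := 0) _); first exact: l2norm_ge0.
by rewrite /l2norm big1 ?sqrtr0// => i _; rewrite mxE expr0n.
Qed.

Lemma opnorm_le_hsnorm : opnorm A <= hsnorm A.
Proof.
apply: ge_sup; first by case: opnorm_has_sup.
by move=> _ [x x1 <-]; apply: l2norm_mul_le.
Qed.

Lemma eigen_le_opnorm j : d 0 j <= opnorm A ^+ 2.
Proof.
rewrite -l2norm_mul_eigen ler_pXn2r ?nnegrE ?l2norm_ge0 ?opnorm_ge0//.
apply: opnorm_ge; rewrite -(@ler_pXn2r _ 2) ?nnegrE ?l2norm_ge0//.
have /matrixP/(_ j j) := OOt; rewrite !mxE eqxx => h.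
rewrite l2norm_sqr expr1n le_eqVlt; apply/orP; left; apply/eqP; apply: etrans h.
by apply: eq_bigr => i _; rewrite !mxE expr2.
Qed.

Hypothesis A0 : A != 0.

Lemma hsnorm_gt0 : 0 < hsnorm A.
Proof.
rewrite lt_neqAle sqrtr_ge0 andbT eq_sym; apply: contra A0 => /eqP h0.
have : \sum_i \sum_j A i j ^+ 2 = 0.
  rewrite -[LHS]sqr_sqrtr -/(hsnorm A) ?h0 ?expr0n//.
  by apply: sumr_ge0 => i _; apply: sumr_ge0 => j _; apply: sqr_ge0.
move=> /psumr_eq0P h; apply/eqP/matrixP => i j.
have hi : \sum_j A i j ^+ 2 = 0.
  by apply: h => // k _; apply: sumr_ge0 => l _; apply: sqr_ge0.
have /eqP : A i j ^+ 2 = 0.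
  by apply: (psumr_eq0P _ hi) => // l _; apply: sqr_ge0.
by rewrite sqrf_eq0 mxE => /eqP.
Qed.

Lemma opnorm_gt0 : 0 < opnorm A.
Proof.
rewrite lt_neqAle opnorm_ge0 andbT eq_sym; apply: contraTN (hsnorm_gt0) => /eqP o0.
rewrite -leNgt -(@ler_pXn2r _ 2) ?nnegrE ?sqrtr_ge0// hsnorm_sqr expr0n/=.
by apply: sumr_le0 => j _; have := eigen_le_opnorm j; rewrite o0 expr0n.
Qed.

Let sv := singular_values A.

Lemma size_sv : size sv = n.
Proof. by rewrite (perm_size (perm_singular_values OOt AE)) size_image card_ord. Qed.

Lemma sv_ge0 j : 0 <= singval A j.
Proof.
rewrite /singval -/sv; have [jn|nj] := ltnP j (size sv); last by rewrite nth_default.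
have := mem_nth 0 jn; rewrite (perm_mem (perm_singular_values OOt AE)) => /mapP[i _ ->].
exact: sqrtr_ge0.
Qed.

Lemma sv_mono i j : (i <= j)%N -> singval A j <= singval A i.
Proof.
move=> ij; have [jn|nj] := ltnP j (size sv); last first.
  by rewrite {1}/singval nth_default// sv_ge0.
have ss : sorted >=%R sv by apply: sort_sorted => x y; apply: le_total.
have tr : transitive (>=%R : rel R) by move=> y x z xy yz; exact: le_trans yz xy.
have rf : reflexive (>=%R : rel R) by move=> x; exact: lexx.
by apply: (sorted_leq_nth tr rf 0 ss) => //; rewrite inE//; apply: leq_ltn_trans jn.
Qed.

Lemma sum_sv (F : R -> R) : \sum_(0 <= j < n) F (singval A j ^+ 2) = \sum_j F (d 0 j).
Proof.
have -> : \sum_(0 <= j < n) F (singval A j ^+ 2) = \sum_(x <- sv) F (x ^+ 2).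
  by rewrite [RHS](big_nth 0) size_sv.
rewrite (perm_big _ (perm_singular_values OOt AE))/= big_image/=.
by apply: eq_bigr => j _; rewrite sqr_sqrtr// eigen_ge0.
Qed.

(** The columns of [A *m O^T] with nonzero eigenvalue are orthogonal and nonzero, hence independent
    in dimension [m]. *)
Lemma card_eigen_neq0 : (#|[set j | d 0%R j != 0%R]%SET| <= m)%N.
Proof.
set J := [set j | _]%SET; pose f (k : 'I_#|J|) := enum_val k.
pose W := colsub f (A *m O^T).
have WW : W^T *m W = diag_mx (\row_k d 0 (f k)).
  have h : (A *m O^T)^T *m (A *m O^T) = diag_mx d.
    by rewrite trmx_mul trmxK !mulmxA -[ O *m _ *m _]mulmxA AE !mulmxA OOt mul1mx -mulmxA OOt mulmx1.
  apply/matrixP => k l; have /matrixP/(_ (f k) (f l)) := h.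
  rewrite !mxE (inj_eq enum_val_inj) => <-.
  by apply: eq_bigr => i _; rewrite !mxE.
apply: (@mulmx1_min _ _ _ (diag_mx (\row_k (d 0 (f k))^-1) *m W^T) W).
rewrite -mulmxA WW mulmx_diag; apply/matrixP => k l; rewrite !mxE.
case: eqP => // _; rewrite mulVf//.
by have := enum_valP k; rewrite inE.
Qed.

(** The case of interest is m <= j < n: if this entry were nonzero, so would be the j + 1 > m
    entries up to it. It allows the sums up to [minn m n] to be extended to [n]. *)
Lemma sv_eq0 j : (minn m n <= j)%N -> singval A j = 0.
Proof.
rewrite geq_min => /orP[mj|nj]; last by rewrite /singval nth_default// size_sv.
have [jn|nj] := ltnP j n; last by rewrite /singval nth_default// size_sv.
apply/eqP; apply: contraTT card_eigen_neq0 => s0; rewrite -ltnNge.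
apply: leq_ltn_trans mj _.
have s1 : 0 < singval A j by rewrite lt_neqAle eq_sym s0 sv_ge0.
rewrite -(ltr_nat R).
have -> : #|[set j | d 0 j != 0]%SET|%:R = \sum_j (if d 0 j != 0 then 1 else 0) :> R.
  by rewrite -big_mkcond/= sumr_const; congr (_ %:R); apply: eq_card => k; rewrite inE.
rewrite -(sum_sv (fun x => if x != 0 then 1 else 0)).
rewrite (big_cat_nat (n := j.+1))//=.
rewrite (eq_big_nat _ _ (F2 := fun=> 1)); last first.
  move=> i /andP[_ ij]; rewrite sqrf_eq0 gt_eqF//.
  by apply: lt_le_trans s1 _; apply: sv_mono.
rewrite sumr_const_nat subn0 ltr_wpDr ?ltr_nat//.
by apply: sumr_ge0 => i _; case: ifP.
Qed.

Lemma sum_sv_min r : \sum_(r <= j < minn m n) singval A j ^+ 2 = \sum_(r <= j < n) singval A j ^+ 2.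
Proof.
rewrite [RHS](bigID (fun j => j < minn m n)%N)/= [X in _ + X]big1 ?addr0.
  by rewrite (big_nat_widen _ _ _ _ _ (geq_minr m n)).
by move=> j; rewrite -leqNgt => /sv_eq0 ->; rewrite expr0n.
Qed.

Lemma sum_sv_all : \sum_(0 <= j < n) singval A j ^+ 2 = hsnorm A ^+ 2.
Proof. by rewrite hsnorm_sqr -(sum_sv id). Qed.

Lemma sv_le_opnorm j : singval A j ^+ 2 <= opnorm A ^+ 2.
Proof.
rewrite /singval -/sv; have [jn|nj] := ltnP j (size sv); last first.
  by rewrite nth_default// expr0n sqr_ge0.
have := mem_nth 0 jn; rewrite (perm_mem (perm_singular_values OOt AE)) => /mapP[i _ ->].
by rewrite sqr_sqrtr ?eigen_ge0// eigen_le_opnorm.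
Qed.

Let S := hsnorm A ^+ 2.
Let L := opnorm A ^+ 2.
Let r := stable_rank A.
Let T := \sum_(r <= j < n) singval A j ^+ 2.

Lemma deltaE : delta A = T / S.
Proof. by rewrite /delta !sum_sv_min sum_sv_all. Qed.

Lemma S_gt0 : 0 < S. Proof. by rewrite exprn_gt0 ?hsnorm_gt0. Qed.
Lemma L_gt0 : 0 < L. Proof. by rewrite exprn_gt0 ?opnorm_gt0. Qed.

Lemma stable_rank_bounds : r%:R <= S / L < r.+1%:R.
Proof. by apply: truncn_itv; rewrite divr_ge0 ?sqr_ge0. Qed.

Lemma stable_rank_ge1 : (1 <= r)%N.
Proof.
rewrite -ltnS -(ltr_nat R); case/andP: stable_rank_bounds => _; apply: le_lt_trans.
rewrite ler_pdivlMr ?L_gt0// mul1r ler_pXn2r ?nnegrE ?sqrtr_ge0 ?opnorm_ge0//.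
exact: opnorm_le_hsnorm.
Qed.

Lemma stable_rank_le : (r <= n)%N.
Proof.
rewrite -(ler_nat R); case/andP: stable_rank_bounds => h _; apply: le_trans h _.
rewrite ler_pdivrMr ?L_gt0// /S -sum_sv_all.
apply: le_trans (_ : \sum_(0 <= j < n) L <= _).
  by apply: ler_sum => j _; apply: sv_le_opnorm.
by rewrite sumr_const_nat subn0 mulr_natl.
Qed.

Lemma T_ge0 : 0 <= T.
Proof. by apply: sumr_ge0 => j _; apply: sqr_ge0. Qed.

Lemma T_le_S : T <= S.
Proof.
rewrite /S -sum_sv_all (big_cat_nat (n := r))//= ?stable_rank_le// lerDr.
by apply: sumr_ge0 => j _; apply: sqr_ge0.
Qed.

Lemma delta01 : 0 <= delta A <= 1.
Proof.
rewrite deltaE divr_ge0 ?T_ge0 ?(ltW S_gt0)//= ler_pdivrMr ?S_gt0// mul1r.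
exact: T_le_S.
Qed.

(** If s_r(A)^2, which is [singval A r.-1 ^+ 2], is at least L delta, the first r terms all equal 1.
    Otherwise the cut-off is inactive from index [r] on, and those terms sum to T / (L delta) = S /
    L >= r. *)
Lemma stable_rank_sum_min : 0 < delta A ->
  r%:R <= \sum_j Num.min (d 0 j / (L * delta A)) 1.
Proof.
move=> del0; rewrite -(sum_sv (fun x => Num.min (x / (L * delta A)) 1)).
have LD : 0 < L * delta A by rewrite mulr_gt0 ?L_gt0.
have F0 j : 0 <= Num.min (singval A j ^+ 2 / (L * delta A)) 1.
  by rewrite le_min ler01 andbT divr_ge0 ?sqr_ge0// ltW.
have [h|h] := leP (L * delta A) (singval A r.-1 ^+ 2).
  rewrite (big_cat_nat (n := r))//= ?stable_rank_le//.
  rewrite (eq_big_nat _ _ (F2 := fun=> 1)); last first.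
    move=> j /andP[_ jr]; apply/min_idPr; rewrite ler_pdivlMr// mul1r.
    apply: (le_trans h); rewrite ler_pXn2r ?nnegrE ?sv_ge0//.
    by apply: sv_mono; rewrite -ltnS prednK// stable_rank_ge1.
  by rewrite sumr_const_nat subn0 lerDl; apply: sumr_ge0.
rewrite (big_cat_nat (n := r))//= ?stable_rank_le//.
apply: ler_wpDl; first exact: sumr_ge0.
rewrite (eq_big_nat _ _ (F2 := fun j => singval A j ^+ 2 / (L * delta A))); last first.
  move=> j /andP[rj _]; apply/min_idPl; rewrite ler_pdivrMr// mul1r.
  apply: (le_trans _ (ltW h)); rewrite ler_pXn2r ?nnegrE ?sv_ge0//.
  by apply: sv_mono; apply: leq_trans rj; apply: leq_pred.
rewrite -mulr_suml -/T; case/andP: stable_rank_bounds => k _; apply: (le_trans k).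
have T0 : 0 < T by have := del0; rewrite deltaE pmulr_lgt0 ?invr_gt0 ?S_gt0.
rewrite le_eqVlt deltaE; apply/orP; left; apply/eqP; field.
by rewrite !gt_eqF ?S_gt0 ?L_gt0.
Qed.

(** Let x_j = s_j^2 / L <= 1. Among the first r indices, each with x_j < 1/2 contributes more than 1
    to the sum of 2 (1 - x_j), which equals 2 (r - (1 - delta) S / L) <= 2 delta r. So at least (1 -
    2 delta) r of these terms reach the cut-off 1. The bound [r <= 5 * k] comes from 1 - 2 delta >
    1/5. *)
Lemma stable_rank0_sum_min : delta A < 2 / 5 -> exists k : nat,
  [/\ stable_rank0 A = k, (r <= 5 * k)%N &
   k%:R <= \sum_j Num.min (d 0 j / (L * 2^-1)) 1].
Proof.
move=> del; case/andP: delta01 => del0 _.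
have r0 : 0 <= (1 - 2 * delta A) * r%:R by rewrite mulr_ge0//; lra.
have c0 : (0 <= stable_rank0 A :> int) by rewrite ceil_ge0 (lt_le_trans _ r0).
pose k := `|stable_rank0 A|%N.
have kE : stable_rank0 A = k by rewrite gez0_abs.
exists k; split => //.
  rewrite -(ler_nat R) natrM.
  have : (1 - 2 * delta A) * r%:R <= k%:R.
    by have := ceil_ge ((1 - 2 * delta A) * r%:R); rewrite -/(stable_rank0 A) kE.
  have : 0 <= (r%:R : R) by [].
  nra.
have L0 := L_gt0; have S0 := S_gt0.
have h0 : 0 < L * 2^-1 by rewrite mulr_gt0.
pose b j : bool := L * 2^-1 <= singval A j ^+ 2.
have sb : (k <= \sum_(0 <= j < r) b j)%N.
  rewrite -lez_nat -kE /stable_rank0 ceil_le_int.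
  have -> : ((Posz (\sum_(0 <= j < r) b j))%:~R : R) = \sum_(0 <= j < r) (b j)%:R by rewrite -pmulrn natr_sum.
  have : \sum_(0 <= j < r) ((1 : R) - (b j)%:R) <= \sum_(0 <= j < r) 2 * (1 - singval A j ^+ 2 / L).
    apply: ler_sum => j _; rewrite /b.
    have : singval A j ^+ 2 / L <= 1 by rewrite ler_pdivrMr// mul1r sv_le_opnorm.
    set x := singval A j ^+ 2 / L => x1.
    have [h|h] := leP (L * 2^-1) (singval A j ^+ 2); rewrite ?mulr1n ?mulr0n; first by lra.
    have : x < 2^-1 by rewrite /x ltr_pdivrMr// [_ * L]mulrC.
    lra.
  rewrite -mulr_sumr !sumrB !sumr_const_nat subn0 -mulr_suml.
  have -> : \sum_(0 <= j < r) singval A j ^+ 2 = S - T.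
    by rewrite /S -sum_sv_all [X in X - _](big_cat_nat (n := r))//= ?stable_rank_le// addrK.
  have TE : T = delta A * S by rewrite deltaE divfK// gt_eqF.
  rewrite TE; case/andP: stable_rank_bounds => k1 _.
  have : (1 - delta A) * r%:R <= (1 - delta A) * (S / L) by rewrite ler_wpM2l//; lra.
  have -> : (S - delta A * S) / L = (1 - delta A) * (S / L) by ring.
  lra.
apply: le_trans (_ : (\sum_(0 <= j < r) b j)%:R <= _); first by rewrite ler_nat.
rewrite -(sum_sv (fun x => Num.min (x / (L * 2^-1)) 1)).
rewrite [leRHS](big_cat_nat (n := r))//= ?stable_rank_le//.
rewrite natr_sum; apply: ler_wpDr.
  by apply: sumr_ge0 => j _; rewrite le_min ler01 andbT divr_ge0 ?sqr_ge0// ltW.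
apply: ler_sum => j _; rewrite /b; have [h|h] := leP (L * 2^-1) (singval A j ^+ 2) => /=.
  by rewrite le_min lexx andbT ler_pdivlMr// mul1r.
by rewrite le_min ler01 andbT divr_ge0 ?sqr_ge0// ltW.
Qed.

End Norms.

(** * Finite additivity and concentration of one variable *)

Section FiniteAdditivity.
Context (d : measure_display) (T : measurableType d) (R : realType) (P : probability T R).
Implicit Types A B : set T.

Definition pr B : R := fine (P B).

Lemma prE B : measurable B -> P B = (pr B)%:E.
Proof. by move=> mB; rewrite /pr fineK// fin_num_measure. Qed.

Lemma pr_ge0 B : 0 <= pr B.
Proof. exact: fine_ge0. Qed.

Lemma pr_le1 B : measurable B -> pr B <= 1.
Proof. by move=> mB; rewrite -lee_fin -prE// probability_le1. Qed.

Lemma pr_le A B : measurable A -> measurable B -> A `<=` B -> pr A <= pr B.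
Proof. by move=> mA mB AB; rewrite -lee_fin -!prE// le_measure ?inE. Qed.

Lemma prDI A B : measurable A -> measurable B -> pr A = pr (A `\` B) + pr (A `&` B).
Proof.
move=> mA mB; have mD := measurableD mA mB; have mI := measurableI _ _ mA mB.
by apply: EFin_inj; rewrite EFinD -!prE//; apply: measureDI.
Qed.

Lemma pr_sum_le (I : eqType) (r : seq I) (F : I -> set T) B :
  uniq r -> (forall i, measurable (F i)) -> measurable B ->
  (forall i j, i != j -> F i `&` F j = set0) ->
  (forall i, i \in r -> F i `<=` B) -> \sum_(i <- r) pr (F i) <= pr B.
Proof.
move=> ur mF mB dF; elim: r ur B mB => [_ B mB _|i r IH /= /andP[ir ur] B mB FB].
  by rewrite big_nil pr_ge0.
rewrite big_cons (prDI mB (mF i)) addrC.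
have -> : B `&` F i = F i by apply/setIidPr; apply: FB; rewrite mem_head.
rewrite lerD2r; apply: IH => //; first exact: measurableD.
move=> j jr w Fj; split; first by apply: FB Fj; rewrite inE jr orbT.
move=> Fi; have ji : j != i by apply: contraNneq ir => <-.
by have := dF j i ji => /seteqP[/(_ w (conj Fj Fi))].
Qed.

Lemma pr_cover_le (I : eqType) (r : seq I) (F : I -> set T) B :
  (forall i, measurable (F i)) -> measurable B ->
  (forall w, B w -> exists2 i, i \in r & F i w) -> pr B <= \sum_(i <- r) pr (F i).
Proof.
move=> mF; elim: r B => [B mB FB|i r IH B mB FB].
  rewrite big_nil (_ : B = set0) ?/pr ?measure0//.
  by apply/seteqP; split => // w /FB[].
rewrite big_cons (prDI mB (mF i)) addrC; apply: lerD.
  by apply: pr_le => //; exact: measurableI.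
apply: IH; first exact: measurableD.
move=> w [/FB[j]]; rewrite inE => /orP[/eqP ->//|jr Fj _]; by exists j.
Qed.

Lemma pr_decr (F : nat -> set T) (a e : R) : (forall k, measurable (F k)) ->
  (forall k, F k.+1 `<=` F k) -> pr (\bigcap_k F k) <= a -> 0 < e ->
  exists k, pr (F k) <= a + e.
Proof.
move=> mF dF Fa e0.
have dF' : nonincreasing_seq F.
  by apply/nonincreasing_seqP => k; apply/subsetPset.
have mI : measurable (\bigcap_k F k) by apply: bigcapT_measurable.
have F0 : (P (F 0%N) < +oo)%E by rewrite prE// ltry.
have cv := nonincreasing_cvg_mu F0 mF mI dF'.
apply: contrapT => /forallNP H.
have : ((a + e)%:E <= P (\bigcap_k F k))%E.
  rewrite -(cvg_lim _ cv)//; apply: lime_ge; first by apply/cvg_ex; exists (P (\bigcap_k F k)).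
  by apply: nearW => k; rewrite /= prE// lee_fin ltW// ltNge; apply/negP/H.
rewrite prE// lee_fin; lra.
Qed.

Variable X : {RV P >-> R}.

Lemma mX (B : set R) : measurable B -> measurable (X @^-1` B).
Proof. by move=> mB; rewrite -[X in measurable X]setTI; exact: measurable_funP. Qed.

Lemma measurable_norm_ge (c : R) : measurable [set x : R | c <= `|x|].
Proof.
have -> : [set x : R | c <= `|x|] = ~` `]- c, c[.
  by apply/seteqP; split => x /=; rewrite in_itv/= -ltr_norml leNgt => /negP.
by apply: measurableC; apply: measurable_itv.
Qed.

Lemma pr_tail (e : R) : 0 < e -> exists b, forall c, b <= c -> pr (X @^-1` [set x | c <= `|x|]) <= e.
Proof.
move=> e0; pose F k := X @^-1` [set x | k%:R <= `|x|].
have mc := measurable_norm_ge.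
have mF k : measurable (F k) by apply: mX.
have [||k hk] := @pr_decr F 0 e mF _ _ e0.
- by move=> k w /=; apply: le_trans; rewrite ler_nat.
- rewrite (_ : \bigcap_k F k = set0) ?/pr ?measure0//.
  apply/seteqP; split => // w h.
  have : (Num.truncn `|X w|).+1%:R <= `|X w| := h _ I.
  by rewrite leNgt truncnS_gt.
exists k%:R => c kc; rewrite add0r in hk; apply: le_trans hk; apply: pr_le => //; first exact: mX.
by move=> w /=; apply: le_trans.
Qed.

Lemma pr_itv_le (t p a s : R) : 0 < t -> 0 <= s ->
  (forall u, pr (X @^-1` `[u - t, u + t]) <= p) ->
  pr (X @^-1` `[a, a + 2 * s]) <= (s / t + 1) * p.
Proof.
move=> t0 s0 H.
have p0 : 0 <= p by apply: le_trans (H 0); exact: pr_ge0.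
pose c (k : nat) := a + t + 2 * t * k%:R.
pose r := iota 0 (Num.truncn (s / t)).+1.
apply: le_trans (_ : \sum_(k <- r) pr (X @^-1` `[c k - t, c k + t]) <= _).
  apply: pr_cover_le => [k||w /=]; try by apply: mX.
  rewrite in_itv/= => /andP[aX Xa].
  have y0 : 0 <= (X w - a) / (2 * t) by apply: divr_ge0; [rewrite subr_ge0|apply: mulr_ge0 => //; exact: ltW].
  have /andP[k1 k2] := truncn_itv y0; set k := Num.truncn _ in k1 k2.
  have t2 : 0 < 2 * t by rewrite mulr_gt0.
  exists k.
    rewrite mem_iota add0n ltnS; apply: le_truncn.
    rewrite ler_pdivrMr// mulrCA divfK ?gt_eqF//; lra.
  rewrite /= in_itv/= /c; move: k1 k2; rewrite ler_pdivlMr// ltr_pdivrMr// -natr1 => k1 k2.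
  apply/andP; split; lra.
apply: le_trans (ler_sum _ (fun k _ => H (c k))) _.
rewrite big_const_seq count_predT size_iota iter_addr_0 -[p *+ _]mulr_natl ler_wpM2r//.
rewrite -natr1 lerD2r; by rewrite truncn_le divr_ge0// ltW.
Qed.

(** The point is uniformity in [u]. If it fails, there are bad centres [u k] at the scales 1 / (k +
    1). They stay bounded because the tails are small, so they cluster at some [v], and every
    interval around [v] contains a bad one; continuity from above at the point [v] forbids this. *)
Lemma concentration_zero (p e : R) : 0 <= p -> 0 < e ->
  (forall u, pr (X @^-1` `[u, u]) <= p) ->
  exists2 t, 0 < t & forall u, pr (X @^-1` `[u - t, u + t]) <= p + e.
Proof.
move=> p0 e0 H; apply: contrapT => nH.
have : forall k, exists u, p + e < pr (X @^-1` `[u - k.+1%:R^-1, u + k.+1%:R^-1]).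
  move=> k; apply: contrapT => /forallNP h; apply: nH.
  exists k.+1%:R^-1 => [|u]; first by rewrite invr_gt0.
  by rewrite leNgt; apply/negP/h.
move=> /choice[u uP].
have k1 k : k.+1%:R^-1 <= 1 :> R by rewrite invf_le1// ler1n.
have [b0 b0P] := pr_tail e0; pose b := Num.max b0 1.
have ub k : u k \in `[- (b + 1), b + 1].
  apply: contraT => uk; have := uP k; rewrite ltNge => /negP; case.
  apply: le_trans (_ : e <= _); last by rewrite lerDr.
  have bP : pr (X @^-1` [set x | b <= `|x|]) <= e by apply: b0P; rewrite le_max lexx.
  apply: le_trans bP; apply: pr_le; try by apply: mX.
    by apply: mX; apply: measurable_norm_ge.
  move=> w /=; rewrite !in_itv/= => /andP[h1 h2].
  have := k1 k; move: uk; rewrite in_itv/= negb_and -!ltNge => /orP[] h3 h4.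
    by move: (ler_norm (- X w)); rewrite normrN; move: (k.+1%:R^-1) h1 h2 h4 => q *; lra.
  by move: (ler_norm (X w)); move: (k.+1%:R^-1) h1 h2 h4 => q *; lra.
have cpt := @segment_compact R (- (b + 1)) (b + 1).
have [|v [_ cv]] := cpt (u @ \oo) (fmap_proper_filter u _).
  by exists 0%N => // k _; exact: ub.
have [k|k w||k hk] := @pr_decr (fun k => X @^-1` `[v - k.+1%:R^-1, v + k.+1%:R^-1]) p e _ _ _ e0.
- exact: mX.
- rewrite /= !in_itv/= => /andP[h1 h2].
  have : k.+2%:R^-1 <= k.+1%:R^-1 :> R by rewrite lef_pV2 ?posrE// ler_nat.
   move: (k.+2%:R^-1 : R) (k.+1%:R^-1 : R) h1 h2 => q1 q2 *; apply/andP; split; lra.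
- apply: le_trans (H v); apply: pr_le; try by apply: mX.
    by apply: bigcapT_measurable => k; apply: mX.
  move=> w /= h; rewrite in_itv/= -eq_le; apply/eqP.
  apply/eqP; rewrite -subr_eq0 -normr_eq0; apply: contraT => n0.
  have n1 : 0 < `|v - X w| by rewrite lt_neqAle eq_sym n0/=.
  have := h (Num.truncn (`|v - X w|^-1)) I; rewrite /= in_itv/=.
  set q := _.+1; have : `|v - X w|^-1 < q%:R by apply: truncnS_gt.
  rewrite -[ltRHS]invrK ltf_pV2 ?posrE ?invr_gt0// => qv /andP[h1 h2].
  have : `|v - X w| <= q%:R^-1 by rewrite ler_norml; apply/andP; split; lra.
  by rewrite leNgt qv.
have := hk; apply/negP; rewrite -ltNge.
(* Half of the radius 1 / (k + 1) is spent on the distance from [u j] to [v], the other half on the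
   interval around [u j]. *)
have d0 : 0 < (2 * k.+1%:R)^-1 :> R by rewrite invr_gt0 mulr_gt0.
have FA : (u @ \oo) [set x | exists2 j, (2 * k.+1 <= j.+1)%N & x = u j].
  exists (2 * k.+1)%N => // j /= kj; exists j => //; exact: (leq_trans kj).
have [_ [[j kj ->]]] := cv _ _ FA (nbhsx_ballx v _ d0).
rewrite /ball/= => vu.
apply: lt_le_trans (uP j) _; apply: pr_le; try by apply: mX.
move=> w /=; rewrite !in_itv/= => /andP[h1 h2].
have jk : j.+1%:R^-1 <= (2 * k.+1%:R)^-1 :> R by rewrite lef_pV2 ?posrE ?mulr_gt0// -natrM ler_nat.
have kE : k.+1%:R^-1 = (2 * k.+1%:R)^-1 + (2 * k.+1%:R)^-1 :> R.
  by rewrite invfM -mulrDl (_ : 2^-1 + 2^-1 = 1) ?mul1r//; lra.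
rewrite kE; move: vu; rewrite ltr_norml => /andP[].
by move: (j.+1%:R^-1 : R) ((2 * k.+1%:R)^-1 : R) h1 h2 jk => q1 q2 *; apply/andP; split; lra.
Qed.

End FiniteAdditivity.

(** * Discretization *)

Section Annuli.
Variable R : realType.

Lemma sum_half_le (N : nat) : \sum_(m < N) (2^-1 : R) ^+ m <= 2.
Proof.
suff -> : \sum_(m < N) (2^-1 : R) ^+ m = 2 - 2 * 2^-1 ^+ N.
  by rewrite gerDl oppr_le0 mulr_ge0// exprn_ge0.
elim: N => [|N IH]; first by rewrite big_ord0 expr0; lra.
by rewrite big_ord_recr/= IH exprS; lra.
Qed.

Lemma gauss_le_half (m : nat) (v : R) : m%:R <= `|v| ->
  expR (- (v ^+ 2 / 2)) <= 2 * 2^-1 ^+ m.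
Proof.
move=> mv.
have mv2 : m%:R ^+ 2 <= v ^+ 2 by rewrite -[leRHS]real_normK ?num_real// ler_pXn2r ?nnegrE.
have -> : 2 * 2^-1 ^+ m = expR (ln 2 - m%:R * ln 2) :> R.
  by rewrite expRD lnK ?posrE// -mulrN expRM_natl expRN lnK ?posrE.
rewrite ler_expR.
have l0 : 0 <= ln (2 : R) by apply: ln_ge0; lra.
have l1 := ln2_le1 R.
case: m mv mv2 => [|m] _ mv2; first by have := sqr_ge0 v; lra.
have : m%:R * ln 2 <= m%:R :> R by rewrite ler_piMr.
have := sqr_ge0 (m.+1%:R - 1 : R); rewrite -natr1 in mv2 *; lra.
Qed.

(** On the m-th annulus the Gaussian weight is at most 2 / 2^m, and the geometric series contributes
    another factor 2. *)
Lemma annuli_le (I : finType) (q x : I -> R) (y s c : R) : 0 < s ->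
  (forall z, 0 <= q z) ->
  (forall m : nat, \sum_(z | Num.truncn (`|y - x z| / s) == m) q z <= c) ->
  \sum_z q z * expR (- (((y - x z) / s) ^+ 2 / 2)) <= 4 * c.
Proof.
move=> s0 q0 qc; pose mz z := Num.truncn (`|y - x z| / s).
pose N := (\sum_z mz z).+1.
have c0 : 0 <= c by apply: le_trans (qc 0%N); apply: sumr_ge0.
have mN z : (mz z < N)%N by rewrite ltnS (bigD1 z)//= leq_addr.
rewrite (partition_big (fun z => Ordinal (mN z)) xpredT)//=.
apply: le_trans (_ : \sum_(m < N) 2 * c * 2^-1 ^+ m <= _); last first.
  by rewrite -mulr_sumr; have := sum_half_le N; nra.
apply: ler_sum => m _; apply: le_trans (_ : \sum_(z | Ordinal (mN z) == m) q z * (2 * 2^-1 ^+ m) <= _).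
  apply: ler_sum => z /eqP zm; rewrite ler_wpM2l//; apply: gauss_le_half.
  have : 0 <= `|y - x z| / s by rewrite divr_ge0// ltW.
  move=> /truncn_itv/andP[+ _]; rewrite -/(mz z) normrM [`|s^-1|]gtr0_norm ?invr_gt0//.
  by rewrite (_ : mz z = m)// -zm.
rewrite -mulr_suml -[leRHS]mulrA [2 * (c * _)]mulrCA.
rewrite ler_wpM2r ?mulr_ge0 ?exprn_ge0//.
apply: le_trans (qc m); rewrite le_eqVlt; apply/orP; left; apply/eqP.
by apply: eq_bigl => z; rewrite -val_eqE.
Qed.

End Annuli.

Section Grid.
Variables (R : realType) (N : nat) (h : R).
Hypothesis h0 : 0 < h.

Definition gridpt (z : 'I_(2 * N)) : R := (z%:R - N%:R) * h.

Definition cell z : set R := `[gridpt z, gridpt z + h[%classic.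

Lemma measurable_cell z : measurable (cell z).
Proof. exact: measurable_itv. Qed.

Lemma ltr_add_step (a b : R) : (a * h < b * h + h) = (a < b + 1).
Proof. by rewrite -[in X in _ + X](mul1r h) -mulrDl ltr_pM2r. Qed.

Lemma cell_uniq z z' x : cell z x -> cell z' x -> z = z'.
Proof.
rewrite /cell /= !in_itv/= /gridpt => /andP[a1 a2] /andP[b1 b2].
apply: val_inj; apply/eqP; rewrite eqn_leq; apply/andP; split.
  rewrite -ltnS -(ltr_nat R) -natr1; have : (z%:R - N%:R) * h < (z'%:R - N%:R) * h + h by apply: le_lt_trans b2.
  by rewrite ltr_add_step; lra.
rewrite -ltnS -(ltr_nat R) -natr1; have : (z'%:R - N%:R) * h < (z%:R - N%:R) * h + h by apply: le_lt_trans a2.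
by rewrite ltr_add_step; lra.
Qed.

Lemma cell_cover x : `|x| < N%:R * h -> exists z, cell z x.
Proof.
rewrite ltr_norml => /andP[x1 x2].
have y0 : 0 <= x / h + N%:R.
  have : - N%:R < x / h by rewrite ltr_pdivlMr// mulNr.
  lra.
have /andP[k1 k2] := truncn_itv y0; set k := Num.truncn _ in k1 k2.
have kN : (k < 2 * N)%N.
  rewrite -(ltr_nat R); apply: (le_lt_trans k1); rewrite mul2n -addnn natrD ltrD2r.
  by rewrite ltr_pdivrMr.
exists (Ordinal kN); rewrite /cell/= in_itv/= /gridpt/=.
have xE : x = x / h * h by rewrite divfK// gt_eqF.
rewrite -natr1 in k2; apply/andP; split.
  by rewrite [leRHS]xE ler_pM2r//; lra.
by rewrite [ltLHS]xE ltr_add_step; lra.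
Qed.

Context (d : measure_display) (T : measurableType d) (P : probability T R).
Variable X : {RV P >-> R}.

Definition cellpr z : R := pr P (X @^-1` cell z).

Lemma cellpr_ge0 z : 0 <= cellpr z. Proof. exact: pr_ge0. Qed.

Lemma sum_cellpr_le (Q : pred 'I_(2 * N)) (B : set R) : measurable B ->
  (forall z, Q z -> cell z `<=` B) -> \sum_(z | Q z) cellpr z <= pr P (X @^-1` B).
Proof.
move=> mB QB; rewrite -big_filter.
apply: (@pr_sum_le _ _ _ P _ _ (fun z => X @^-1` cell z)).
- by rewrite filter_uniq// index_enum_uniq.
- by move=> z; apply: mX; apply: measurable_cell.
- exact: mX.
- move=> z z' zz; apply/seteqP; split => // w [cz cz'].
  by move: zz; rewrite (cell_uniq cz cz') eqxx.
- by move=> z; rewrite mem_filter => /andP[Qz _] w; apply: QB.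
Qed.

Lemma sum_cellpr_le1 : \sum_z cellpr z <= 1.
Proof.
apply: le_trans (sum_cellpr_le (B := setT) _ _) _ => //.
by apply: pr_le1; apply: mX.
Qed.

Lemma grid_conc (t p s y : R) : 0 < t -> t <= s -> h <= s ->
  (forall u, pr P (X @^-1` `[u - t, u + t]) <= p) ->
  \sum_z cellpr z * expR (- (((y - gridpt z) / s) ^+ 2 / 2)) <= 16 * (s / t) * p.
Proof.
move=> t0 ts hs H; have s0 : 0 < s by lra.
have p0 : 0 <= p by apply: le_trans (H 0); exact: pr_ge0.
have -> : 16 * (s / t) * p = 4 * (4 * (s / t) * p) by ring.
apply: annuli_le => // [|m]; first exact: cellpr_ge0.
have st : 1 <= s / t by rewrite ler_pdivlMr// mul1r.
have bnd a : pr P (X @^-1` `[a, a + 2 * s]) <= 2 * (s / t) * p.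
  apply: le_trans (pr_itv_le a t0 (ltW s0) H) _.
  by rewrite ler_wpM2r//; lra.
rewrite (bigID (fun z => y <= gridpt z))/=.
have -> : 4 * (s / t) * p = 2 * (s / t) * p + 2 * (s / t) * p by ring.
have tr z : Num.truncn (`|y - gridpt z| / s) == m -> m%:R * s <= `|y - gridpt z| < m.+1%:R * s.
  move=> /eqP <-; have : 0 <= `|y - gridpt z| / s by rewrite divr_ge0// ltW.
  by move=> /truncn_itv/andP[a b]; rewrite -ler_pdivlMr// a -ltr_pdivrMr.
apply: lerD.
  apply: le_trans (bnd (y + m%:R * s)); apply: sum_cellpr_le; first exact: measurable_itv.
  move=> z /andP[/tr/andP[a b] yz] x; rewrite /cell /= !in_itv/= => /andP[c e].
  move: a b; rewrite distrC ger0_norm ?subr_ge0// -natr1 mulrDl mul1r => a b.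
  by apply/andP; split; lra.
apply: le_trans (bnd (y - m.+1%:R * s)); apply: sum_cellpr_le; first exact: measurable_itv.
move=> z /andP[/tr/andP[a b] yz] x; rewrite /cell /= !in_itv/= => /andP[c e].
rewrite -ltNge in yz.
move: a b; rewrite gtr0_norm ?subr_gt0// -natr1 mulrDl mul1r => a b.
have : 0 <= m%:R * s by rewrite mulr_ge0// ltW.
by move=> ?; apply/andP; split; lra.
Qed.

End Grid.

(** * Small ball probabilities *)

Section Finite.
Variables (R : realType) (m n : nat) (A : 'M[R]_(m, n)) (O : 'M[R]_n) (dd : 'rV[R]_n).
Hypothesis OOt : O *m O^T = 1%:M.
Hypothesis AE : A^T *m A = O^T *m diag_mx dd *m O.
Hypothesis A0 : A != 0.
Let Lam := opnorm A ^+ 2.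
Let S := hsnorm A ^+ 2.

Lemma eigen_le_hsnorm j : dd 0 j <= S.
Proof.
rewrite /S (hsnorm_sqr OOt AE) (bigD1 j)//= lerDl sumr_ge0// => k _.
exact: (eigen_ge0 OOt AE).
Qed.

Lemma l2norm_mul_sqr_le (x : 'cV[R]_n) : l2norm (A *m x) ^+ 2 <= S * l2norm x ^+ 2.
Proof.
rewrite (l2norm_mul_sqr AE) -(l2norm_orth OOt x) l2norm_sqr mulr_sumr.
by apply: ler_sum => j _; rewrite ler_wpM2r ?sqr_ge0// eigen_le_hsnorm.
Qed.

Variables (I : finType) (p : 'I_n -> I -> R) (x : I -> R) (K s : R).
Hypothesis s_gt0 : 0 < s.
Hypothesis p_ge0 : forall i z, 0 <= p i z.
Hypothesis p_le1 : forall i, \sum_z p i z <= 1.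
Hypothesis K_gt0 : 0 < K.
Hypothesis K_ub : forall i y, \sum_z p i z * expR (- (((y - x z) / s) ^+ 2 / 2)) <= K.
Hypothesis K_le : smallball_const R * K <= 1.

(** Exponential Markov inequality: on [G] the truncated quadratic form is at most [c], because
    truncation only lowers the eigenvalues. *)
Lemma finite_small_ball (kappa c : R) (k : nat) (z0 : {ffun 'I_n -> I})
    (G : pred {ffun 'I_n -> I}) : 0 < kappa ->
  k%:R <= \sum_j Num.min (dd 0 j / (Lam * kappa)) 1 ->
  (forall z, G z -> l2norm (A *m (\col_i (x (z0 i) - x (z i)))) ^+ 2 <= 4 * (Lam * kappa * s ^+ 2) * c) ->
  \sum_(z | G z) wt p z <= expR c * (smallball_const R * K) ^+ k.
Proof.
move=> kap0 kmu Gc.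
have Lam0 : 0 < Lam by apply: exprn_gt0; apply: (opnorm_gt0 OOt AE A0).
have LK : 0 < Lam * kappa by apply: mulr_gt0.
pose mu j := Num.min (dd 0 j / (Lam * kappa)) 1.
pose a j (z : {ffun 'I_n -> I}) := coor O (fun i => x (z0 i) / s - x (z i) / s) j ^+ 2 / 4.
have d0 j : 0 <= dd 0 j by apply: (eigen_ge0 OOt AE).
have mu01 j : 0 <= mu j <= 1.
  by rewrite /mu le_min ler01 andbT ge_min lexx orbT andbT divr_ge0// ltW.
have B01 : 0 <= smallball_const R * K <= 1.
  rewrite K_le andbT mulr_ge0//; last exact: ltW.
  by apply: le_trans (smallball_const_ge1 R).
have K_ub' i v : \sum_z p i z * expR (- ((v - x z / s) ^+ 2 / 2)) <= K.
  have := K_ub i (v * s); congr (_ <= _); apply: eq_bigr => z _.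
  by congr (_ * expR (- (_ ^+ 2 / 2))); rewrite mulrBl mulfK// gt_eqF.
have vert (th : {set 'I_n}) : \sum_z wt p z * expR (- (\sum_(j in th) a j z)) <=
    (smallball_const R * K) ^+ #|th|.
  exact: (small_ball_proj OOt (xs := fun _ z => x z / s) (fun i => x (z0 i) / s)).
have a0 j z : 0 <= a j z by rewrite /a divr_ge0 ?sqr_ge0.
have := hypersimplex_le (wt_ge0 p_ge0) a0 B01 vert mu01 kmu.
set F := \sum_z _ => FB.
apply: le_trans (_ : expR c * F <= _); last by rewrite ler_wpM2l ?expR_ge0.
rewrite /F mulr_sumr [leRHS](bigID G)/=; apply: ler_wpDr.
  by apply: sumr_ge0 => z _; rewrite !mulr_ge0 ?expR_ge0 ?(wt_ge0 p_ge0).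
apply: ler_sum => z Gz; rewrite mulrCA -expRD ler_peMr ?(wt_ge0 p_ge0)//.
rewrite -[leLHS]expR0 ler_expR subr_ge0.
have s2 : 0 < s ^+ 2 by rewrite exprn_gt0.
have D0 : 0 < 4 * (Lam * kappa * s ^+ 2) by apply: mulr_gt0 => //; exact: mulr_gt0.
have := Gc z Gz; rewrite (l2norm_mul_sqr AE) mulrC -ler_pdivrMr//.
apply: le_trans; rewrite mulr_suml; apply: ler_sum => j _.
have -> : (O *m \col_i (x (z0 i) - x (z i))) j 0 = s * coor O (fun i => x (z0 i) / s - x (z i) / s) j.
  rewrite mxE /coor mulr_sumr; apply: eq_bigr => i _; rewrite mxE.
  by rewrite mulrCA; congr (_ * _); field; rewrite gt_eqF.
rewrite /a; set y := coor _ _ _.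
apply: le_trans (_ : dd 0 j / (Lam * kappa) * (y ^+ 2 / 4) <= _).
  by rewrite ler_wpM2r ?divr_ge0 ?sqr_ge0// /mu ge_min lexx.
rewrite le_eqVlt; apply/orP; left; apply/eqP; field.
by rewrite !gt_eqF.
Qed.

End Finite.

Lemma sqr4_le (R : realType) (a b c e : R) :
  (a + b - c - e) ^+ 2 <= 4 * (a ^+ 2 + b ^+ 2 + c ^+ 2 + e ^+ 2).
Proof.
have := sqr_ge0 (a - b); have := sqr_ge0 (a + c); have := sqr_ge0 (a + e).
have := sqr_ge0 (b + c); have := sqr_ge0 (b + e); have := sqr_ge0 (c - e); lra.
Qed.

(** The 16 comes from [grid_conc], and [expR 40] from the exponential Markov inequality with c = 40
    k in [core_prob]. *)
Definition main_const (R : realType) : R := 16 * expR 40 * smallball_const R.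

Lemma main_const_gt0 (R : realType) : 0 < main_const R.
Proof.
have := smallball_const_ge1 R; have := expR_gt0 (40 : R) => *.
by rewrite /main_const !mulr_gt0//; lra.
Qed.

Section Core.
Context (d : measure_display) (T : measurableType d) (R : realType) (P : probability T R).
Variables (n : nat) (X : 'I_n -> {RV P >-> R}).
Hypothesis indepX : mutually_independent X.

Lemma indep_pr (B : 'I_n -> set R) : (forall i, measurable (B i)) ->
  pr P (\bigcap_(i in [set` [set: 'I_n]%SET]) (X i @^-1` B i)) = \prod_i pr P (X i @^-1` B i).
Proof.
move=> mB; rewrite /pr (indepX _ mB).
have -> : (\prod_(i in [set: 'I_n]%SET) P (X i @^-1` B i))%E =
   (\prod_i pr P (X i @^-1` B i))%:E.
  rewrite (big_morph EFin (fun _ _ => EFinM _ _) erefl).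
  by apply: eq_big => [i|i _]; rewrite ?inE// prE//; apply: mX.
by [].
Qed.

Variables (m : nat) (A : 'M[R]_(m, n)) (O : 'M[R]_n) (dd : 'rV[R]_n).
Hypothesis OOt : O *m O^T = 1%:M.
Hypothesis AE : A^T *m A = O^T *m diag_mx dd *m O.
Hypothesis A0 : A != 0.

Let AX w := A *m (\col_(i < n) X i w).

Lemma measurable_event (u : 'cV[R]_m) (c : R) : 0 <= c ->
  measurable [set w | l2norm (AX w - u) <= c].
Proof.
move=> c0.
have -> : [set w | l2norm (AX w - u) <= c] =
   (fun w => \sum_k (\sum_j A k j * X j w - u k 0) ^+ 2) @^-1` `]-oo, c ^+ 2].
  have E w : (l2norm (AX w - u) <= c) = (\sum_k (\sum_j A k j * X j w - u k 0) ^+ 2 <= c ^+ 2).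
    rewrite -(@ler_pXn2r _ 2) ?nnegrE ?l2norm_ge0// l2norm_sqr.
    congr (_ <= _); apply: eq_bigr => k _; rewrite !mxE; congr ((_ - _) ^+ 2).
    by apply: eq_bigr => j _; rewrite mxE.
  by apply/seteqP; split => w /=; rewrite in_itv/= E.
rewrite -[X in measurable X]setTI.
have : measurable_fun setT (fun w => \sum_k (\sum_j A k j * X j w - u k 0) ^+ 2).
  apply: measurable_sum => k; apply: measurable_funX; apply: measurable_funB => //.
  by apply: measurable_sum => j; apply: measurable_funM.
by apply.
Qed.

Lemma core_prob (t p M kappa : R) (k : nat) (u : 'cV[R]_m) :
  0 < t -> 0 < p -> (forall i v, pr P (X i @^-1` `[v - t, v + t]) <= p) ->
  1 <= M -> 0 < kappa <= 1 ->
  k%:R <= \sum_j Num.min (dd 0 j / (opnorm A ^+ 2 * kappa)) 1 ->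
  (stable_rank A <= 5 * k)%N ->
  pr P [set w | l2norm (AX w - u) <= M * t * hsnorm A] <=
    (main_const R * M * p / Num.sqrt kappa) ^+ k.
Proof.
move=> t0 p0 H M1 /andP[kap0 kap1] kmu rk.
set rho := M * t * hsnorm A.
have hs0 := hsnorm_gt0 A0.
have op0 := opnorm_gt0 OOt AE A0.
have rho0 : 0 < rho by rewrite /rho !mulr_gt0//; lra.
have mE := measurable_event u (ltW rho0).
set E := [set w | _] in mE *.
have sk0 : 0 < Num.sqrt kappa by rewrite sqrtr_gt0.
have sk1 : Num.sqrt kappa <= 1 by rewrite -[leRHS]sqrtr1 ler_wsqrtr.
(* Chosen so that kappa s^2 = (M t)^2: a wider window compensates for dividing the eigenvalues by
   [kappa], and this puts sqrt kappa into the bound. *)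
pose s := M * t / Num.sqrt kappa.
have s0 : 0 < s by rewrite /s divr_gt0// mulr_gt0//; lra.
have ts : t <= s.
  rewrite /s ler_pdivlMr//; apply: (@le_trans _ _ t); first by rewrite ler_piMr// ltW.
  by rewrite ler_peMl// ltW.
pose K := 16 * (s / t) * p.
have K0 : 0 < K by apply: mulr_gt0 => //; apply: mulr_gt0 => //; exact: divr_gt0.
have KE : main_const R * M * p / Num.sqrt kappa = expR 40 * (smallball_const R * K).
  by rewrite /main_const /K /s; field; rewrite !gt_eqF.
have sc1 := smallball_const_ge1 R.
have e40 : 1 <= expR 40 :> R by rewrite -[leLHS]expR0 ler_expR.
(* [hypersimplex_le] needs a base of at most 1; for a larger one the claimed bound is at least 1,
   hence trivial. *)
rewrite KE; have [K1|K1] := leP (smallball_const R * K) 1; last first.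
  apply: le_trans (pr_le1 P mE) _; apply: exprn_ege1.
  by rewrite -[leLHS]mulr1 ler_pM// ltW.
apply/ler_addgt0Pr => e e0.
have n0 : 0 < n.+1%:R :> R by [].
(* Rounding all coordinates then moves AX by at most sqrt n h |A|_HS <= t |A|_HS <= rho. *)
pose h := t / n.+1%:R.
have h0 : 0 < h by rewrite divr_gt0.
have hs : h <= s.
  by apply: le_trans ts; rewrite /h ler_pdivrMr// ler_peMr ?(ltW t0)// ler1n.
have [b bP] := choice (fun i => pr_tail (X i) (divr_gt0 e0 n0)).
pose N := (Num.truncn ((\sum_i `|b i|) / h)).+1.
have Nb i : b i <= N%:R * h.
  apply: le_trans (ler_norm _) _; apply: le_trans (_ : \sum_i `|b i| <= _).
    by rewrite (bigD1 i)//= lerDl sumr_ge0.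
  by rewrite -ler_pdivrMr// ltW// truncnS_gt.
pose tail i := X i @^-1` [set y | N%:R * h <= `|y|].
have mtail i : measurable (tail i) by apply: mX; apply: measurable_norm_ge.
pose cl i z := X i @^-1` @cell R N h z.
have mcl i z : measurable (cl i z) by apply: mX; apply: measurable_cell.
pose Cz (z : {ffun 'I_n -> 'I_(2 * N)}) := \bigcap_(i in [set` [set: 'I_n]%SET]) cl i (z i).
have mCz z : measurable (Cz z).
  by apply: fin_bigcap_measurable => //; exact: finite_finset.
pose G z := `[< exists2 w, E w & Cz z w >].
pose F (j : {ffun 'I_n -> 'I_(2 * N)} + 'I_n) := match j with inl z => Cz z | inr i => tail i end.
pose r := map inl (enum G) ++ map inr (enum 'I_n) : seq ({ffun 'I_n -> 'I_(2 * N)} + 'I_n).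
have cov : pr P E <= \sum_(j <- r) pr P (F j).
  apply: pr_cover_le => //; first by case.
  move=> w Ew; have [[i ti]|nt] := pselect (exists i, tail i w).
    by exists (inr i) => //; rewrite mem_cat map_f ?orbT// mem_enum.
  have nt' i : exists z, cl i z w.
    apply: cell_cover => //; rewrite ltNge; apply/negP => ti; apply: nt; by exists i.
  have [zf zP] := choice nt'.
  exists (inl [ffun i => zf i]); last by move=> i _; rewrite ffunE.
  rewrite mem_cat map_f// mem_enum; apply/asboolP; exists w => // i _; rewrite ffunE; exact: zP.
apply: (le_trans cov); rewrite big_cat !big_map/=; apply: lerD; last first.
  rewrite -[Finite.enum _]enumT big_enum/=; apply: le_trans (_ : \sum_(i < n) e / n.+1%:R <= _).
    by apply: ler_sum => i _; apply: bP.
  rewrite sumr_const card_ord -[_ *+ n]mulr_natl mulrCA ler_piMr ?(ltW e0)//.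
  by rewrite ler_pdivrMr// mul1r ler_nat.
rewrite big_enum/=.
have prCz z : pr P (Cz z) = wt (fun i => cellpr h (X i)) z.
  by rewrite /Cz indep_pr// => i; apply: measurable_cell.
under eq_bigr do rewrite prCz.
rewrite exprMn.
(* The vector [u] need not be in the range of [A], so the Gaussian is centred at a cell [z0] that
   meets the event; this only doubles the distances. *)
have [/existsP[z0 Gz0]|/existsPn Gn] := boolP [exists z, G z]; last first.
  rewrite big_pred0; last by move=> z; apply/negbTE/Gn.
  by apply: mulr_ge0; apply: exprn_ge0; [exact: expR_ge0 | apply: mulr_ge0; lra].
have p_ge0 i (z : 'I_(2 * N)) : 0 <= cellpr h (X i) z by apply: cellpr_ge0.
have p_le1 i : \sum_(z : 'I_(2 * N)) cellpr h (X i) z <= 1 by apply: sum_cellpr_le1.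
have K_ub i y : \sum_(z : 'I_(2 * N)) cellpr h (X i) z * expR (- (((y - gridpt h z) / s) ^+ 2 / 2)) <= K.
  by apply: grid_conc.
(* Two cells that meet the event are separated by two rounding errors and two radii, so the squared
   distance is at most 16 rho^2. Moreover |A|_HS^2 < (r + 1) |A|^2 <= 2 r |A|^2 <= 10 k |A|^2, and
   16 times 10 is 4 times 40. *)
have := finite_small_ball OOt AE A0 s0 p_ge0 p_le1 K0 K_ub K1 (z0 := z0) (G := G)
  (c := 40 * k%:R) kap0 kmu.
rewrite -[40 * _]mulrC expRM_natl; apply.
move=> z Gz.
have close z' : G z' -> exists v w : 'cV[R]_m, [/\ A *m (\col_i gridpt h (z' i)) - u = v + w,
    l2norm v ^+ 2 <= rho ^+ 2 & l2norm w ^+ 2 <= rho ^+ 2].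
  move=> /asboolP[w Ew Cw].
  exists (A *m (\col_i (gridpt h (z' i) - X i w))), (AX w - u); split.
  - rewrite addrA -mulmxDr; congr (A *m _ - _); apply/matrixP => i j; rewrite !mxE; ring.
  - apply: le_trans (l2norm_mul_sqr_le OOt AE _) _.
    rewrite /rho [in leRHS]exprMn mulrC ler_wpM2r ?sqr_ge0//.
    rewrite l2norm_sqr; apply: le_trans (_ : \sum_(i < n) h ^+ 2 <= _).
      apply: ler_sum => i _; rewrite mxE.
      have := Cw i (finset.in_setT i); rewrite /cl /cell /= in_itv/= => /andP[c1 c2].
      rewrite -[leLHS]real_normK ?num_real// ler_pXn2r ?nnegrE ?(ltW h0)//.
      by rewrite ler_norml; apply/andP; split; lra.
    rewrite sumr_const card_ord -[_ *+ n]mulr_natl.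
    apply: le_trans (_ : t ^+ 2 <= _); last first.
      rewrite ler_pXn2r ?nnegrE ?mulr_ge0 ?(ltW t0)//; [|lra].
      by rewrite ler_peMl// ltW.
    rewrite /h expr_div_n mulrCA ler_piMr ?sqr_ge0//.
    rewrite ler_pdivrMr ?exprn_gt0// mul1r.
    apply: (@le_trans _ _ n.+1%:R); first by rewrite ler_nat.
    by rewrite -[leLHS]expr1 ler_weXn2l// ler1n.
  - by rewrite ler_pXn2r ?nnegrE ?l2norm_ge0// ltW.
have [v1 [w1 [e1 hv1 hw1]]] := close z0 Gz0.
have [v2 [w2 [e2 hv2 hw2]]] := close z Gz.
have -> : A *m (\col_i (gridpt h (z0 i) - gridpt h (z i))) = v1 + w1 - v2 - w2.
  have -> : (\col_i (gridpt h (z0 i) - gridpt h (z i))) = (\col_i gridpt h (z0 i)) - (\col_i gridpt h (z i)).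
    by apply/matrixP => i j; rewrite !mxE.
  by rewrite mulmxBr -addrA -opprD -e1 -e2 opprB addrA subrK.
apply: le_trans (_ : 4 * (l2norm v1 ^+ 2 + l2norm w1 ^+ 2 + l2norm v2 ^+ 2 + l2norm w2 ^+ 2) <= _).
  rewrite !l2norm_sqr -!big_split/= mulr_sumr; apply: ler_sum => i _; rewrite !mxE.
  exact: sqr4_le.
have sE : kappa * s ^+ 2 = M ^+ 2 * t ^+ 2.
  by rewrite /s expr_div_n sqr_sqrtr ?(ltW kap0)// mulrC divfK ?gt_eqF// exprMn.
have rE : rho ^+ 2 = M ^+ 2 * t ^+ 2 * hsnorm A ^+ 2 by rewrite /rho !exprMn.
have SL : hsnorm A ^+ 2 <= opnorm A ^+ 2 * (10 * k%:R).
  have /andP[_] := stable_rank_bounds A.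
  rewrite ltr_pdivrMr ?exprn_gt0// => /ltW h1; apply: (le_trans h1).
  rewrite mulrC ler_wpM2l ?sqr_ge0//.
  have := stable_rank_ge1 OOt AE A0; rewrite -(ler_nat R) => r1.
  have : (stable_rank A)%:R <= 5 * k%:R :> R by rewrite -natrM ler_nat.
  rewrite -natr1; lra.
have r2 : rho ^+ 2 <= M ^+ 2 * t ^+ 2 * (opnorm A ^+ 2 * (10 * k%:R)).
  by rewrite rE ler_wpM2l// mulr_ge0 ?sqr_ge0.
have -> : 4 * (opnorm A ^+ 2 * kappa * s ^+ 2) * (k%:R * 40) =
   16 * (M ^+ 2 * t ^+ 2 * (opnorm A ^+ 2 * (10 * k%:R))).
  by rewrite -sE; ring.
lra.
Qed.

End Core.

Lemma le_exprn_limit (R : realType) (x a p : R) (k : nat) :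
  (forall e, 0 < e -> x <= (a * (p + e)) ^+ k) -> x <= (a * p) ^+ k.
Proof.
move=> H.
have c : (fun j => (a * (p + harmonic j)) ^+ k) @ \oo --> (a * p) ^+ k.
  rewrite -{2}[p]addr0.
  apply: (@cvg_comp _ _ _ (fun j => a * (p + harmonic j)) (fun y => y ^+ k)); last exact: exprn_continuous.
  apply: cvgM; first exact: cvg_cst.
  by apply: cvgD; [exact: cvg_cst|exact: cvg_harmonic].
rewrite -(cvg_lim _ c)//; apply: limr_ge; first by apply/cvg_ex; eexists; exact: c.
by apply: nearW => j; apply: H; rewrite invr_gt0.
Qed.

Section Final.
Context (d : measure_display) (T : measurableType d) (R : realType) (P : probability T R).

Lemma concentration1_le (X : {RV P >-> R}) (t p : R) :
  (concentration P (fun w => const_mx (X w) : 'cV[R]_1) t <= p%:E)%E ->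
  forall v, pr P (X @^-1` `[v - t, v + t]) <= p.
Proof.
move=> H v; rewrite -lee_fin -prE; last exact: mX.
apply: le_trans H; apply: ereal_sup_ubound; exists (const_mx v) => //.
congr (P _); apply/seteqP; split => w /=; rewrite in_itv/= /l2norm big_ord1 !mxE sqrtr_sqr ler_norml => /andP[h1 h2];
  by apply/andP; split; lra.
Qed.

(* For [t = 0] the bound at radius 0 gives one at a small positive radius, up to
   [e]; this reduces the theorem to [0 < t]. *)
Lemma concentration_perturb n (X : 'I_n -> {RV P >-> R}) (t p e : R) : 0 <= t -> 0 <= p -> 0 < e ->
  (forall i v, pr P (X i @^-1` `[v - t, v + t]) <= p) ->
  exists2 s, 0 < s /\ t <= s & forall i v, pr P (X i @^-1` `[v - s, v + s]) <= p + e.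
Proof.
move=> t0 p0 e0 H; have [tp|t_le] := ltP 0 t.
  by exists t => // i v; apply: le_trans (H i v) _; rewrite lerDl ltW.
have {t0 t_le} tE : t = 0 by apply/eqP; rewrite eq_le t0 t_le.
have /choice[s sP] : forall i, exists s, 0 < s /\ forall v, pr P (X i @^-1` `[v - s, v + s]) <= p + e.
  move=> i; have [|s s0 sP] := @concentration_zero _ _ _ P (X i) p e p0 e0.
    by move=> u; have := H i u; rewrite tE subr0 addr0.
  by exists s.
pose q := (1 + \sum_i (s i)^-1)^-1.
have si0 i : 0 <= (s i)^-1 by rewrite invr_ge0 ltW//; case: (sP i).
have q0 : 0 < q by rewrite invr_gt0 ltr_wpDr// sumr_ge0.
exists q; first by rewrite tE ltW.
move=> i v; have [s0 h] := sP i; apply: le_trans (h v).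
have qs : q <= s i.
  rewrite -[leRHS]invrK lef_pV2 ?posrE ?invr_gt0//; last by rewrite ltr_wpDr// sumr_ge0.
  by rewrite (bigD1 i)//= addrCA lerDl addr_ge0// sumr_ge0.
apply: pr_le; try by apply: mX.
by move=> w /=; rewrite !in_itv/= => /andP[h1 h2]; apply/andP; split; lra.
Qed.

Lemma main_bound n (X : 'I_n -> {RV P >-> R}) (t p : R) m (A : 'M[R]_(m, n)) (M kappa : R) (k : nat)
   (O : 'M[R]_n) (dd : 'rV[R]_n) :
  mutually_independent X -> 0 <= t -> 0 <= p ->
  (forall i, (concentration P (fun w => const_mx (X i w) : 'cV[R]_1) t <= p%:E)%E) ->
  O *m O^T = 1%:M -> A^T *m A = O^T *m diag_mx dd *m O -> A != 0 -> 1 <= M -> 0 < kappa <= 1 ->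
  k%:R <= \sum_j Num.min (dd 0 j / (opnorm A ^+ 2 * kappa)) 1 ->
  (stable_rank A <= 5 * k)%N ->
  (concentration P (fun w => A *m (\col_(i < n) X i w)) (M * t * hsnorm A)
      <= ((main_const R * M / Num.sqrt kappa * p) ^+ k)%:E)%E.
Proof.
move=> iX t0 p0 H OO AE A0 M1 kap kmu rk.
apply: ge_ereal_sup => _ [u _ <-].
have hs0 := sqrtr_ge0 (\sum_(i < m) \sum_(j < n) A i j ^+ 2); rewrite -/(hsnorm A) in hs0.
have mev := measurable_event X A u.
have r0 : 0 <= M * t * hsnorm A by rewrite !mulr_ge0//; lra.
rewrite (prE _ (mev _ r0)) lee_fin; apply: le_exprn_limit => e e0.
(* [core_prob] asks for a positive radius and a positive probability bound; [s] and [p + e] are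
   positive, and [e] tends to 0 at the end. *)
have [s [s0 ts] sP] := concentration_perturb t0 p0 e0 (fun i => concentration1_le (H i)).
have pe : 0 < p + e by lra.
have rs : M * t * hsnorm A <= M * s * hsnorm A by rewrite ler_wpM2r// ler_wpM2l//; lra.
apply: le_trans (_ : pr P [set w | l2norm (A *m (\col_(i < n) X i w) - u) <= M * s * hsnorm A] <= _).
  apply: pr_le; [exact: mev|apply: mev; exact: le_trans rs|].
  by move=> w /= h; apply: le_trans rs.
have := core_prob iX OO AE A0 u s0 pe sP M1 kap kmu rk.
by congr (_ <= _ ^+ _); rewrite mulrAC.
Qed.

End Final.

Theorem theorem8p1 (R : realType) :
  exists C : R, 0 < C /\
  forall (d : measure_display) (T : measurableType d) (P : probability T R)
    (n : nat) (X : 'I_n -> {RV P >-> R}) (t p : R),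
  mutually_independent X ->
  0 <= t -> 0 <= p ->
  (forall i : 'I_n,
    (concentration P (fun w => const_mx (X i w) : 'cV[R]_1) t <= p%:E)%E) ->
  forall (m : nat) (A : 'M[R]_(m, n)) (M : R),
  A != 0 -> 1 <= M ->
  let AX := fun w : T => A *m (\col_(i < n) X i w) in
  (0 < delta A ->
    (concentration P AX (M * t * hsnorm A)
      <= ((C * M * p / Num.sqrt (delta A)) ^+ stable_rank A)%:E)%E) /\
  (delta A < 2 / 5 ->
    (concentration P AX (M * t * hsnorm A)
      <= ((C * M * p) ^ stable_rank0 A)%:E)%E).
Proof.
have c0 := main_const_gt0 R.
(* The factor 2 bounds 1 / sqrt kappa for kappa = 1/2, the choice in the second estimate; the first
   one takes kappa = [delta A]. *)
exists (2 * main_const R); split; first exact: mulr_gt0.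
move=> d T P n X t p iX t0 p0 H m A M A0 M1 AX.
have Asym : (A^T *m A)^T = A^T *m A by rewrite trmx_mul trmxK.
have [Q [dd [QQ AE]]] := sym_spectral Asym.
have Mp : 0 <= M * p by rewrite mulr_ge0//; lra.
split=> del.
  have /andP[_ del1] := delta01 QQ AE A0.
  have kap : 0 < delta A <= 1 by rewrite del.
  apply: le_trans (main_bound iX t0 p0 H QQ AE A0 M1 kap (stable_rank_sum_min QQ AE A0 del) _) _.
    by rewrite leq_pmull.
  have sd : 0 <= (Num.sqrt (delta A))^-1 by rewrite invr_ge0 sqrtr_ge0.
  pose b := main_const R * (M * p) / Num.sqrt (delta A).
  have b0 : 0 <= b by rewrite /b mulr_ge0// mulr_ge0// ltW.
  have -> : main_const R * M / Num.sqrt (delta A) * p = b by rewrite /b; ring.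
  have -> : 2 * main_const R * M * p / Num.sqrt (delta A) = 2 * b by rewrite /b; ring.
  by rewrite lee_fin; apply: lerXn2r; rewrite ?nnegrE; clearbody b; lra.
have [k [kE rk kmu]] := stable_rank0_sum_min QQ AE A0 del.
have kap : 0 < (2^-1 : R) <= 1 by apply/andP; split; lra.
apply: le_trans (main_bound iX t0 p0 H QQ AE A0 M1 kap kmu rk) _.
rewrite kE lee_fin -exprnP.
have s2 : (Num.sqrt (2^-1 : R))^-1 <= 2.
  rewrite -[leRHS]invrK lef_pV2 ?posrE ?sqrtr_gt0//.
  by rewrite -[leLHS]ger0_norm// -sqrtr_sqr ler_wsqrtr//; lra.
apply: lerXn2r; rewrite ?nnegrE; last first.
- have -> : 2 * main_const R * M * p = (main_const R * (M * p)) * 2 by ring.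
  have -> : main_const R * M / Num.sqrt 2^-1 * p = (main_const R * (M * p)) / Num.sqrt 2^-1 by ring.
  by rewrite ler_wpM2l// mulr_ge0// ltW.
- by rewrite !mulr_ge0 ?(ltW c0)//; lra.
- by rewrite !mulr_ge0 ?invr_ge0 ?sqrtr_ge0 ?(ltW c0)//; lra.
Qed.
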